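(* Let $t\ge1$, $n\ge1$ and $J\subseteq[n-1]$. Then \[\mathrm{ps}\,\beta_n^{(t)}(J)=\frac{\tilde\beta_{B_n^{(t)}(q)}(J)}{\prod_{i=1}^n(1-q^i)^t}.\]
   Context: $B_n^{(t)}$ is the poset of $t$-tuples $(A_1,\ldots,A_t)$ of subsets of $[n]$ with $|A_1|=\cdots=|A_t|$, ordered componentwise by inclusion and graded by the common cardinality, with $\mathfrak{S}_n^{\times t}$ acting coordinatewise. For $J\subseteq[n-1]$, $B_n^{(t)}(J)$ is the subposet of elements of rank in $J$ with bottom and top adjoined, and $\beta_n^{(t)}(J)$ is the product Frobenius characteristic of its top reduced rational homology $\tilde H_{|J|-1}$ as an $\mathfrak{S}_n^{\times t}$-module, where the product Frobenius characteristic of $\sum a_{\boldsymbol\mu}\chi^{\mu^1}\otimes\cdots\otimes\chi^{\mu^t}$ is $\sum a_{\boldsymbol\mu}\prod_js_{\mu^j}(X^j)$ for disjoint variable sets $X^1,\ldots,X^t$. $\mathrm{ps}$ is the stable principal specialisation: each variable set $X^j=(x^j_1,x^j_2,\ldots)$ is replaced by $(1,q,q^2,\ldots)$. $B_n^{(t)}(q)$ is the poset of $t$-tuples of subspaces of $\mathbb{F}_q^n$ of equal dimension, ordered componentwise by inclusion ($q$ a prime power, and the identity is then read as one of polynomials/power series in $q$). For a graded bounded poset $Q$ of rank $n$ and $J\subseteq[n-1]$, $\tilde\alpha_Q(J)$ is the number of maximal chains of the subposet of elements of rank in $J$ with $\hat0,\hat1$, and $\tilde\beta_Q(J)=\sum_{U\subseteq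 J}(-1)^{|J|-|U|}\tilde\alpha_Q(U)$. *)

(* Defs.v *)
From HB Require Import structures.
From mathcomp Require Import all_boot all_order all_algebra all_fingroup.
From mathcomp Require Import mxrepresentation.
From mathcomp.multinomials Require Import mpoly.

Set Implicit Arguments.
Unset Strict Implicit.
Unset Printing Implicit Defensive.

Import GroupScope GRing.Theory.
Local Open Scope ring_scope.

(* A finite graded poset is given by an ambient finite type T, an order le on T
   and its levels L : nat -> {set T}, where L r is the set of elements of
   rank r. *)

Section Chains.

Variables (T : finType) (le : rel T).

Definition chain (c : {set T}) : bool :=
  [forall x in c, forall y in c, le x y || le y x].

Definition max_chains (Q : {set T}) : {set {set T}} :=
  [set c | maxset (fun d : {set T} => (d \subset Q) && chain d) c].

Variables (n : nat) (L : nat -> {set T}).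

Definition rank_sel (J : {set 'I_n}) : {set T} := \bigcup_(r in J) L r.

(* L 0 and L n are the bottom and the top of a bounded poset of rank n. *)
Definition alpha_num (J : {set 'I_n}) : nat :=
  #|max_chains (L 0 :|: rank_sel J :|: L n)|.

Definition beta_num (J : {set 'I_n}) : int :=
  \sum_(U : {set 'I_n} | U \subset J) (-1) ^+ (#|J| - #|U|) * (alpha_num U)%:R.

End Chains.

(* Reduced rational simplicial homology of the order complex of P, as a
   representation of a group acting on P by order automorphisms.  All chain
   spaces live in the space with basis the subsets of T; the complex is
   augmented, the empty chain being the only face of dimension -1, and the
   index k below is the number of elements of a face (dimension k - 1). *)
Section Homology.

Variables (gT : finGroupType) (T : finType) (to : {action gT &-> T}).
Variables (le : rel T) (P : {set T}).

Local Notation N := #|{set T}|.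

Definition face (k : nat) (c : {set T}) : bool :=
  [&& c \subset P, chain le c & #|c| == k].

Definition chain_space (k : nat) : 'M[rat]_N :=
  \matrix_(i, j) ((i == j) && face k (enum_val i))%:R.

(* x_0 < ... < x_(k-1) is sent to the alternating sum over i of the faces
   omitting x_i; the exponent is the position i of x = x_i. *)
Definition face_boundary (c : {set T}) : 'rV[rat]_N :=
  \sum_(x in c) (-1) ^+ #|[set y in c | (y != x) && le y x]|
                *: delta_mx 0 (enum_rank (c :\ x)).

Definition boundary (k : nat) : 'M[rat]_N :=
  \matrix_i (if face k (enum_val i) then face_boundary (enum_val i) else 0).

Definition cycles (k : nat) : 'M[rat]_N :=
  (chain_space k :&: kermx (boundary k))%MS.

Definition boundaries (k : nat) : 'M[rat]_N := boundary k.+1.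

Definition sets_mx (g : gT) : 'M[rat]_N :=
  \matrix_i delta_mx 0 (enum_rank (to^*%act (enum_val i) g)).

Lemma sets_mx_repr : mx_repr [set: gT] sets_mx.
Proof.
split=> [|g h _ _]; apply/row_matrixP=> i.
  by rewrite rowK act1 enum_valK rowE mulmx1.
by rewrite row_mul !rowK -rowE rowK enum_rankK actM.
Qed.

Canonical sets_repr := MxRepresentation sets_mx_repr.

Hypothesis le_act : forall g x y, le (to x g) (to y g) = le x y.
Hypothesis P_act : forall g x, (to x g \in P) = (x \in P).

Lemma chain_act g c : chain le (to^*%act c g) = chain le c.
Proof.
apply/forall_inP/forall_inP => H x cx; apply/forall_inP => y cy.
  have /forall_inP := H _ (imset_f (to^~ g) cx).
  by move/(_ _ (imset_f (to^~ g) cy)); rewrite !le_act.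
case/imsetP: cx => x' cx' ->; case/imsetP: cy => y' cy' ->.
by rewrite !le_act; have /forall_inP/(_ _ cy') := H _ cx'.
Qed.

Lemma face_act k g c : face k (to^*%act c g) = face k c.
Proof.
rewrite /face chain_act (card_imset _ (act_inj to g)); congr (_ && _).
apply/subsetP/subsetP => H x cx.
  by rewrite -(P_act g); apply/H/imset_f.
by case/imsetP: cx => x' /H Px' ->; rewrite P_act.
Qed.

Lemma chain_space_comm k g :
  chain_space k *m sets_mx g = sets_mx g *m chain_space k.
Proof.
have rowC i : row i (chain_space k) = (face k (enum_val i))%:R *: delta_mx 0 i.
  by apply/rowP=> j; rewrite !mxE eqxx /= mulr_natl -mulrnA mulnb [in RHS]eq_sym
                            mulrb andbC; case: ifP => //; case: ifP.
apply/row_matrixP=> i; rewrite !row_mul rowC rowK -scalemxAl -!rowE rowK rowC.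
by rewrite enum_rankK face_act.
Qed.

Lemma boundary_comm k g : boundary k *m sets_mx g = sets_mx g *m boundary k.
Proof.
apply/row_matrixP=> i; rewrite !row_mul !rowK -rowE rowK enum_rankK face_act.
case: ifP => _; last by rewrite mul0mx.
rewrite /face_boundary; set c := enum_val i.
have toI := act_inj to g.
rewrite mulmx_suml big_imset /=; last by move=> x y _ _; apply: toI.
apply: eq_bigr => x cx; rewrite -scalemxAl -rowE rowK enum_rankK.
congr (_ ^+ _ *: delta_mx 0 (enum_rank _)); last first.
  apply/setP=> y; rewrite !inE; apply/imsetP/andP => [[z]|[yx /imsetP[z cz yE]]].
    by rewrite !inE => /andP[zx cz] ->; rewrite (inj_eq toI) zx; split=> //;
      apply: imset_f.
  by exists z; rewrite // !inE cz andbT; apply: contraNneq yx => <-; rewrite yE.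
rewrite -(card_imset _ toI); apply: eq_card => y; rewrite [RHS]inE.
apply/imsetP/andP => [[z]|[/imsetP[z cz ->]]].
  by rewrite inE => /andP[cz ?] ->; rewrite (inj_eq toI) le_act; split=> //;
    apply: imset_f.
by rewrite (inj_eq toI) le_act => ?; exists z; rewrite // inE cz.
Qed.

Lemma cycles_module k : mxmodule sets_repr (cycles k).
Proof.
apply: capmx_module; apply/mxmoduleP => g _ /=.
  by rewrite chain_space_comm submxMl.
apply/sub_kermxP; rewrite -mulmxA -boundary_comm mulmxA.
by rewrite mulmx_ker mul0mx.
Qed.

Lemma boundaries_module k : mxmodule sets_repr (boundaries k).
Proof. by apply/mxmoduleP => g _ /=; rewrite boundary_comm submxMl. Qed.

Definition homology_repr (k : nat) :=
  section_repr (boundaries_module k) (cycles_module k).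

Definition homology_char (k : nat) (g : gT) : rat := \tr (homology_repr k g).

End Homology.

Notation tuples_perm t n := {dffun forall _ : 'I_t, {perm 'I_n}}.

Section TuplesOfSubsets.

Variables t n : nat.

Local Notation elt := {ffun 'I_t -> {set 'I_n}}.

Definition Ble : rel elt := [rel A B : elt | [forall j, A j \subset B j]].

Definition Blevel (r : nat) : {set elt} := [set A : elt | [forall j, #|A j| == r]].

Definition Bact_fun (A : elt) (w : tuples_perm t n) : elt :=
  [ffun j => w j @: A j].

Lemma Bact_is_action : is_action [set: tuples_perm t n] Bact_fun.
Proof.
split=> [w A B /ffunP eqAB|A w1 w2 _ _].
  apply/ffunP=> j; have := eqAB j; rewrite !ffunE.
  exact/imset_inj/perm_inj.
apply/ffunP=> j; rewrite !ffunE -imset_comp; apply: eq_imset => x /=.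
by rewrite permM.
Qed.

Canonical Bact := Action Bact_is_action.

Lemma Ble_act w A B : Ble (Bact A w) (Bact B w) = Ble A B.
Proof.
apply/forallP/forallP => H j; move: (H j); rewrite !ffunE.
  move/subsetP=> sAB; apply/subsetP=> x /(imset_f (w j))/sAB.
  by rewrite mem_imset //; apply: perm_inj.
exact: imsetS.
Qed.

Lemma Brank_sel_act (J : {set 'I_n}) w A :
  (Bact A w \in rank_sel Blevel J) = (A \in rank_sel Blevel J).
Proof.
have levE r : (Bact A w \in Blevel r) = (A \in Blevel r).
  rewrite !inE; apply: eq_forallb => j; rewrite ffunE card_imset //.
  exact: perm_inj.
by apply/bigcupP/bigcupP => -[r Jr]; rewrite ?levE => Ar; exists r;
  rewrite // ?levE.
Qed.

Definition top_homology_char (J : {set 'I_n}) : tuples_perm t n -> rat :=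
  homology_char Ble_act (Brank_sel_act J) #|J|.

End TuplesOfSubsets.

Section FiniteVspace.
Import VectorInternalTheory.
HB.instance Definition _ (F : finFieldType) (vT : vectType F) :=
  [Countable of {vspace vT} by <:].
HB.instance Definition _ (F : finFieldType) (vT : vectType F) :=
  [Finite of {vspace vT} by <:].
End FiniteVspace.

Section TuplesOfSubspaces.

Variables (F : finFieldType) (t n : nat).

Local Notation elt := {ffun 'I_t -> {vspace 'rV[F]_n}}.

Definition Bqle : rel elt := [rel A B : elt | [forall j, (A j <= B j)%VS]].

Definition Bqlevel (r : nat) : {set elt} :=
  [set A : elt | [forall j, \dim (A j) == r]].

End TuplesOfSubspaces.

(* Partitions of n, padded with zeros to length n. *)
Definition is_part (n : nat) (mu : n.-tuple 'I_n.+1) : bool :=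
  sorted geq (map val mu) && (sumn (map val mu) == n).

Definition intpart (n : nat) : Type := {mu : n.-tuple 'I_n.+1 | is_part mu}.
HB.instance Definition _ n := Finite.on (intpart n).

Section Young.

Variables (n : nat) (mu : intpart n).

(* The boxes of the diagram of mu are numbered 0, ..., n - 1 row by row. *)
Definition shape_of : seq nat := map val (val mu).
Definition brow (i : 'I_n) : nat := reshape_index shape_of i.
Definition bcol (i : 'I_n) : nat := reshape_offset shape_of i.

Definition row_stab : {set {perm 'I_n}} :=
  [set p : {perm 'I_n} | [forall i, brow (p i) == brow i]].
Definition col_stab : {set {perm 'I_n}} :=
  [set p : {perm 'I_n} | [forall i, bcol (p i) == bcol i]].

(* c = (sum of the p in row_stab) (sum of the sgn(s) s for s in col_stab) in the
   group algebra; as (s * p) x = p (s x) for permutations, s * p is the usual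
   composite p s, and the right regular representation is the usual left one.
   The submodule generated by c is the Specht module. *)
Definition young_symmetrizer : 'rV[rat]_#|[set: {perm 'I_n}]| :=
  \sum_(p in row_stab) \sum_(s in col_stab)
    (-1) ^+ odd_perm s *: delta_mx 0 (gring_index [set: {perm 'I_n}]%G (s * p)%g).

Definition specht_repr :=
  submod_repr (cyclic_mx_module (regular_repr rat [set: {perm 'I_n}])
                                young_symmetrizer).

Definition specht_char (w : {perm 'I_n}) : rat := \tr (specht_repr w).

Definition is_ssyt (N : nat) (T : {ffun 'I_n -> 'I_N}) : bool :=
  [forall i, forall k,
    ((brow i == brow k) && (bcol i < bcol k)%N ==> (T i <= T k)%N) &&
    ((bcol i == bcol k) && (brow i < brow k)%N ==> (T i < T k)%N)].

Definition schur (R : comNzRingType) (N : nat) (x : 'I_N -> R) : R :=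
  \sum_(T : {ffun 'I_n -> 'I_N} | is_ssyt T) \prod_i x (T i).

End Young.

(* A symmetric function in t sets of variables, given by its restrictions to the
   first N variables of each set, for all N; x^j_i is the variable of index
   mxvec_index j i. *)
Definition symfun (t : nat) : Type := forall N : nat, {mpoly rat[t * N]}.

Definition is_prod_frob (t n : nat) (phi : tuples_perm t n -> rat)
    (f : symfun t) : Prop :=
  exists a : {ffun 'I_t -> intpart n} -> rat,
    (forall w, phi w = \sum_mu a mu * \prod_j specht_char (mu j) (w j)) /\
    (forall N, f N = \sum_mu a mu *:
       \prod_j schur (mu j) (fun i : 'I_N => 'X_(mxvec_index j i))).

(* Power series in q, by their coefficients. *)
Definition series : Type := nat -> rat.

Definition ser_mul (f g : series) : series :=
  fun m => \sum_(i < m.+1) f i * g (m - i)%N.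

Fixpoint ser_inv_seq (f : series) (m : nat) : seq rat :=
  if m is k.+1 then
    let s := ser_inv_seq f k in
    rcons s (((k == 0)%N%:R - \sum_(i < k) f (k - i)%N * s`_i) / f 0%N)
  else [::].

Definition ser_inv (f : series) : series := fun m => (ser_inv_seq f m.+1)`_m.

Definition ser_div (f g : series) : series := ser_mul f (ser_inv g).

Definition ser_of_poly (p : {poly rat}) : series := fun m => p`_m.

(* x^j_i := q^i for i < N. *)
Definition ps_trunc (t N : nat) (f : {mpoly rat[t * N]}) : {poly rat} :=
  mmap polyC (mxvec (\matrix_(j < t, i < N) ('X^i : {poly rat})) 0) f.

(* g is the limit of f(1, q, ..., q^(N-1)) as N tends to infinity, for the
   q-adic topology. *)
Definition is_ps (t : nat) (f : symfun t) (g : series) : Prop :=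
  forall m : nat, exists N0 : nat, forall N : nat, (N0 <= N)%N ->
    (ps_trunc (f N))`_m = g m.

(* Main.v *)
Require Import Defs.
From HB Require Import structures.
From mathcomp Require Import all_boot all_order all_algebra all_fingroup.
From mathcomp Require Import mxrepresentation.
From mathcomp Require Import pgroup finfield zify ring.
From mathcomp.multinomials Require Import mpoly.

Set Implicit Arguments.
Unset Strict Implicit.
Unset Printing Implicit Defensive.

Import GroupScope GRing.Theory.
Local Open Scope ring_scope.

(** A cycle of top degree is a combination of J-flags whose coefficients sum to
    zero over the J-flags that contain any given (J \ i)-flag, so the top
    homology is the orthogonal complement of the sum of the W_(J \ i) in W_J,
    where W_U is the space of functions on S_n^t that factor through the U-flags.
    The indicators of the cosets v Y_(D(v)), with D(v) the union of the descent
    sets of the components of v, form a basis of the functions on S_n^t for which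
    every W_U is spanned by the basis vectors with D(v) contained in U; by Moebius
    inversion the character of the top homology is
    sum_(U <= J) (-1)^|J \ U| prod_j psi_U(w_j), psi_U being the permutation
    character of S_n on the U-flags of [n].

    Young's rule (the multiplicity of a Specht module in a space of words is a
    number of semistandard tableaux, by Garnir straightening and a leading term
    argument) gives s_mu(1, q, ..., q^(N-1)) = 1/n! sum_w chi_mu(w) pi_w(q), where
    pi_w counts the words fixed by w.  Hence the specialisation of any Frobenius
    characteristic of phi is the average of phi(w) prod_j pi_(w_j), whatever the
    chosen expansion of phi.  Burnside's lemma turns the average of psi_U pi_w
    into a count of words that increase along the blocks of U, whose limit is the
    q-multinomial coefficient of U divided by prod_(i <= n) (1 - q^i).  Finally
    the t-th power of this q-multinomial coefficient counts the maximal chains of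
    the rank selection U of the poset of t-tuples of subspaces. *)


(** * Rearrangement within blocks *)

(** Two mechanisms carry the linear algebra. Among the rearrangements of a word within blocks, the
    sum of the [a i * f i] is largest exactly at the block-sorted word; applied to rows and columns
    of a diagram, and to the blocks of a flag, this makes the bideterminants of tableaux and the
    coset indicators triangular. The Specht module is only given as the module generated by a
    symmetrizer, so its pairing with another character is computed as a rank: Maschke yields an
    idempotent generating the same module, and the trace of an idempotent is its rank. The two sides
    of the identity meet in one statistic: [tailsize U i] is the exponent of the i-th factor in the
    generating function of block-sorted words, and also the gap from [i] to the next selected rank
    when bases adapted to a flag of subspaces are counted. Divisions are postponed: integrality of
    the polynomial rests on q-multinomials built by the q-Pascal rule, counts are stated as
    products, and the limit is an equality of all coefficients below the number of letters. *)

Section BlockSorting.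

Variables (I : finType) (B : eqType) (blk : I -> B) (a : I -> nat).

Definition block_sorted (f : I -> nat) : bool :=
  [forall i, forall j, (blk i == blk j) && (a i < a j)%N ==> (f i <= f j)%N].

Definition block_perm (y : {perm I}) : bool := [forall i, blk (y i) == blk i].

Lemma block_sortedP f :
  reflect (forall i j, blk i = blk j -> (a i < a j)%N -> (f i <= f j)%N)
          (block_sorted f).
Proof.
apply: (iffP idP) => [sf i j eij lij|sf].
  by move/forallP: sf => /(_ i)/forallP/(_ j); rewrite eij eqxx lij.
by apply/forallP=> i; apply/forallP=> j; apply/implyP=> /andP[/eqP]; apply: sf.
Qed.

Lemma block_permP (y : {perm I}) : reflect (forall i, blk (y i) = blk i) (block_perm y).
Proof. by apply: (iffP forallP) => H i; apply/eqP. Qed.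

Lemma block_perm1 : block_perm 1.
Proof. by apply/block_permP => i; rewrite perm1. Qed.

Lemma block_permM (y z : {perm I}) : block_perm y -> block_perm z -> block_perm (y * z).
Proof.
move=> /block_permP hy /block_permP hz; apply/block_permP => i.
by rewrite permM hz hy.
Qed.

Lemma block_permV (y : {perm I}) : block_perm y -> block_perm y^-1.
Proof.
by move=> /block_permP hy; apply/block_permP => i; rewrite -hy permKV.
Qed.

Lemma block_perm_tperm i j : blk i = blk j -> block_perm (tperm i j).
Proof. by move=> eij; apply/block_permP=> k; case: tpermP => // ->. Qed.

Lemma block_perm_group_set : group_set [set y | block_perm y].
Proof.
apply/group_setP; split=> [|y z]; rewrite !inE; first exact: block_perm1.
exact: block_permM.
Qed.

Canonical block_perm_group := Group block_perm_group_set.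

Lemma sum_swap_lt (f : I -> nat) i j : (a i < a j)%N -> (f j < f i)%N ->
  (\sum_k a k * f k < \sum_k a k * f (tperm i j k))%N.
Proof.
move=> lij lf; have nij : j != i by apply: contraTneq lij => ->; rewrite ltnn.
rewrite (bigD1 i) //= (bigD1 j) //= [X in (_ < X)%N](bigD1 i) //=.
rewrite [X in (_ < _ + X)%N](bigD1 j) //= tpermL tpermR !addnA.
rewrite (eq_bigr (fun k => a k * f (tperm i j k))%N) => [|k /andP[ki kj]].
  rewrite ltn_add2r; nia.
by rewrite tpermD // eq_sym.
Qed.

Hypothesis a_inj : forall i j, blk i = blk j -> a i = a j -> i = j.

(** Within a block, the positions with value at most [c] form an initial segment for [a], for [f] as
    for [f \o y], and [y] matches the two. By [a_inj] the order is total, so initial segments of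
    equal size coincide. *)
Lemma block_sorted_unique (f : I -> nat) (y : {perm I}) :
  block_perm y -> block_sorted f -> block_sorted (f \o y) -> f \o y =1 f.
Proof.
move=> /block_permP py /block_sortedP sf /block_sortedP sfy x.
pose S c := [set i | (blk i == blk x) && (f i <= c)%N].
pose S' c := [set i | (blk i == blk x) && (f (y i) <= c)%N].
have cardS c : #|S c| = #|S' c|.
  rewrite -(card_imset (mem (S' c)) (@perm_inj _ y)); apply: eq_card => i.
  apply/idP/imsetP => [|[j]]; rewrite !inE; last first.
    by move=> /andP[bj fj] ->; rewrite py bj.
  by exists (y^-1%g i); rewrite ?permKV // inE permKV -py permKV.
have eqS c : S c = S' c.
  have [sub|/subsetPn[i]] := boolP (S c \subset S' c).
    by apply/eqP; rewrite eqEcard sub cardS leqnn.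
  rewrite !inE => /andP[bi fi]; rewrite bi /= => nfi.
  apply/esym/eqP; rewrite eqEcard cardS leqnn andbT.
  apply/subsetP=> j; rewrite !inE => /andP[bj fj]; rewrite bj /=.
  have bij : blk i = blk j by rewrite (eqP bi) (eqP bj).
  have [lij|lji|eij] := ltngtP (a i) (a j).
  - by case/negP: nfi; apply: leq_trans (sfy _ _ bij lij) fj.
  - by apply: leq_trans fi; apply: sf.
  by rewrite -(a_inj bij eij).
apply/eqP; rewrite eqn_leq /=; apply/andP; split.
  by have /setP/(_ x) := eqS (f x); rewrite !inE eqxx leqnn /= => <-.
by have /setP/(_ x) := eqS (f (y x)); rewrite !inE eqxx leqnn /= => ->.
Qed.

Lemma max_block_sorted (f : I -> nat) (y : {perm I}) : block_perm y ->
    (forall z, block_perm z -> (\sum_i a i * f (z i) <= \sum_i a i * f (y i))%N) ->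
  block_sorted (f \o y).
Proof.
move=> py max_y; apply/block_sortedP => i j bij lij; rewrite leqNgt.
apply/negP => lf; have := sum_swap_lt lij lf.
rewrite ltnNge => /negP; apply; rewrite /=.
have := max_y _ (block_permM (block_perm_tperm bij) py).
by congr (_ <= _)%N; apply: eq_bigr => k _; rewrite permM.
Qed.

Lemma ex_block_sorted (f : I -> nat) : exists2 y, block_perm y &
  block_sorted (f \o y) /\
  forall z, block_perm z -> (\sum_i a i * f (z i) <= \sum_i a i * f (y i))%N.
Proof.
pose F (z : {perm I}) := (\sum_i a i * f (z i))%N.
case: (@arg_maxnP _ 1%g block_perm F block_perm1) => y py max_y.
by exists y => //; split=> //; apply: max_block_sorted.
Qed.

(** The maximum over block permutations is attained at a sorted rearrangement, which agrees with [f]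
    by uniqueness. *)
Lemma block_rearrangement (f : I -> nat) (y : {perm I}) : block_sorted f -> block_perm y ->
  (\sum_i a i * f (y i) <= \sum_i a i * f i)%N.
Proof.
move=> sf py; have [z pz [sz max_z]] := ex_block_sorted f.
have := max_z _ py; congr (_ <= _)%N; apply: eq_bigr => i _.
by have /= -> := block_sorted_unique pz sf sz i.
Qed.

Lemma block_rearrangement_eq (f : I -> nat) (y : {perm I}) : block_sorted f -> block_perm y ->
  (\sum_i a i * f i <= \sum_i a i * f (y i))%N -> f \o y =1 f.
Proof.
move=> sf py le; apply: block_sorted_unique => //.
apply: max_block_sorted => // z pz; apply: leq_trans le.
exact: block_rearrangement.
Qed.

End BlockSorting.

(** Among the indices with nonzero coefficient take one with [m] maximal: in the equation at its
    [k], only its own term survives. *)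
Lemma triangular_eq0 (R : idomainType) (I K : finType) (P : pred I) (x : I -> R)
    (k : I -> K) (m : I -> nat) (M : I -> K -> R) :
  (forall i, P i -> M i (k i) != 0) ->
  (forall i j, P i -> P j -> M i (k j) != 0 -> i = j \/ (m j < m i)%N) ->
  (forall j, P j -> \sum_(i | P i) x i * M i (k j) = 0) ->
  forall i, P i -> x i = 0.
Proof.
move=> Mii Mij sum0 i0 Pi0; apply/eqP/negPn/negP => nz0.
pose Q i := P i && (x i != 0).
have Q0 : Q i0 by rewrite /Q Pi0.
case: (@arg_maxnP _ i0 Q m Q0) => i /andP[Pi nzi] maxi.
have := sum0 i Pi; rewrite (bigD1 i) //= big1 ?addr0 => [/eqP|j /andP[Pj ji]].
  by rewrite mulf_eq0 (negPf nzi) (negPf (Mii i Pi)).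
apply/eqP; rewrite mulf_eq0; apply/orP.
have [_|nzj] := eqVneq (x j) 0; [by left | right].
apply/negPn/negP => /(Mij _ _ Pj Pi)[/eqP|]; first by rewrite (negPf ji).
by rewrite ltnNge => /negP; apply; apply: maxi; rewrite /Q Pj.
Qed.

(** * Traces and cyclic modules *)

Section TraceLemmas.

Variable F : fieldType.

(** Rank factorisation: [E] is [col_base E] times [row_base E], and idempotency makes the product in
    the other order the identity. *)
Lemma mxtrace_idem n (E : 'M[F]_n) : E *m E = E -> \tr E = (\rank E)%:R.
Proof.
move=> EE; suff RC : row_base E *m col_base E = 1%:M.
  by rewrite -{1}(mulmx_base E) mxtrace_mulC RC mxtrace1.
have /row_fullP[D DC] : row_full (col_base E) by exact: col_base_full.
have /row_freeP[D' RD] : row_free (row_base E) by exact: row_base_free.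
set C := col_base E in DC *; set R := row_base E in RD *.
have CR : C *m R = E by apply: mulmx_base.
have : D *m (C *m R *m (C *m R)) *m D' = D *m (C *m R) *m D' by rewrite CR EE.
by clearbody C R; rewrite !mulmxA DC !mul1mx -(mulmxA _ R) RD !mulmx1.
Qed.

(** The change of basis and its inverse have formally rectangular shapes; the one-sided identity for
    [M' *m M] is enough because the trace is cyclic. *)
Lemma mxtrace_basis n m1 m2 (R1 : 'M[F]_(m1, n)) (R2 : 'M[F]_(m2, n))
    (g : 'M[F]_n) h1 h2 :
  row_free R1 -> row_free R2 -> (R1 :=: R2)%MS ->
  R1 *m g = h1 *m R1 -> R2 *m g = h2 *m R2 -> \tr h1 = \tr h2.
Proof.
move=> free1 free2 eqR gR1 gR2.
have /submxP[M R1E] : (R1 <= R2)%MS by rewrite eqR.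
have /submxP[M' R2E] : (R2 <= R1)%MS by rewrite eqR.
have M'M : M' *m M = 1%:M.
  by apply: (row_free_inj free2); rewrite -mulmxA -R1E -R2E mul1mx.
have -> : h1 = M *m h2 *m M'.
  apply: (row_free_inj free1).
  by rewrite -gR1 {1}R1E -mulmxA gR2 -!mulmxA -R2E mulmxA.
by rewrite -mulmxA mxtrace_mulC -mulmxA M'M mulmx1.
Qed.

Variables (gT : finGroupType) (G : {group gT}).

Lemma mxtrace_submod n (rG : mx_representation F G n) (U : 'M_n)
    (modU : mxmodule rG U) m (R : 'M_(m, n)) h g :
  g \in G -> row_free R -> (R :=: U)%MS -> R *m rG g = h *m R ->
  \tr (submod_repr modU g) = \tr h.
Proof.
move=> Gg freeR eqRU gR.
have eqV : (val_submod (1%:M : 'M_(\rank U)) :=: R)%MS.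
  exact: eqmx_trans (val_submod1 U) (eqmx_sym eqRU).
apply: (mxtrace_basis (R1 := val_submod (1%:M : 'M_(\rank U))) _ freeR eqV _ gR).
  by rewrite /row_free val_submod1.
by rewrite -[X in X = _](val_submodJ modU 1%:M Gg) mul1mx [LHS]val_submodE.
Qed.

(** [P] is a coordinate map followed by a basis [R] of [U], and [R] followed by the coordinates is
    the identity. *)
Lemma mxtrace_submod_proj n (rG : mx_representation F G n) (U : 'M_n)
    (modU : mxmodule rG U) (P : 'M_n) g :
  g \in G -> (P <= U)%MS -> (forall u : 'rV_n, (u <= U)%MS -> u *m P = u) ->
  \tr (submod_repr modU g) = \tr (P *m rG g).
Proof.
move=> Gg sPU idP.
set R := val_submod (1%:M : 'M_(\rank U)).
have freeR : row_free R by rewrite /row_free val_submod1.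
have gR : R *m rG g = submod_repr modU g *m R.
  by rewrite -[X in X = _](val_submodJ modU 1%:M Gg) mul1mx [LHS]val_submodE.
have RP : R *m P = R.
  apply/row_matrixP => i; rewrite row_mul idP //.
  by apply: submx_trans (row_sub _ _) _; rewrite val_submod1.
have PE : P = in_submod U P *m R by rewrite -val_submodE in_submodK.
have RP1 : R *m in_submod U P = 1%:M.
  by apply: (row_free_inj freeR); rewrite -mulmxA -PE RP mul1mx.
by rewrite PE -mulmxA gR mulmxA [RHS]mxtrace_mulC mulmxA RP1 mul1mx.
Qed.

End TraceLemmas.

Section CyclicCharacter.

Variables (gT : finGroupType).
Local Notation G := [set: gT]%G.
Local Notation aG := (regular_repr rat G).
Local Notation idx := (gring_index G).

Lemma regular_coef (x : 'rV[rat]_(gcard G)) h g :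
  (x *m aG h) 0 (idx g) = x 0 (idx (g * h^-1)%g).
Proof.
rewrite mxE (bigD1 (idx (g * h^-1)%g)) //= big1 ?addr0 => [|i ni].
  by rewrite mxE gring_indexK ?inE // mulgKV mxE !eqxx mulr1.
rewrite mxE mxE eqxx /=; case: eqP => [eq_idx|]; last by rewrite mulr0.
case/eqP: ni; rewrite -[LHS](gring_valK i); congr (idx _).
have := congr1 enum_val eq_idx.
by rewrite !gring_indexK ?inE // => ->; rewrite mulgK.
Qed.

Lemma gring_mxE n (rG : mx_representation rat G n) (x : 'rV[rat]_(gcard G)) :
  gring_mx rG x = \sum_g x 0 (idx g) *: rG g.
Proof.
rewrite /gring_mx /= mulmx_sum_row linear_sum /=.
rewrite (reindex idx) /=; last first.
  by exists enum_val => i _; [apply: gring_indexK; rewrite inE | apply: gring_valK].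
by apply: eq_bigr => g _; rewrite linearZ /= rowK mxvecK gring_indexK ?inE.
Qed.

(** The left side is the group order times the dimension of the homomorphisms from the cyclic module
    to that of [rG]. An idempotent [e] generating the same module acts with the rank of [c], and its
    trace is this rank. *)
Theorem cyclic_character_rank (c : 'rV[rat]_(gcard G)) n
    (rG : mx_representation rat G n) :
  \sum_g \tr (submod_repr (cyclic_mx_module aG c) g) * \tr (rG g^-1)%g =
  #|gT|%:R * (\rank (gring_mx rG c))%:R.
Proof.
set U := cyclic_mx aG c; set modU := cyclic_mx_module aG c.
have charG : [pchar rat]^'.-group G.
  by rewrite /pgroup pcharf'_nat Num.Theory.pnatr_eq0 -lt0n cardG_gt0.
have [W modW defUW dxUW] := mx_Maschke_pchar aG charG modU (submx1 U).
have dx0 : (U :&: W = 0)%MS by apply/mxdirect_addsP.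
pose P := proj_mx U W.
have PU m (X : 'M_(m, _)) : (X *m P <= U)%MS by apply: proj_mx_sub.
have idP m (X : 'M_(m, _)) : (X <= U)%MS -> X *m P = X by apply: proj_mx_id.
(* Both summands are stable, so the projection along [W] is a module map. *)
have commP g : P *m aG g = aG g *m P.
  have sum1 : (1%:M <= U + W)%MS by rewrite defUW.
  have split1 : P + proj_mx W U = 1%:M.
    by rewrite -[P]mul1mx -[proj_mx W U]mul1mx add_proj_mx.
  rewrite -[aG g in RHS]mul1mx -split1 mulmxDl mulmxDl idP; last first.
    by rewrite (mxmodule_trans modU) ?inE // -[P]mul1mx PU.
  rewrite [X in _ + X]proj_mx_0 ?addr0 // (mxmodule_trans modW) ?inE //.
  by rewrite -[proj_mx W U]mul1mx proj_mx_sub.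
have commPa x : P *m gring_mx aG x = gring_mx aG x *m P.
  rewrite gring_mxE mulmx_suml mulmx_sumr; apply: eq_bigr => g _.
  by rewrite -scalemxAr -scalemxAl commP.
pose d1 : 'rV[rat]_(gcard G) := delta_mx 0 (idx 1%g).
pose e := d1 *m P.
have d1E x : d1 *m gring_mx aG x = x by rewrite -rowE; apply: gring_mxK.
(* As [P] commutes with right multiplications, it is left multiplication by the image [e] of the
   unit. *)
have xP x : x *m P = e *m gring_mx aG x.
  by rewrite -{1}(d1E x) -mulmxA -commPa mulmxA.
have [A RA eE] := cyclic_mxP (PU _ d1 : e <= U)%MS.
(* Each of [e] and [c] is a right multiple of the other, so they act with the same rank. *)
have rank_e : \rank (gring_mx rG e) = \rank (gring_mx rG c).
  have ge : gring_mx rG e = gring_mx rG c *m gring_mx rG (gring_row A).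
    by rewrite eE -{1}(gring_rowK RA) gring_mxA.
  have gc : gring_mx rG c = gring_mx rG e *m gring_mx rG c.
    by rewrite -gring_mxA -xP idP ?cyclic_mx_id.
  by apply/eqP; rewrite eqn_leq {1}ge mxrankM_maxl /= {1}gc mxrankM_maxl.
have idem_e : gring_mx rG e *m gring_mx rG e = gring_mx rG e.
  by rewrite -gring_mxA -xP idP // PU.
transitivity (#|gT|%:R * \tr (gring_mx rG e)); last first.
  by rewrite mxtrace_idem // rank_e.
(* In the basis of group elements, the diagonal entry at [g] is the coefficient of [e] at a
   conjugate of the inverse of [w]. *)
have trP w : \tr (submod_repr modU w) =
             \sum_g e 0 (idx (g * w^-1 * g^-1)%g).
  have sPU : (P <= U)%MS by rewrite -[P]mul1mx PU.
  rewrite (mxtrace_submod_proj modU (in_setT w) sPU (@idP _)).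
  rewrite /mxtrace (reindex idx) /=; last first.
    exists enum_val => i _; last exact: gring_valK.
    by apply: gring_indexK; rewrite inE.
  apply: eq_bigr => g _.
  have -> : (P *m aG w) (idx g) (idx g) = (row (idx g) P *m aG w) 0 (idx g).
    by rewrite -row_mul [RHS]mxE.
  have -> : row (idx g) P = e *m aG g.
    rewrite -[e *m _]mulmxA commP [RHS]mulmxA rowE; congr mulmx.
    by rewrite -[RHS]rowE rowK gring_indexK ?inE // mul1g.
  by rewrite !regular_coef.
under eq_bigr do rewrite trP mulr_suml.
rewrite exchange_big /= mulr_natl -[RHS]sumr_const; apply: eq_bigr => g _.
(* Inverting and then conjugating the summation variable frees the coefficient of [e] from [g], so
   all the inner sums equal the trace of [e]. *)
rewrite (reindex_inj invg_inj) (reindex_inj (conjg_inj g)) /=.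
rewrite gring_mxE raddf_sum; apply: eq_bigr => w _ /=.
rewrite linearZ /= invgK conjgE !mulgA mulgV mul1g mulgK; congr (_ * _).
rewrite !repr_mxM ?inE // -mulmxA mxtrace_mulC -mulmxA -repr_mxM ?inE //.
by rewrite mulgV repr_mx1 mulmx1.
Qed.

End CyclicCharacter.

(** * Young's rule *)

Section YoungDiagram.

Variables (n : nat) (mu : intpart n).
Local Notation sh := (shape_of mu).
Local Notation brow := (brow mu).
Local Notation bcol := (bcol mu).

Lemma size_shape : size sh = n.
Proof. by rewrite size_map size_tuple. Qed.

Lemma sumn_shape : sumn sh = n.
Proof. by have /andP[_ /eqP] := valP mu. Qed.

Lemma shape_anti r r' : (r <= r')%N -> (nth 0%N sh r' <= nth 0%N sh r)%N.
Proof.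
move=> le; have [lt|ge] := ltnP r' n; last by rewrite nth_default ?size_shape.
have /andP[srt _] := valP mu.
apply: (sorted_leq_nth _ _ _ srt) => //; rewrite ?inE ?size_shape //.
- by move=> x y z xy yz; apply: leq_trans xy.
- exact: leqnn.
exact: leq_ltn_trans lt.
Qed.

Lemma brow_lt (i : 'I_n) : (brow i < n)%N.
Proof. by rewrite -[X in (_ < X)%N]size_shape reshape_indexP // sumn_shape. Qed.

Lemma bcol_lt (i : 'I_n) : (bcol i < nth 0%N sh (brow i))%N.
Proof. by rewrite reshape_offsetP // sumn_shape. Qed.

Lemma cell_inj (i j : 'I_n) : brow i = brow j -> bcol i = bcol j -> i = j.
Proof.
move=> er ec; apply: val_inj => /=.
by rewrite -(reshape_indexK sh i) -(reshape_indexK sh j) -/(brow i) -/(bcol i) er ec.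
Qed.

Lemma cell_ex r c : (c < nth 0%N sh r)%N ->
  exists2 i : 'I_n, brow i = r & bcol i = c.
Proof.
move=> lt; have := flatten_indexP lt; rewrite sumn_shape => ltn.
exists (Ordinal ltn); first exact: flatten_indexKl.
exact: flatten_indexKr.
Qed.

Lemma cell_sub (i : 'I_n) r c : (r <= brow i)%N -> (c <= bcol i)%N ->
  exists2 k : 'I_n, brow k = r & bcol k = c.
Proof.
move=> ler lec; apply: cell_ex; apply: leq_ltn_trans lec _.
exact: leq_trans (bcol_lt i) (shape_anti ler).
Qed.

Lemma ssytP N (T : {ffun 'I_n -> 'I_N}) : reflect
  ((forall i k, brow i = brow k -> (bcol i < bcol k)%N -> (T i <= T k)%N) /\
   (forall i k, bcol i = bcol k -> (brow i < brow k)%N -> (T i < T k)%N))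
  (is_ssyt mu T).
Proof.
apply: (iffP forallP) => [H|[Hr Hc] i].
  split=> i k e l; have /forallP/(_ k)/andP[] := H i.
    by rewrite e eqxx l.
  by rewrite [bcol i]e eqxx l.
apply/forallP => k; apply/andP; split; apply/implyP=> /andP[/eqP].
  exact: Hr.
exact: Hc.
Qed.

Definition row_of (i : 'I_n) : 'I_n := Ordinal (brow_lt i).

(* Garnir's pigeonhole: the union below has more cells than column [bcol x]. *)
Definition garnir_set (x y : 'I_n) : {set 'I_n} :=
  [set z | (bcol z == bcol x) && (brow x <= brow z)%N]
  :|: [set z | (bcol z == bcol y) && (brow z <= brow y)%N].

(** A column permutation leaves each cell of the Garnir set in column [bcol x] or to the right of
    it, hence in a row that meets column [bcol x]. There are fewer such rows than cells. *)
Lemma garnir_collision (x y : 'I_n) (s : {perm 'I_n}) :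
    brow x = brow y -> (bcol x < bcol y)%N -> s \in col_stab mu ->
  exists u v, [/\ u \in garnir_set x y, v \in garnir_set x y, u != v &
                  brow (s u) = brow (s v)].
Proof.
move=> exy lxy; rewrite inE => /forallP sC.
set X := [set z | (bcol z == bcol x) && (brow x <= brow z)%N].
set Y := [set z | (bcol z == bcol y) && (brow z <= brow y)%N].
pose Z := [set z | bcol z == bcol x].
have injr c (A : {set 'I_n}) : {in A, forall z, bcol z = c} ->
    #|row_of @: A| = #|A|.
  move=> Ac; rewrite card_in_imset // => z z' Az Az' /(congr1 val) /= er.
  by apply: cell_inj => //; rewrite !Ac.
have cX : {in X, forall z, bcol z = bcol x} by move=> z; rewrite inE => /andP[/eqP].
have cY : {in Y, forall z, bcol z = bcol y} by move=> z; rewrite inE => /andP[/eqP].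
have cZ : {in Z, forall z, bcol z = bcol x} by move=> z; rewrite inE => /eqP.
have ltZ : (#|Z| < #|X :|: Y|)%N.
  rewrite cardsU (_ : X :&: Y = set0) ?cards0 ?subn0; last first.
    apply/setP => z; rewrite !inE; apply/negP => /andP[/andP[/eqP ex _]].
    by move=> /andP[/eqP ey _]; move: lxy; rewrite -ex -ey ltnn.
  (* The rows of the two pieces cover all rows of column [bcol x], and the common row of [x] and [y]
     occurs in both: hence the strict inequality. *)
  rewrite -(injr _ _ cX) -(injr _ _ cY) -(injr _ _ cZ) -cardsUI -addn1.
  apply: leq_add; last first.
    apply/card_gt0P; exists (row_of x); rewrite inE imset_f ?inE ?eqxx ?leqnn //=.
    apply/imsetP; exists y; first by rewrite inE eqxx leqnn.
    exact: val_inj.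
  apply/subset_leq_card/subsetP => w /imsetP[z]; rewrite inE => /eqP ez ->.
  rewrite inE; have [le|lt] := leqP (brow x) (brow z).
    by rewrite imset_f // inE ez eqxx.
  have [|z' er' ec'] := @cell_sub y (brow z) (bcol y) _ (leqnn _).
    by rewrite -exy ltnW.
  apply/orP; right; apply/imsetP; exists z'; last exact: val_inj.
  by rewrite inE ec' eqxx er' -exy ltnW.
have [inj|] := boolP (dinjectiveb (fun u => row_of (s u)) (mem (X :|: Y))).
  suff : (#|X :|: Y| <= #|Z|)%N by rewrite leqNgt ltZ.
  rewrite -(card_in_imset (elimT (dinjectiveP _ _) inj)) -(injr _ _ cZ).
  apply/subset_leq_card/subsetP => w /imsetP[u Su ->].
  have lec : (bcol x <= bcol (s u))%N.
    rewrite (eqP (sC u)); move: Su; rewrite inE => /orP[/cX -> //|/cY ->].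
    exact: ltnW.
  have [k er ec] := @cell_sub (s u) (brow (s u)) (bcol x) (leqnn _) lec.
  by apply/imsetP; exists k; [rewrite inE ec | apply: val_inj].
case/dinjectivePn => u Su [v /andP[vu Sv] /(congr1 val) /= e].
by exists u, v; split; rewrite // eq_sym.
Qed.

End YoungDiagram.

Section PermutationRepresentation.

Variables (gT : finGroupType) (S : finType) (to : {action gT &-> S}).

Definition act_mx (g : gT) : 'M[rat]_#|S| :=
  \matrix_i delta_mx 0 (enum_rank (to (enum_val i) g)).

Lemma act_mx_repr : mx_repr [set: gT] act_mx.
Proof.
split=> [|g h _ _]; apply/row_matrixP=> i.
  by rewrite rowK act1 enum_valK rowE mulmx1.
by rewrite row_mul !rowK -rowE rowK enum_rankK actM.
Qed.

Canonical act_repr := MxRepresentation act_mx_repr.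

Lemma delta_act_mx x g :
  delta_mx 0 (enum_rank x) *m act_repr g
    = delta_mx 0 (enum_rank (to x g)) :> 'rV_#|S|.
Proof. by rewrite -rowE rowK enum_rankK. Qed.

Lemma mxtrace_act g : \tr (act_repr g) = #|[set x | to x g == x]|%:R.
Proof.
rewrite /mxtrace (reindex (@enum_rank S)) /=; last first.
  by exists enum_val => ? _; rewrite ?enum_rankK ?enum_valK.
rewrite -[in RHS]sum1_card natr_sum [RHS]big_mkcond; apply: eq_bigr => x _.
rewrite inE mxE enum_rankK mxE eqxx (inj_eq enum_rank_inj) eq_sym.
by case: eqP.
Qed.

End PermutationRepresentation.

(** * Straightening of words by Garnir relations *)

Section Words.

Variables n N : nat.
Local Notation word := {ffun 'I_n -> 'I_N}.

Definition wact (f : word) (w : {perm 'I_n}) : word := [ffun x => f (w^-1%g x)].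

Lemma wact_is_action : is_action [set: {perm 'I_n}] wact.
Proof.
split=> [w f g /ffunP e|f v w _ _].
  by apply/ffunP => x; have := e (w x); rewrite !ffunE permK.
by apply/ffunP => x; rewrite !ffunE invMg permM.
Qed.

Canonical word_action := Action wact_is_action.

Variable Q : pred word.
Hypothesis Q_act : forall f w, Q (wact f w) = Q f.

Local Notation qword := {f : word | Q f}.

(** The default of [insubd] is never reached, as [Q] is stable. The predicate is left general so
    that Young's rule applies both to the words of a given weight and to a single orbit of words. *)
Definition qact (f : qword) (w : {perm 'I_n}) : qword := insubd f (wact (val f) w).

Lemma val_qact f w : val (qact f w) = wact (val f) w.
Proof. by rewrite val_insubd Q_act (valP f). Qed.

Lemma qact_is_action : is_action [set: {perm 'I_n}] qact.
Proof.
split=> [w f g /(congr1 val)|f v w _ _].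
  by rewrite !val_qact => /(@act_inj _ _ _ word_action w)/val_inj.
by apply: val_inj; rewrite !val_qact; apply: (actM word_action).
Qed.

Canonical qword_action := Action qact_is_action.

Lemma qactE f w x : val (qact f w) x = val f (w^-1%g x).
Proof. by rewrite val_qact ffunE. Qed.

Lemma qact_sum (a : 'I_n -> nat) f w :
  (\sum_z a z * val (qact f w) z = \sum_z a (w z) * val f z)%N.
Proof.
rewrite (reindex_inj (@perm_inj _ w)) /=; apply: eq_bigr => z _.
by rewrite qactE permK.
Qed.

Variable mu : intpart n.
Local Notation brow := (brow mu).
Local Notation bcol := (bcol mu).
Local Notation rho := (act_repr qword_action).
Local Notation e_ f := (delta_mx 0 (enum_rank (f : qword)) : 'rV[rat]_#|(qword : finType)|).

Let colsum : 'M[rat]_#|(qword : finType)| :=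
  \sum_(s in col_stab mu) (-1) ^+ odd_perm s *: rho s.
Let rowsum : 'M[rat]_#|(qword : finType)| := \sum_(p in row_stab mu) rho p.

Lemma gring_young : gring_mx rho (young_symmetrizer mu) = colsum *m rowsum.
Proof.
rewrite /young_symmetrizer linear_sum mulmx_sumr; apply: eq_bigr => p _ /=.
rewrite linear_sum mulmx_suml; apply: eq_bigr => s _ /=.
rewrite linearZ /= -scalemxAl -repr_mxM ?inE //; congr (_ *: _).
by rewrite /gring_mx /= -rowE rowK mxvecK gring_indexK ?inE.
Qed.

(** A form of bideterminant: the word fills the diagram and is antisymmetrised along columns, then
    symmetrised along rows. These vectors span the image of the Young symmetrizer. *)
Let bidet f := e_ f *m colsum *m rowsum.

Lemma sign_sqr (s : {perm 'I_n}) : (-1) ^+ s * (-1) ^+ s = 1 :> rat.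
Proof. by rewrite -expr2 sqrr_sign. Qed.

Lemma act_colsum s : s \in col_stab mu -> rho s *m colsum = (-1) ^+ s *: colsum.
Proof.
move=> Cs; rewrite /colsum mulmx_sumr scaler_sumr.
have grpC := block_perm_group bcol.
rewrite [RHS](reindex_inj (mulgI s)) /=; apply: eq_big => [u|u Cu].
  rewrite (_ : col_stab mu = block_perm_group bcol) // in Cs *.
  by rewrite groupMl.
rewrite -scalemxAr -repr_mxM ?inE // scalerA; congr (_ *: _).
by rewrite odd_permM signr_addb mulrA sign_sqr mul1r.
Qed.

Lemma act_rowsum p : p \in row_stab mu -> rho p *m rowsum = rowsum.
Proof.
move=> Rp; rewrite /rowsum mulmx_sumr.
rewrite [RHS](reindex_inj (mulgI p)) /=; apply: eq_big => [u|u Cu].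
  rewrite (_ : row_stab mu = block_perm_group brow) // in Rp *.
  by rewrite groupMl.
by rewrite -repr_mxM ?inE.
Qed.

Lemma bidet_act f s : s \in col_stab mu ->
  bidet (qact f s) = (-1) ^+ s *: bidet f.
Proof.
move=> Cs; rewrite /bidet -(delta_act_mx qword_action f s).
by rewrite -(mulmxA (e_ f) (rho s)) act_colsum // -scalemxAr -scalemxAl.
Qed.

Lemma tperm_col x y : bcol x = bcol y -> tperm x y \in col_stab mu.
Proof. by move=> e; rewrite inE; apply: block_perm_tperm. Qed.

Lemma bidet_swap f x y : x != y -> bcol x = bcol y ->
  bidet (qact f (tperm x y)) = - bidet f.
Proof.
move=> nxy e; rewrite bidet_act ?tperm_col // odd_tperm nxy.
by rewrite scaleN1r.
Qed.

(** Transposing the two cells fixes the word but changes the sign, in characteristic zero. *)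
Lemma bidet_eq0 (f : qword) x y : x != y -> bcol x = bcol y -> val f x = val f y ->
  bidet f = 0.
Proof.
move=> nxy e ef; have := bidet_swap f nxy e.
have -> : qact f (tperm x y) = f.
  apply: val_inj; apply/ffunP => z; rewrite qactE tpermV.
  by case: tpermP => // ->.
by move/eqP; rewrite -addr_eq0 -mulr2n -scaler_nat scaler_eq0 => /orP[] // /eqP.
Qed.

(** For each column permutation [s], two cells of the Garnir set land in one row. Their
    transposition reverses the sign of [Gam] on one side and is absorbed by [rowsum] on the other,
    so the term of [s] equals its own negative. *)
Lemma garnir_relation f x y : brow x = brow y -> (bcol x < bcol y)%N ->
  \sum_(h | perm_on (garnir_set mu x y) h) (-1) ^+ h *: bidet (qact f h) = 0.
Proof.
move=> exy lxy; set S := garnir_set mu x y.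
pose Gam : 'M[rat]_#|(qword : finType)| := \sum_(h | perm_on S h) (-1) ^+ h *: rho h.
have -> : \sum_(h | perm_on S h) (-1) ^+ h *: bidet (qact f h) =
          e_ f *m (Gam *m colsum *m rowsum).
  rewrite (mulmxA (e_ f) (Gam *m colsum)) (mulmxA (e_ f) Gam) /Gam.
  rewrite [e_ f *m _]mulmx_sumr !mulmx_suml; apply: eq_bigr => h _.
  by rewrite -scalemxAr -!scalemxAl delta_act_mx.
suff Gam0 s : s \in col_stab mu -> Gam *m rho s *m rowsum = 0.
  rewrite /colsum [Gam *m _]mulmx_sumr mulmx_suml big1 ?mulmx0 // => s Cs.
  by rewrite -scalemxAr -scalemxAl Gam0 ?scaler0.
move=> Cs; have [u [v [Su Sv nuv er]]] := garnir_collision exy lxy Cs.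
have GamT : Gam *m rho (tperm u v) = - Gam.
  rewrite /Gam mulmx_suml -sumrN (reindex_inj (mulIg (tperm u v))) /=.
  have tS : perm_on S (tperm u v).
    apply: subset_trans (tperm_on u v) _.
    by apply/subsetP => z; rewrite in_set2 => /orP[] /eqP->.
  apply: eq_big => [h|h Sh].
    apply/idP/idP => [Sh|Sh]; last exact: perm_onM.
    by rewrite -(mulgK (tperm u v) h) tpermV perm_onM.
  rewrite -scalemxAl -repr_mxM ?inE // -mulgA tperm2 mulg1 odd_permM odd_tperm nuv.
  by rewrite signr_addb mulrN1 scaleNr.
(* Moved past [s], the transposition of [u] and [v] becomes that of [s u] and [s v], which lie in
   one row. *)
have e1 : Gam *m rho s *m rowsum = - (Gam *m rho s *m rowsum).
  have Rt : tperm (s u) (s v) \in row_stab mu by rewrite inE; apply: (block_perm_tperm er).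
  rewrite -{1}(act_rowsum Rt) -!mulmxA !(mulmxA (rho s)) -repr_mxM ?inE //.
  rewrite -tpermJ conjgE !mulgA mulgV mul1g repr_mxM ?inE // !mulmxA GamT.
  by rewrite !mulNmx.
apply/eqP; move/eqP: e1; rewrite -addr_eq0 -mulr2n -scaler_nat scaler_eq0.
by case/orP.
Qed.

(* The straightening raises [Phi1], or keeps it and raises [Phi2]. *)
Let Phi1 (f : qword) := (\sum_z bcol z * val f z)%N.
Let Phi2 (f : qword) := (\sum_z brow z * val f z)%N.

(** Twice the gain in [Phi1] is a sum over the cells of column displacement times [d]. Cells of the
    left column carry positive [d] and can only move right, those of the right column carry negative
    [d] and can only move left; some cell does move. *)
Lemma garnir_increase (f : qword) x y h :
    brow x = brow y -> (bcol x < bcol y)%N -> (val f y < val f x)%N ->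
    (forall i k, bcol i = bcol k -> (brow i < brow k)%N -> (val f i < val f k)%N) ->
    perm_on (garnir_set mu x y) h -> h \notin col_stab mu ->
  (Phi1 f < Phi1 (qact f h))%N.
Proof.
move=> exy lxy lf strict Sh nCh.
have fX z : bcol z = bcol x -> (brow x <= brow z)%N -> (val f x <= val f z)%N.
  move=> ec; rewrite leq_eqVlt => /orP[/eqP er|lt]; last exact/ltnW/strict.
  by rewrite (cell_inj er (esym ec)).
have fY z : bcol z = bcol y -> (brow z <= brow y)%N -> (val f z <= val f y)%N.
  move=> ec; rewrite leq_eqVlt => /orP[/eqP er|lt]; last exact/ltnW/strict.
  by rewrite (cell_inj er ec).
rewrite /Phi1 qact_sum.
pose c (z : 'I_n) : int := (bcol z)%:Z.
(* The subtracted constant [f x + f y] gives [d] opposite signs on the two columns; it does not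
   affect the sum, since the column displacements add up to zero. *)
pose d (z : 'I_n) : int := (val f z)%:Z *+ 2 - (val f x)%:Z - (val f y)%:Z.
have term z : 0 <= (c (h z) - c z) * d z ?= iff (bcol (h z) == bcol z).
  have [Sz|nSz] := boolP (z \in garnir_set mu x y); last first.
    by rewrite (out_perm Sh nSz) subrr mul0r eqxx; apply/Order.POrderTheory.leifP; rewrite eqxx.
  have Shz : h z \in garnir_set mu x y by rewrite perm_closed.
  move: Sz Shz; rewrite !inE /c /d.
  case/orP => /andP[/eqP ez lz]; case/orP => /andP[/eqP ehz lhz];
    rewrite ez ehz; apply/Order.POrderTheory.leifP; case: eqP => [e|ne]; try lia.
  - by have := fX z ez lz; nia.
  - by have := fY z ez lz; nia.
have [z0 nz0] : exists z, bcol (h z) != bcol z.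
  by apply/existsP; rewrite -negb_forall; move: nCh; rewrite inE.
have pos : 0 < \sum_z (c (h z) - c z) * d z.
  rewrite (bigD1 z0) //= Num.Theory.ltr_wpDr //.
    by apply: Num.Theory.sumr_ge0 => z _; apply: (term z).1.
  by rewrite Order.POrderTheory.lt_neqAle (term z0).1 andbT (term z0).2.
have sum0 : \sum_z (c (h z) - c z) = 0.
  by rewrite sumrB [X in _ - X](reindex_inj (@perm_inj _ h)) subrr.
have eqs : \sum_z (c (h z) - c z) * d z =
    (((\sum_z bcol (h z) * val f z)%N)%:Z - ((\sum_z bcol z * val f z)%N)%:Z) *+ 2.
  transitivity (\sum_z (c (h z) - c z) * (val f z)%:Z *+ 2
                - (\sum_z (c (h z) - c z)) * ((val f x)%:Z + (val f y)%:Z)).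
    rewrite mulr_suml -sumrB; apply: eq_bigr => z _; rewrite /d; ring.
  rewrite sum0 mul0r subr0 sumrMnl; congr (_ *+ 2).
  rewrite -[X in _ = X - _]natz -[X in _ = _ - X]natz !natr_sum -sumrB.
  by apply: eq_bigr => z _; rewrite /c -!natz !natrM mulrBl.
move: pos; rewrite eqs; lia.
Qed.

(** The lexicographic pair of [Phi1] and [Phi2] in one number: the base exceeds every value of
    [Phi2]. *)
Let Phi (f : qword) := (Phi1 f * (\max_(g : qword) Phi2 g).+1 + Phi2 f)%N.

Lemma Phi_lt f g :
  (Phi1 f < Phi1 g)%N || (Phi1 f == Phi1 g) && (Phi2 f < Phi2 g)%N ->
  (Phi f < Phi g)%N.
Proof.
have lef := leq_bigmax (F := Phi2) f; have leg := leq_bigmax (F := Phi2) g.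
rewrite /Phi; case/orP => [lt|/andP[/eqP-> lt]]; last by rewrite ltn_add2l.
apply: leq_trans (leq_addr _ _); apply: leq_trans (leq_mul lt (leqnn _)).
by rewrite mulSn addnC ltn_add2r ltnS.
Qed.

Local Notation ssyt_set := [set f : qword | is_ssyt mu (val f)].

Let ssyt_mx : 'M[rat]_(#|ssyt_set|, #|(qword : finType)|) :=
  \matrix_i bidet (enum_val i).

(** Induction on the distance of [Phi f] from its maximum. A column violation gives zero (equal
    letters) or a swap that raises [Phi2]; with strict columns, a row violation gives a Garnir
    relation whose other terms have larger [Phi1]. *)
Lemma straightening f : (bidet f <= ssyt_mx)%MS.
Proof.
have [k] := ubnP (\max_g Phi g - Phi f)%N; elim: k f => // k IHk f le_k.
have up g : (Phi f < Phi g)%N -> (bidet g <= ssyt_mx)%MS.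
  move=> lt; apply: IHk; have := leq_bigmax (F := Phi) g; lia.
have [ss|nss] := boolP (is_ssyt mu (val f)).
  have ff : f \in ssyt_set by rewrite inE.
  rewrite (_ : bidet f = row (enum_rank_in ff f) ssyt_mx) ?row_sub //.
  by rewrite rowK enum_rankK_in.
have [/existsP[x /existsP[y /and3P[/eqP ec ltr le]]]|nocol] := boolP
  [exists x, exists y, [&& bcol x == bcol y, (brow x < brow y)%N
                         & (val f y <= val f x)%N]].
  have nxy : x != y by apply: contraTneq ltr => ->; rewrite ltnn.
  move: le; rewrite leq_eqVlt => /orP[/eqP/val_inj e|lt].
    by rewrite (bidet_eq0 nxy ec (esym e)) sub0mx.
  have -> : bidet f = - bidet (qact f (tperm x y)).
    by rewrite (bidet_swap f nxy ec) opprK.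
  rewrite eqmx_opp; apply: up; apply: Phi_lt; apply/orP; right.
  apply/andP; split.
    rewrite /Phi1 qact_sum; apply/eqP/eq_bigr => z _.
    by have := tperm_col ec; rewrite inE => /forallP/(_ z)/eqP->.
  have := sum_swap_lt (f := fun z => val (val f z)) ltr lt.
  by congr (_ < _)%N; apply: eq_bigr => z _; rewrite qactE tpermV.
have strict i k' : bcol i = bcol k' -> (brow i < brow k')%N ->
    (val f i < val f k')%N.
  move=> ec ltr; rewrite ltnNge; apply: contra nocol => le.
  by apply/existsP; exists i; apply/existsP; exists k'; rewrite ec eqxx ltr.
have [x [y [er ltc ltf]]] :
    exists x y, [/\ brow x = brow y, (bcol x < bcol y)%N & (val f y < val f x)%N].
  have [/existsP[x /existsP[y /and3P[/eqP]]]|norow] := boolP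
    [exists x, exists y, [&& brow x == brow y, (bcol x < bcol y)%N
                           & (val f y < val f x)%N]]; first by exists x, y.
  case/negP: nss; apply/ssytP; split=> // i j e l; rewrite leqNgt.
  apply: contra norow => lt; apply/existsP; exists i; apply/existsP; exists j.
  by rewrite e eqxx l.
have := garnir_relation f er ltc; set S := garnir_set mu x y.
rewrite (bigID (mem (col_stab mu))) /= => /eqP; rewrite addr_eq0 => /eqP.
(* A column permutation contributes its sign twice, so each of these terms is [bidet f]. *)
rewrite (eq_bigr (fun _ => bidet f)) => [|h /andP[_ Ch]]; last first.
  by rewrite bidet_act // scalerA sign_sqr scale1r.
rewrite sumr_const -scaler_nat => eq_f.
(* The identity is among the permutations counted, so the multiple of [bidet f] can be divided
   out. *)
have nz : #|[pred h | perm_on S h & h \in col_stab mu]|%:R != 0 :> rat.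
  rewrite Num.Theory.pnatr_eq0 -lt0n; apply/card_gt0P; exists 1%g.
  rewrite inE /= perm_on1 inE; exact: block_perm1.
rewrite -(eqmx_scale _ nz) eq_f eqmx_opp; apply: summx_sub => h /andP[Sh nCh].
apply: scalemx_sub; apply: up; apply: Phi_lt; apply/orP; left.
exact: garnir_increase Sh nCh.
Qed.

Lemma bidet_coef f g : bidet f 0 (enum_rank g) =
  \sum_(p in row_stab mu) \sum_(s in col_stab mu)
    (-1) ^+ s * (qact (qact f s) p == g)%:R.
Proof.
rewrite /bidet {1}/rowsum mulmx_sumr summxE; apply: eq_bigr => p _.
rewrite [e_ f *m _]mulmx_sumr mulmx_suml summxE; apply: eq_bigr => s _.
rewrite -scalemxAr -scalemxAl !delta_act_mx mxE mxE eqxx /=.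
by rewrite (inj_eq enum_rank_inj) eq_sym.
Qed.

Lemma ssyt_col_sorted (f : qword) : is_ssyt mu (val f) ->
  block_sorted bcol brow (fun z => val (val f z)).
Proof.
by case/ssytP => _ H; apply/block_sortedP => i j e l; apply/ltnW/H.
Qed.

Lemma ssyt_row_sorted (f : qword) : is_ssyt mu (val f) ->
  block_sorted brow bcol (fun z => val (val f z)).
Proof. by case/ssytP => H _; apply/block_sortedP. Qed.

Lemma Phi2_row f p : p \in row_stab mu -> Phi2 (qact f p) = Phi2 f.
Proof.
rewrite inE => /forallP Rp; rewrite /Phi2 qact_sum.
by apply: eq_bigr => z _; rewrite (eqP (Rp z)).
Qed.

Lemma row_stabV p : p \in row_stab mu -> p^-1%g \in row_stab mu.
Proof. by rewrite !inE => /block_permV. Qed.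

Lemma col_stabV p : p \in col_stab mu -> p^-1%g \in col_stab mu.
Proof. by rewrite !inE => /block_permV. Qed.

(** The columns of a tableau are sorted by row, so it maximises [Phi2] on its column orbit, and a
    rearrangement reaching the maximum is the same word. *)
Lemma ssyt_col_act (f : qword) s : is_ssyt mu (val f) -> s \in col_stab mu ->
  (Phi2 f <= Phi2 (qact f s))%N -> qact f s = f.
Proof.
move=> ss Cs le; apply: val_inj; apply/ffunP => z; apply: val_inj.
have Csv : block_perm bcol s^-1%g by have := col_stabV Cs; rewrite inE.
have binj i j : bcol i = bcol j -> brow i = brow j -> i = j.
  by move=> e e'; apply: cell_inj e' e.
rewrite qactE; apply: (block_rearrangement_eq binj (ssyt_col_sorted ss) Csv).
apply: leq_trans le _; apply: eq_leq.
by apply: eq_bigr => x _; rewrite qactE.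
Qed.

(** Entries strictly increase down a column, so cells with equal letters in one column coincide. *)
Lemma ssyt_stab1 (f : qword) s : is_ssyt mu (val f) -> s \in col_stab mu ->
  qact f s = f -> s = 1%g.
Proof.
move=> /ssytP[_ strict]; rewrite inE => /forallP Cs e.
apply/permP => x; rewrite perm1; apply/eqP/negPn/negP => nx.
have ec : bcol (s x) = bcol x by apply/eqP.
have ef : val f x = val f (s x) by rewrite -{2}e qactE permK.
have [lt|lt|er] := ltngtP (brow (s x)) (brow x).
- by have := strict _ _ ec lt; rewrite ef ltnn.
- by have := strict _ _ (esym ec) lt; rewrite ef ltnn.
by case/eqP: nx; apply: (cell_inj er ec).
Qed.

(* Among the words in the support of a bideterminant of a tableau [f], only row
   rearrangements of [f] attain the maximal value of [Phi2]. *)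
Lemma ssyt_mx_free : row_free ssyt_mx.
Proof.
have key (x : qword -> rat) :
    (forall g, \sum_(f | is_ssyt mu (val f)) x f * bidet f 0 (enum_rank g) = 0) ->
    forall f, is_ssyt mu (val f) -> x f = 0.
  move=> sum0; apply: (@triangular_eq0 _ _ _ _ x id Phi2
      (fun f g => bidet f 0 (enum_rank g))) => [f ss|f g ssf ssg nz|g ss] //.
    rewrite bidet_coef.
    (* In the diagonal coefficient only the trivial column permutation contributes; what remains
       counts row permutations fixing [f], without signs. *)
    have -> : \sum_(p in row_stab mu) \sum_(s in col_stab mu)
        (-1) ^+ s * (qact (qact f s) p == f)%:R =
        #|[set p in row_stab mu | qact f p == f]|%:R :> rat.
      rewrite -sum1_card natr_sum [RHS](eq_bigl (fun p => (p \in row_stab mu) &&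
        (qact f p == f))) => [|p]; last by rewrite inE.
      rewrite [RHS]big_mkcondr /=; apply: eq_bigr => p Rp.
      have C1 : 1%g \in col_stab mu by rewrite inE; apply: block_perm1.
      rewrite (bigD1 1%g) //= big1 ?addr0 => [|s /andP[Cs ns]].
        by rewrite odd_perm1 mul1r (act1 qword_action); case: eqP.
      case: eqP => [e|_]; last by rewrite mulr0.
      case/eqP: ns; apply: (ssyt_stab1 ss Cs).
      by apply: (ssyt_col_act ss Cs); rewrite -(Phi2_row (qact f s) Rp) e leqnn.
    rewrite Num.Theory.pnatr_eq0 -lt0n; apply/card_gt0P; exists 1%g.
    rewrite !inE (act1 qword_action) eqxx andbT; exact: block_perm1.
  have [p Rp [s Cs e]] : exists2 p, p \in row_stab mu &
      exists2 s, s \in col_stab mu & qact (qact f s) p = g.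
    have [/existsP[p /andP[Rp /existsP[s /andP[Cs /eqP e]]]]|no] := boolP
      [exists p, (p \in row_stab mu) && [exists s, (s \in col_stab mu) &&
                   (qact (qact f s) p == g)]]; first by exists p => //; exists s.
    case/eqP: nz; rewrite bidet_coef big1 // => p Rp; rewrite big1 // => s Cs.
    case: eqP => [e|_]; last by rewrite mulr0.
    case/negP: no; apply/existsP; exists p; rewrite Rp /=; apply/existsP; exists s.
    by rewrite Cs e /=.
  have eP : Phi2 g = Phi2 (qact f s) by rewrite -e Phi2_row.
  (* Row permutations preserve [Phi2]. If it has not dropped, the column permutation fixes [f]; then
     [f] and [g] are row rearrangements of each other with sorted rows, hence equal. *)
  have [lt|le] := ltnP (Phi2 g) (Phi2 f); [by right | left].
  have efs : qact f s = f by apply: ssyt_col_act => //; rewrite -eP.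
  apply/esym/val_inj/ffunP => z; apply: val_inj.
  have Rpv : block_perm brow p^-1%g by have := row_stabV Rp; rewrite inE.
  have binj i j : brow i = brow j -> bcol i = bcol j -> i = j by apply: (@cell_inj n mu).
  have := block_sorted_unique binj Rpv (ssyt_row_sorted ssf).
  move/(_ _ z) => /= <-; first by rewrite -e efs qactE.
  apply/block_sortedP => i j ei lij /=.
  have /block_sortedP/(_ i j ei lij) := ssyt_row_sorted ssg.
  by rewrite -e efs !qactE.
rewrite -kermx_eq0; apply/rowV0P => v /sub_kermxP v0.
(* The coefficients indexed by tableaux are extended by zero to all words, the index type of
   [key]. *)
pose x (f : qword) : rat :=
  if insub f : {? f | f \in ssyt_set} is Some f' then
    v 0 (enum_rank_in (valP f') f) else 0.
have xE i : x (enum_val i) = v 0 i.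
  rewrite /x insubT ?enum_valP //= => H.
  by rewrite enum_valK_in.
apply/rowP => i; rewrite mxE -xE; apply: key; last first.
  by have := enum_valP i; rewrite inE.
move=> g; have := congr1 (fun M : 'rV_ _ => M 0 (enum_rank g)) v0.
rewrite mxE [RHS]mxE => e0; apply: etrans e0; rewrite (eq_bigl (fun f => f \in ssyt_set)) => [|f]; last by rewrite inE.
rewrite [LHS]big_enum_val; apply: eq_bigr => j _; rewrite xE; congr (_ * _).
by rewrite [RHS]mxE.
Qed.

(** The bideterminants of all words span the image of the symmetrizer; straightening reduces them to
    those of tableaux, which are independent. *)
Theorem rank_young : \rank (gring_mx rho (young_symmetrizer mu)) =
  #|[set f : word | is_ssyt mu f && Q f]|.
Proof.
have -> : #|[set f : word | is_ssyt mu f && Q f]| = #|ssyt_set|.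
  rewrite -(card_imset (mem ssyt_set) val_inj); apply: eq_card => f.
  rewrite inE; apply/andP/imsetP => [[ss Qf]|[g]].
    by exists (exist _ f Qf); rewrite ?inE.
  by rewrite inE => ss ->; split=> //; apply: valP.
have /eqP <- := ssyt_mx_free; apply: eqmx_rank.
rewrite gring_young; apply/andP; split; apply/row_subP => i.
  rewrite row_mul -[i]enum_valK rowE; exact: straightening.
rewrite rowK /bidet -mulmxA; exact: submxMl.
Qed.

End Words.

Lemma card_permutations n : #|{perm 'I_n}| = n`!.
Proof.
rewrite -[RHS](card_ord n`!) -(card_Sn n); apply: esym.
by rewrite card_ord -cardsT; apply: eq_card => w; rewrite !inE.
Qed.

(** * Specht characters: Frobenius's formula and linear independence *)

Section SpechtCharacters.

Variable n : nat.
Implicit Types (mu nu : intpart n) (w : {perm 'I_n}).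

(** [cyclic_character_rank] with the rank from [rank_young]. The permutation character is taken at
    the inverse of [w], which fixes the same words as [w]. *)
Theorem specht_pairing N (Q : pred {ffun 'I_n -> 'I_N}) mu :
  (forall f w, Q (wact f w) = Q f) ->
  \sum_w specht_char mu w * #|[set f | Q f && (wact f w == f)]|%:R =
  n`!%:R * #|[set f : {ffun 'I_n -> 'I_N} | is_ssyt mu f && Q f]|%:R.
Proof.
move=> Q_act.
have := cyclic_character_rank (young_symmetrizer mu)
          (act_repr (qword_action Q_act)).
rewrite rank_young card_permutations => <-; apply: eq_bigr => w _; congr (_ * _).
rewrite mxtrace_act; congr (_%:R).
rewrite -(card_imset _ (@val_inj _ Q _)); apply: eq_card => f.
rewrite [LHS]in_set; apply/andP/imsetP => [[Qf /eqP e]|[g]].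
  exists (exist _ f Qf) => //; rewrite inE -val_eqE /= (val_qact Q_act) /=.
  by rewrite -{1}e; apply/eqP; apply: (actK (word_action n N)).
move=> gfix ->; split; first exact: valP.
move: gfix; rewrite in_set => /eqP e; apply/eqP.
by rewrite -{1}e -(val_qact Q_act) (actKV (qword_action Q_act)).
Qed.

Lemma specht_char_conj mu w g : specht_char mu (w ^ g) = specht_char mu w.
Proof.
rewrite /specht_char conjgE !repr_mxM ?inE // mxtrace_mulC -mulmxA -repr_mxM ?inE //.
by rewrite mulgV repr_mx1 mulmx1.
Qed.

(** A fixed word is constant on cycles, so this is the power sum of the cycle type of [w] at 1, q,
    ..., q^(N-1). *)
Definition pi_word N w : {poly rat} :=
  \sum_(f : {ffun 'I_n -> 'I_N} | wact f w == f) 'X^(\sum_i f i).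

Lemma wact_sum N (f : {ffun 'I_n -> 'I_N}) w :
  (\sum_i wact f w i = \sum_i f i)%N.
Proof.
rewrite (reindex_inj (@perm_inj _ w)) /=; apply: eq_bigr => z _.
by rewrite ffunE permK.
Qed.

Lemma coef_pi_word N w m : (pi_word N w)`_m =
  #|[set f : {ffun 'I_n -> 'I_N} | (\sum_i f i == m)%N && (wact f w == f)]|%:R.
Proof.
rewrite /pi_word coef_sum -sum1_card natr_sum big_mkcond [RHS]big_mkcond.
apply: eq_bigr => f _; rewrite coefXn inE andbC [m == _]eq_sym.
by case: eqP => //=; case: eqP.
Qed.

(** Frobenius's expansion of a Schur function in power sums, specialised. In degree [m] it is
    Young's rule on the words of weight [m]. *)
Theorem schur_principal N mu :
  schur mu (fun i : 'I_N => 'X^i : {poly rat}) =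
  n`!%:R^-1 *: \sum_w specht_char mu w *: pi_word N w.
Proof.
apply/polyP => m; rewrite [RHS]coefZ [in RHS]coef_sum.
pose Q (f : {ffun 'I_n -> 'I_N}) := (\sum_i f i == m)%N.
have Q_act f w : Q (wact f w) = Q f by rewrite /Q wact_sum.
have := specht_pairing mu Q_act.
rewrite (eq_bigr (fun w => (specht_char mu w *: pi_word N w)`_m)) => [->|w _]; last first.
  by rewrite coefZ coef_pi_word.
rewrite mulKf ?Num.Theory.pnatr_eq0 -?lt0n ?fact_gt0 // /schur coef_sum.
rewrite -sum1_card natr_sum big_mkcond [RHS]big_mkcond.
apply: eq_bigr => f _; rewrite inE /Q; case: (is_ssyt mu f) => //=.
by rewrite -expr_sum coefXn eq_sym; case: eqP.
Qed.

Lemma card_brow mu v : #|[set z | brow mu z == v]| = nth 0%N (shape_of mu) v.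
Proof.
have cbound (z : 'I_n) : brow mu z == v -> (bcol mu z < nth 0%N (shape_of mu) v)%N.
  by move=> /eqP <-; apply: bcol_lt.
rewrite -[RHS]card_ord.
have inj : injective (fun z : {z | brow mu z == v} =>
                        Ordinal (cbound (val z) (valP z))).
  move=> z z' /(congr1 val) /= ec; apply/val_inj/(@cell_inj _ mu) => //.
  by rewrite (eqP (valP z)) (eqP (valP z')).
have surj (c : 'I_(nth 0%N (shape_of mu) v)) : c \in
    codom (fun z : {z | brow mu z == v} => Ordinal (cbound (val z) (valP z))).
  have [z er ec] := cell_ex (ltn_ord c).
  apply/codomP; exists (exist _ z (introT eqP er)); exact: val_inj.
rewrite -(eq_card (B := predT) surj) (card_codom inj) card_sig.
by apply: eq_card => z; rewrite !inE.
Qed.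

(** The tableau with constant rows; its orbit consists of the words of content [mu]. *)
Definition row_word mu : {ffun 'I_n -> 'I_n} := [ffun z => row_of mu z].

(** The action preserves the multiplicity of each letter, and in a row word these are the row
    lengths. *)
Lemma row_word_orbit_inj mu nu w : wact (row_word nu) w = row_word mu -> mu = nu.
Proof.
move=> e; apply: val_inj; apply: eq_from_tnth => i; apply: val_inj.
have shE la : val (tnth (val la) i) = nth 0%N (shape_of la) i :> nat.
  by rewrite (nth_map ord0) ?size_tuple // -tnth_nth.
rewrite !shE -!card_brow -[RHS](card_imset _ (@perm_inj _ w)); apply: eq_card => z.
rewrite inE; apply/idP/imsetP => [/eqP er|[z' ]].
  exists (w^-1%g z); rewrite ?permKV // inE -er.
  by move/ffunP/(_ z)/(congr1 val): e; rewrite !ffunE /= => ->.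
rewrite inE => /eqP <- ->.
by move/ffunP/(_ (w z'))/(congr1 val): e; rewrite !ffunE /= permK => ->.
Qed.

Lemma ssyt_row_word mu : is_ssyt mu (row_word mu).
Proof. by apply/ssytP; split=> i k e l; rewrite !ffunE //= e. Qed.

Lemma ssyt_ge_row N mu (T : {ffun 'I_n -> 'I_N}) z :
  is_ssyt mu T -> (brow mu z <= T z)%N.
Proof.
case/ssytP => _ strict; have [r] := ubnP (brow mu z); elim: r z => // r IH z.
rewrite ltnS => le; case E: (brow mu z) => [//|k].
have [z' er ec] := @cell_sub _ mu z k (bcol mu z) (ltnW (eq_leq (esym E))) (leqnn _).
have := strict z' z ec; rewrite er E => /(_ (leqnn _)); apply: leq_ltn_trans.
by rewrite -er; apply: IH; rewrite er -E.
Qed.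

(** Pairing with the orbit of [row_word nu] turns a linear relation between characters into one
    between the rows of the Kostka matrix, which is triangular. *)
Lemma specht_char_free (x : intpart n -> rat) :
  (forall w, \sum_mu x mu * specht_char mu w = 0) -> forall mu, x mu = 0.
Proof.
move=> sum0 mu.
pose Q nu (f : {ffun 'I_n -> 'I_n}) := [exists w, wact (row_word nu) w == f].
have Q_act nu f w : Q nu (wact f w) = Q nu f.
  apply/existsP/existsP => [[v /eqP e]|[v /eqP <-]].
    by exists (v * w^-1)%g; rewrite (actM (word_action n n)) /= e; apply/eqP/(actK (word_action n n)).
  by exists (v * w)%g; rewrite (actM (word_action n n)).
pose M mu nu : rat :=
  #|[set f : {ffun 'I_n -> 'I_n} | is_ssyt mu f && Q nu f]|%:R.
(* A tableau has entries at least its row indices, so its weight bounds the sum of these, with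
   equality only for the row word. Subtracting from [n * n], which bounds these sums, reverses the
   order without truncation. *)
apply: (@triangular_eq0 _ _ _ predT x id
   (fun mu => n * n - \sum_z brow mu z)%N M) => // [la _|la nu _ _|nu _].
- rewrite Num.Theory.pnatr_eq0 -lt0n; apply/card_gt0P; exists (row_word la).
  rewrite inE ssyt_row_word; apply/existsP; exists 1%g.
  by rewrite (act1 (word_action n n)).
- rewrite Num.Theory.pnatr_eq0 -lt0n => /card_gt0P[f].
  rewrite inE => /andP[ss /existsP[w /eqP e]].
  have sumf : (\sum_z f z = \sum_z brow nu z)%N.
    by rewrite -e wact_sum; apply: eq_bigr => z _; rewrite ffunE.
  have le z : (brow la z <= f z ?= iff (brow la z == f z))%N.
    by apply: leqif_eq; apply: ssyt_ge_row.
  have [le1 eq1] := leqif_sum (fun z (_ : true) => le z).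
  have bnd : (\sum_z brow nu z <= n * n)%N.
    rewrite -[X in (_ <= X * _)%N]card_ord -sum_nat_const; apply: leq_sum => z _.
    exact/ltnW/brow_lt.
  move: le1; rewrite leq_eqVlt eq1 sumf => /orP[/forallP all_eq|lt]; last by right; lia.
  left; apply: (@row_word_orbit_inj _ _ w); rewrite e.
  apply/ffunP => z; apply: val_inj; rewrite ffunE /=.
  by apply/esym/eqP; have := all_eq z.
have : \sum_w (\sum_mu x mu * specht_char mu w) *
     #|[set f | Q nu f && (wact f w == f)]|%:R = 0.
  by apply: big1 => w _; rewrite sum0 mul0r.
under eq_bigr do rewrite mulr_suml.
rewrite exchange_big /=.
under eq_bigr do under eq_bigr do rewrite -mulrA.
under eq_bigr => la _ do rewrite -mulr_sumr (specht_pairing la (Q_act nu)) mulrCA.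
rewrite -mulr_sumr => /eqP; rewrite mulf_eq0 Num.Theory.pnatr_eq0.
by rewrite eqn0Ngt fact_gt0 /= => /eqP.
Qed.

End SpechtCharacters.

(** * Cycle types and the span of the Specht characters *)

Section CycleType.

Variable n : nat.
Implicit Types w : {perm 'I_n}.

Lemma porbit_iter_inj w x a b :
  (iter a w x == iter b w x) = (a == b %[mod #|porbit w x|]).
Proof.
have m_gt0 : (0 < #|porbit w x|)%N by apply/card_gt0P; exists x; apply: porbit_id.
have iter_mod k : iter k w x = iter (k %% #|porbit w x|) w x.
  rewrite {1}(divn_eq k #|porbit w x|) addnC iterD; congr (iter _ w _).
  by elim: (k %/ _)%N => // j IH; rewrite mulSn iterD IH iter_porbit.
rewrite (iter_mod a) (iter_mod b).
have lt k : (k %% #|porbit w x| < #|porbit w x|)%N by rewrite ltn_pmod.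
rewrite -(nth_traject w (lt a) x) -(nth_traject w (lt b) x).
by rewrite nth_uniq ?size_traject // uniq_traject_porbit.
Qed.

Definition orbit_seq w : seq {set 'I_n} :=
  sort (fun A B : {set 'I_n} => #|B| <= #|A|)%N (enum (porbits w)).

Lemma mem_orbit_seq w A : (A \in orbit_seq w) = (A \in porbits w).
Proof. by rewrite mem_sort mem_enum. Qed.

Lemma uniq_orbit_seq w : uniq (orbit_seq w).
Proof. by rewrite sort_uniq enum_uniq. Qed.

Definition cycle_sizes w : seq nat := [seq #|A| | A : {set 'I_n} <- orbit_seq w].

(** The i-th orbits of [v] and [w] have equal length; [gf] carries the k-th iterate of [v] on a
    chosen point to the k-th iterate of [w] on the corresponding point, and thus intertwines the
    two. *)
Lemma cycle_sizes_conj v w : cycle_sizes v = cycle_sizes w ->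
  exists g, w = (v ^ g)%g.
Proof.
move=> eqs; have eqsz : size (orbit_seq v) = size (orbit_seq w).
  by have := congr1 size eqs; rewrite !size_map.
pose ix u x := index (porbit u x) (orbit_seq u).
have ixP u x : (ix u x < size (orbit_seq u))%N.
  by rewrite index_mem mem_orbit_seq imset_f.
pose O u i := nth set0 (orbit_seq u) i.
have O_ix u x : O u (ix u x) = porbit u x.
  by rewrite /O nth_index // mem_orbit_seq imset_f.
have Orb u i : (i < size (orbit_seq u))%N -> exists y, O u i = porbit u y.
  move=> lt; have : O u i \in orbit_seq u by apply: mem_nth.
  by rewrite mem_orbit_seq => /imsetP[y _]; exists y.
have O_inj u i y : (i < size (orbit_seq u))%N -> y \in O u i ->
    O u i = porbit u y /\ ix u y = i.
  move=> lt; have [z ez] := Orb u i lt; rewrite ez => yz.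
  have e : porbit u y = porbit u z by apply/eqP; rewrite eq_porbit_mem.
  by split=> //; rewrite /ix e -ez /O index_uniq ?uniq_orbit_seq.
pose rep u (x0 : 'I_n) i := odflt x0 [pick y in O u i].
have repP u x0 i : (i < size (orbit_seq u))%N -> rep u x0 i \in O u i.
  move=> lt; rewrite /rep; case: pickP => //= no; have [z ez] := Orb u i lt.
  by have := no z; rewrite ez porbit_id.
have cardO i : (i < size (orbit_seq v))%N -> #|O v i| = #|O w i|.
  move=> lt; have := congr1 (nth 0%N ^~ i) eqs.
  by rewrite /= !(nth_map set0) // -eqsz.
have log x : exists k, x == iter k v (rep v x (ix v x)).
  have := repP v x _ (ixP v x); rewrite O_ix porbit_sym => /porbitP[k e].
  by exists k; rewrite -permX -e.
(* The default value of [rep] is irrelevant since the orbits are nonempty. *)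
have repE u x y i : (i < size (orbit_seq u))%N -> rep u x i = rep u y i.
  move=> lt; have := repP u x _ lt; rewrite /rep.
  by case: pickP => //= no; have := repP u y _ lt; rewrite no.
pose lg x := xchoose (log x).
have lgP x : iter (lg x) v (rep v x (ix v x)) = x by apply/esym/eqP/(xchooseP (log x)).
pose gf x := iter (lg x) w (rep w x (ix v x)).
(* The exponent is determined only modulo the orbit length, and the lengths agree, so every
   admissible exponent computes [gf]. *)
have main x y k : ix v x = ix v y -> y = iter k v (rep v x (ix v x)) ->
    gf y = iter k w (rep w x (ix v x)).
  move=> eix ey; have lt := ixP v x; have ltw : (ix v x < size (orbit_seq w))%N.
    by rewrite -eqsz.
  rewrite /gf -eix (repE w y x) //; apply/eqP; rewrite porbit_iter_inj.
  have [ew _] := O_inj w _ _ ltw (repP w x _ ltw); rewrite -ew -cardO //.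
  have [ev _] := O_inj v _ _ lt (repP v x _ lt); rewrite ev -porbit_iter_inj -ey.
  by have /esym/eqP := lgP y; rewrite -eix (repE v y x) // eq_sym.
have ix_perm x : ix v (v x) = ix v x.
  rewrite /ix; congr index; apply/eqP; rewrite eq_porbit_mem.
  by have := mem_porbit v 1 x; rewrite expg1.
have comm x : gf (v x) = w (gf x).
  rewrite (main x (v x) (lg x).+1) //= ?lgP //.
have gf_in x : gf x \in O w (ix v x).
  have ltw : (ix v x < size (orbit_seq w))%N by rewrite -eqsz.
  have [ew _] := O_inj w _ _ ltw (repP w x _ ltw); rewrite ew.
  by rewrite /gf -permX mem_porbit.
have gf_inj : injective gf.
  move=> x y e.
  have ltx : (ix v x < size (orbit_seq w))%N by rewrite -eqsz.
  have lty : (ix v y < size (orbit_seq w))%N by rewrite -eqsz.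
  have [_ ex] := O_inj w _ _ ltx (gf_in x).
  have [_ ey] := O_inj w _ _ lty (gf_in y).
  have eix : ix v x = ix v y by rewrite -ex -ey e.
  move/eqP: e; rewrite /gf -eix (repE w y x) // porbit_iter_inj.
  have [ew _] := O_inj w _ _ ltx (repP w x _ ltx); rewrite -ew -cardO //.
  have [ev _] := O_inj v _ _ (ixP v x) (repP v x _ (ixP v x)).
  rewrite ev -porbit_iter_inj lgP (repE v x y) // eix lgP.
  by move/eqP.
exists (perm gf_inj); apply/permP => x.
by rewrite conjgE !permM -{1}(permKV (perm gf_inj) x) !permE comm.
Qed.

Lemma cycle_sizes_gt0 w : all (fun k => 0 < k)%N (cycle_sizes w).
Proof.
apply/allP => k /mapP[A]; rewrite mem_orbit_seq => /imsetP[x _ ->] ->.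
by apply/card_gt0P; exists x; apply: porbit_id.
Qed.

Lemma sumn_cycle_sizes w : sumn (cycle_sizes w) = n.
Proof.
rewrite sumnE big_map -[RHS]card_ord -cardsT.
rewrite (perm_big _ (permEl (perm_sort _ _))) big_enum /= -sum1_card.
rewrite (partition_big_imset (porbit w)) /=; apply: eq_big => [A|A /imsetP[y _ ->]].
  by apply/imsetP/imsetP => -[x _ ->]; exists x.
rewrite -sum1_card; apply: eq_bigl => x.
by rewrite inE /= eq_porbit_mem.
Qed.

Lemma size_cycle_sizes w : (size (cycle_sizes w) <= n)%N.
Proof.
rewrite -[X in (_ <= X)%N](sumn_cycle_sizes w).
elim: (cycle_sizes w) (cycle_sizes_gt0 w) => //= k s IH /andP[k0 s0].
by rewrite -add1n leq_add ?IH.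
Qed.

Lemma cycle_sizes_sorted w : sorted geq (cycle_sizes w).
Proof.
rewrite sorted_map; apply: sort_sorted => A B; exact: leq_total.
Qed.

(** The parts are at most [n], so [inord] keeps them; beyond the last part it yields the padding
    zeros. *)
Definition cycle_tuple w : n.-tuple 'I_n.+1 :=
  [tuple inord (nth 0%N (cycle_sizes w) i) | i < n].

Lemma cycle_tupleE w :
  map val (cycle_tuple w) = cycle_sizes w ++ nseq (n - size (cycle_sizes w)) 0%N.
Proof.
have szE := size_cycle_sizes w.
apply: (@eq_from_nth _ 0%N).
  by rewrite size_map size_tuple size_cat size_nseq subnKC.
move=> i; rewrite size_map size_tuple => lt_in.
rewrite (nth_map ord0) ?size_tuple // -[i]/(val (Ordinal lt_in)) -tnth_nth.
rewrite tnth_mktuple /= inordK; last first.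
  have [lt|ge] := ltnP i (size (cycle_sizes w)); last by rewrite nth_default.
  rewrite ltnS -[X in (_ <= X)%N](sumn_cycle_sizes w) sumnE.
  by rewrite (big_nth 0%N) big_mkord (bigD1 (Ordinal lt)) //= leq_addr.
rewrite nth_cat nth_nseq; case: ltnP => // ge; rewrite nth_default //.
by case: ifP.
Qed.

Lemma cycle_tuple_part w : is_part (cycle_tuple w).
Proof.
rewrite /is_part cycle_tupleE sumn_cat sumn_nseq mul0n addn0 sumn_cycle_sizes eqxx.
rewrite andbT; case E: (cycle_sizes w) => [|k s] /=.
  by elim: (n - 0)%N => //= -[|m] //= ->.
rewrite cat_path; have := cycle_sizes_sorted w; rewrite E /= => -> /=.
by move: (last k s); elim: (n - _)%N => //= m IH l; rewrite IH.
Qed.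

Definition cycle_type w : intpart n := exist (@is_part n) _ (cycle_tuple_part w).

Lemma cycle_type_conj v w : cycle_type v = cycle_type w -> exists g, w = (v ^ g)%g.
Proof.
move=> /(congr1 (fun mu : intpart n => filter (leq 1) (map val (val mu)))) /=.
rewrite !cycle_tupleE !filter_cat => e; apply: cycle_sizes_conj.
have nseq0 k : filter (leq 1) (nseq k 0%N) = [::] by elim: k.
by move: e; rewrite !nseq0 !cats0 !(all_filterP (cycle_sizes_gt0 _)).
Qed.

End CycleType.

Section SpechtSpan.

Variable n : nat.

(** The values of the characters at cycle types form a square matrix indexed by partitions on both
    sides, so independence makes it invertible. [at_type] has the default 0 at partitions that no
    permutation realises. *)
Theorem specht_char_span (psi : {perm 'I_n} -> rat) :
  (forall w g, psi (w ^ g)%g = psi w) ->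
  exists k : intpart n -> rat, forall w, psi w = \sum_mu k mu * specht_char mu w.
Proof.
move=> psiJ.
pose at_type (phi : {perm 'I_n} -> rat) (la : intpart n) :=
  if [pick w | cycle_type w == la] is Some w then phi w else 0.
have at_typeE phi w : (forall w g, phi (w ^ g)%g = phi w) ->
    at_type phi (cycle_type w) = phi w.
  move=> phiJ; rewrite /at_type; case: pickP => [v /eqP e|/(_ w)]; last by rewrite eqxx.
  by have [g ->] := cycle_type_conj e; rewrite phiJ.
pose X : 'M[rat]_#|(intpart n : finType)| :=
  \matrix_(i, j) at_type (specht_char (enum_val i)) (enum_val j).
have coefX (v : 'rV_#|(intpart n : finType)|) w :
    (v *m X) 0 (enum_rank (cycle_type w)) =
    \sum_mu v 0 (enum_rank mu) * specht_char mu w.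
  rewrite mxE [RHS](reindex (@enum_val _ (mem (intpart n : finType)))) /=; last first.
    by exists enum_rank => i _; rewrite ?enum_valK ?enum_rankK.
  apply: eq_bigr => i _; rewrite enum_valK mxE enum_rankK at_typeE // => u g.
  exact: specht_char_conj.
have Xu : X \in unitmx.
  rewrite -row_free_unit -kermx_eq0; apply/rowV0P => v /sub_kermxP v0.
  apply/rowP => i; rewrite mxE -[i]enum_valK.
  apply: (@specht_char_free _ (fun mu => v 0 (enum_rank mu))) => w.
  by rewrite -coefX v0 mxE.
pose y : 'rV[rat]_#|(intpart n : finType)| := \row_j at_type psi (enum_val j).
exists (fun mu => (y *m invmx X) 0 (enum_rank mu)) => w.
by rewrite -coefX mulmxKV // mxE enum_rankK at_typeE.
Qed.

End SpechtSpan.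

(** * Flags of subsets *)

Section YoungBlocks.

Variables (n : nat) (U : {set 'I_n}).

(** Number of the block of [x] when 0, ..., n-1 is cut before each element of [U]; the blocks are
    intervals. *)
Definition blk (x : 'I_n) : nat := #|[set r in U | (r <= x)%N]|.

Lemma blk_mono (x y : 'I_n) : (x <= y)%N -> (blk x <= blk y)%N.
Proof.
move=> le; apply/subset_leq_card/subsetP => r; rewrite !inE => /andP[-> lr].
exact: leq_trans lr le.
Qed.

Lemma blk_lt (x r : 'I_n) : r \in U -> (x < r)%N = (blk x < blk r)%N.
Proof.
move=> Ur; apply/idP/idP => [lt|]; last first.
  by apply: contraTT; rewrite -!leqNgt; apply: blk_mono.
apply/proper_card/properP; split.
  by apply/subsetP => s; rewrite !inE => /andP[-> ls]; apply: leq_trans ls (ltnW lt).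
by exists r; rewrite !inE Ur ?leqnn // -ltnNge.
Qed.

Lemma block_perm_blk (y : {perm 'I_n}) :
  reflect (forall r x : 'I_n, r \in U -> (y x < r)%N = (x < r)%N) (block_perm blk y).
Proof.
apply: (iffP (block_permP _ _)) => [H r x Ur|H x].
  by rewrite !(blk_lt _ Ur) H.
apply: eq_card => r; rewrite !inE; case Ur: (r \in U) => //=.
by rewrite leqNgt [RHS]leqNgt H.
Qed.

End YoungBlocks.

Section Flags.

Variables t n : nat.
Hypothesis t_gt0 : (0 < t)%N.

Local Notation elt := {ffun 'I_t -> {set 'I_n}}.
Local Notation gT := (tuples_perm t n).
Implicit Types (u v w : gT) (U J : {set 'I_n}).

Definition lev (r : nat) v : elt := [ffun j => v j @: [set x : 'I_n | (x < r)%N]].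

Definition flag U v : {set elt} := [set lev r v | r : 'I_n in U].

Lemma lev_in_flag U (r : 'I_n) v : r \in U -> lev r v \in flag U v.
Proof. by move=> Ur; apply/imsetP; exists r. Qed.

Lemma lev_act r v w : Bact t n (lev r v) w = lev r (v * w)%g.
Proof.
apply/ffunP => j; rewrite !ffunE -imset_comp; apply: eq_imset => x /=.
by rewrite permM.
Qed.

Lemma flag_act U v w : (Bact t n)^*%act (flag U v) w = flag U (v * w)%g.
Proof.
rewrite /flag /= /setact -imset_comp; apply: eq_imset => r /=.
exact: lev_act.
Qed.

Lemma card_lev (r : 'I_n) v j : #|lev r v j| = r.
Proof.
rewrite ffunE card_imset; last exact: perm_inj.
have widen_inj : injective (widen_ord (ltnW (ltn_ord r))).
  by move=> x y /(congr1 val) /= /val_inj.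
rewrite -[RHS]card_ord -(card_imset _ widen_inj).
apply: eq_card => x; rewrite inE; apply/idP/imsetP => [lt|[y _ ->]].
  by exists (Ordinal lt) => //; apply: val_inj.
exact: (ltn_ord y).
Qed.

Lemma lev_level (r : 'I_n) v : lev r v \in Blevel t n r.
Proof. by rewrite inE; apply/forallP => j; rewrite card_lev. Qed.

Lemma level_inj (r s : nat) (A : elt) :
  A \in Blevel t n r -> A \in Blevel t n s -> r = s.
Proof.
rewrite !inE => /forallP/(_ (Ordinal t_gt0))/eqP <-.
by move=> /forallP/(_ (Ordinal t_gt0))/eqP <-.
Qed.

Lemma lev_rank_inj (r s : 'I_n) u v : lev r u = lev s v -> r = s.
Proof.
move=> e; apply: val_inj; apply: (@level_inj _ _ (lev r u)); rewrite ?lev_level //.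
by rewrite e lev_level.
Qed.

Lemma lev_eqP (r : 'I_n) u v : reflect
  (forall j x, ((u j * (v j)^-1)%g x < r)%N = (x < r)%N) (lev r u == lev r v).
Proof.
apply: (iffP eqP) => [/ffunP e j x|H].
  move/setP: (e j) => /(_ (u j x)); rewrite !ffunE mem_imset; last exact: perm_inj.
  rewrite inE => ->; rewrite -[u j x](permKV (v j)) mem_imset ?inE ?permM //.
  exact: perm_inj.
apply/ffunP => j; rewrite !ffunE; apply/setP => y.
rewrite -{1}[y](permKV (u j)) -{2}[y](permKV (v j)) !mem_imset; try exact: perm_inj.
by rewrite !inE -(H j ((u j)^-1%g y)) permM permKV.
Qed.

Lemma flag_eq_lev U u v :
  reflect (forall r : 'I_n, r \in U -> lev r u = lev r v) (flag U u == flag U v).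
Proof.
apply: (iffP eqP) => [e r Ur|H]; last by apply: eq_in_imset.
have : lev r u \in flag U v by rewrite -e lev_in_flag.
by case/imsetP => s Us es; rewrite es (lev_rank_inj es).
Qed.

(** Stabilising the initial segments of the lengths in [U] means preserving the blocks cut by [U],
    so flags are cosets of a product of Young subgroups. *)
Lemma flag_eqP U u v :
  reflect (forall j, block_perm (blk U) (u j * (v j)^-1)%g) (flag U u == flag U v).
Proof.
apply: (iffP (flag_eq_lev U u v)) => [H j|H r Ur].
  by apply/block_perm_blk => r x Ur; have /eqP/lev_eqP := H r Ur.
by apply/eqP/lev_eqP => j x; have /block_perm_blk := H j; apply.
Qed.

Lemma flagS U J u v : U \subset J -> flag J u = flag J v -> flag U u = flag U v.
Proof.
move=> /subsetP sUJ /eqP/flag_eq_lev H; apply/eqP/flag_eq_lev => r /sUJ; exact: H.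
Qed.

Lemma card_flag U v : #|flag U v| = #|U|.
Proof. by rewrite card_imset // => r s /lev_rank_inj. Qed.

Lemma flag_type_inj U U' u v : flag U u = flag U' v -> U = U'.
Proof.
move=> e; apply/setP => r; apply/idP/idP => Ur.
  have : lev r u \in flag U' v by rewrite -e lev_in_flag.
  by case/imsetP => s Us /lev_rank_inj->.
have : lev r v \in flag U u by rewrite e lev_in_flag.
by case/imsetP => s Us /lev_rank_inj->.
Qed.

Definition fibre U := #|[set u | flag U u == flag U 1%g]|.

Lemma card_fibre U v : #|[set u | flag U u == flag U v]| = fibre U.
Proof.
rewrite /fibre -[RHS](card_imset _ (mulIg v)); apply: eq_card => u.
rewrite inE; apply/flag_eqP/imsetP => [H|[u' ]].
  exists (u * v^-1)%g; rewrite ?mulgKV // inE; apply/flag_eqP => j.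
  by rewrite !ffunE invg1 mulg1.
rewrite inE => /flag_eqP H -> j; have := H j.
by rewrite !ffunE invg1 mulg1 mulgK.
Qed.

Lemma fibre_gt0 U : (0 < fibre U)%N.
Proof. by apply/card_gt0P; exists 1%g; rewrite inE. Qed.

(** A descent is recorded at its right position: positions start at 0, so the cut between [i - 1]
    and [i] is the rank [i] of the initial segment it ends, and 0 never occurs. *)
Definition Des v : {set 'I_n} :=
  [set i : 'I_n | [exists j, exists x : 'I_n, (x.+1 == i :> nat) && (v j i < v j x)%N]].

Lemma Des_sub U v :
  (Des v \subset U) = [forall j, block_sorted (blk U) val (fun x => val (v j x))].
Proof.
apply/subsetP/forallP => [H j|H i].
  apply/block_sortedP => x y; have [k] := ubnP (y - x)%N.
  elim: k y => // k IH y le_k eb /= lt.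
  have yU : y \notin U by apply/negP => Uy; move: lt; rewrite (blk_lt _ Uy) eb ltnn.
  have lty : (y.-1 < n)%N by apply: leq_ltn_trans (ltn_ord y); apply: leq_pred.
  pose y' := Ordinal lty.
  have y0 : (0 < y)%N by apply: leq_ltn_trans lt.
  have ley : (v j y' <= v j y)%N.
    rewrite leqNgt; apply: contra yU => l; apply: H; rewrite inE.
    by apply/existsP; exists j; apply/existsP; exists y'; rewrite /= prednK // eqxx.
  apply: leq_trans ley; have : (x <= y')%N by rewrite /= -ltnS prednK.
  rewrite leq_eqVlt => /orP[/eqP/val_inj-> //|ltx]; apply: IH => //=.
    by rewrite -ltnS; apply: leq_trans le_k; rewrite ltnS; lia.
  apply/eqP; rewrite eqn_leq blk_mono ?(ltnW ltx) //= eb blk_mono //=.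
  exact: leq_pred.
rewrite inE => /existsP[j /existsP[x /andP[/eqP ex lt]]].
apply/negPn/negP => nU; have ltx : (x < i)%N by rewrite -ex.
have eb : blk U x = blk U i.
  apply: eq_card => r; rewrite !inE; case Ur: (r \in U) => //=.
  rewrite [RHS]leq_eqVlt -ex ltnS; case: eqP => //= er.
  by move: nU; rewrite -(_ : r = i) ?Ur //; apply: val_inj; rewrite /= er ex.
by have /block_sortedP/(_ x i eb ltx) := H j; rewrite leqNgt lt.
Qed.

Lemma ordinal_blk_inj U (x y : 'I_n) : blk U x = blk U y -> val x = val y -> x = y.
Proof. by move=> _; apply: val_inj. Qed.

Lemma Des_rep U v : exists2 u, Des u \subset U & flag U u = flag U v.
Proof.
have ex j : exists y : {perm 'I_n}, block_perm (blk U) y &&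
    block_sorted (blk U) val (fun x => val (v j (y x))).
  have [y py [sy _]] := ex_block_sorted (blk U) val (fun x => val (v j x)).
  by exists y; rewrite py.
pose y j := xchoose (ex j).
have yP j := xchooseP (ex j).
pose u : gT := [ffun j => (y j * v j)%g].
exists u.
  rewrite Des_sub; apply/forallP => j; have /andP[_] := yP j.
  move=> /block_sortedP H; apply/block_sortedP => x x' e l.
  by rewrite ffunE !permM; apply: H.
apply/eqP/flag_eqP => j; rewrite ffunE mulgK.
by have /andP[] := yP j.
Qed.

Definition Psi v : nat := (\sum_j \sum_x val x * val (v j x))%N.

(** Rearrangement inequality in each component: a sorted representative is the unique maximum of
    [Psi] on its coset. *)
Lemma Psi_max U u v : Des u \subset U -> flag U v = flag U u ->
  v = u \/ (Psi v < Psi u)%N.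
Proof.
rewrite Des_sub => /forallP Du /eqP/flag_eqP e.
have vE j x : v j x = u j ((v j * (u j)^-1)%g x) by rewrite permM permKV.
have le j : (\sum_x val x * val (v j x) <= \sum_x val x * val (u j x)
    ?= iff (v j == u j))%N.
  have le1 := block_rearrangement (@ordinal_blk_inj U) (Du j) (e j).
  have eq1 := block_rearrangement_eq (@ordinal_blk_inj U) (Du j) (e j).
  have sE : (\sum_x val x * val (v j x) =
             \sum_x val x * val (u j ((v j * (u j)^-1)%g x)))%N.
    by apply: eq_bigr => x _; rewrite -vE.
  rewrite sE; split=> //; apply/eqP/eqP => [eqs|evu]; last by rewrite -sE evu.
  by apply/permP => x; rewrite vE; apply: val_inj; apply: eq1; rewrite eqs.
have [le1 eq1] := leqif_sum (fun j (_ : true) => le j).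
move: le1; rewrite leq_eqVlt eq1 => /orP[/forallP H|]; [left | by right].
by apply/ffunP => j; apply/eqP; have := H j.
Qed.

Lemma Des_unique U u v :
  Des u \subset U -> Des v \subset U -> flag U v = flag U u -> v = u.
Proof.
move=> Du Dv e; have [//|lt] := Psi_max Du e.
have [->//|lt'] := Psi_max Dv (esym e).
by move: (ltn_trans lt lt'); rewrite ltnn.
Qed.

Lemma flag_face J v : face (Ble (n:=n)) (rank_sel (Blevel t n) J) #|J| (flag J v).
Proof.
rewrite /face card_flag eqxx andbT; apply/andP; split.
  apply/subsetP => A /imsetP[r Jr ->]; apply/bigcupP; exists r => //.
  exact: lev_level.
apply/forall_inP => A /imsetP[r Jr ->]; apply/forall_inP => B /imsetP[s Js ->].
have mono (r' s' : 'I_n) : (r' <= s')%N -> Ble (lev r' v) (lev s' v).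
  move=> le; apply/forallP => j; rewrite !ffunE; apply: imsetS.
  by apply/subsetP => x; rewrite !inE => lt; apply: leq_trans le.
by case/orP: (leq_total r s) => /mono ->; rewrite ?orbT.
Qed.

Lemma face_rank_inj c A B (r : nat) : chain (Ble (n:=n)) c ->
  A \in c -> B \in c -> A \in Blevel t n r -> B \in Blevel t n r -> A = B.
Proof.
move=> /forall_inP ch cA cB; rewrite !inE => /forallP rA /forallP rB.
have /forall_inP/(_ B cB) := ch A cA.
case/orP => /forallP sAB; apply/ffunP => j; [|apply: esym]; apply/eqP;
  by rewrite eqEcard sAB (eqP (rA j)) (eqP (rB j)) leqnn.
Qed.

(** With one element in every selected rank, the chain is realised by permutations that list points
    in the order in which its members absorb them. *)
Lemma face_flag J c : face (Ble (n:=n)) (rank_sel (Blevel t n) J) #|J| c ->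
  exists v, c = flag J v.
Proof.
case/and3P => /subsetP sub ch /eqP card_c.
have ranks A : A \in c -> exists2 r : 'I_n, r \in J & A \in Blevel t n r.
  by move=> /sub /bigcupP[r Jr Ar]; exists r.
(* Rank is injective on a chain, so a chain of [#|J|] elements with ranks in [J] meets every rank of
   [J]. *)
have sel (r : 'I_n) : r \in J -> exists2 A, A \in c & A \in Blevel t n r.
  move=> Jr; pose cr := [set s : 'I_n | [exists A in c, A \in Blevel t n s]].
  have sub_cr : cr \subset J.
    apply/subsetP => s; rewrite inE => /existsP[A /andP[cA As]].
    by have [s' Js' As'] := ranks A cA; rewrite (val_inj (level_inj As As')).
  have le : (#|J| <= #|cr|)%N.
    rewrite -card_c.
    have [f Hf] : exists f : elt -> 'I_n, {in c, forall A, A \in Blevel t n (f A)}.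
      exists (fun A => odflt r [pick s : 'I_n | A \in Blevel t n s]) => A cA.
      by case: pickP => //= no; have [s _ As] := ranks A cA; have := no s; rewrite As.
    rewrite -(card_in_imset (f := f) (D := mem c)).
      apply/subset_leq_card/subsetP => s /imsetP[A cA ->]; rewrite inE.
      by apply/existsP; exists A; rewrite cA Hf.
    move=> A B cA cB e; apply: (face_rank_inj ch cA cB (Hf A cA)).
    by rewrite e; apply: Hf.
  have : r \in cr by rewrite (eqP (_ : cr == J)) // eqEcard sub_cr le.
  by rewrite inE => /existsP[A /andP[cA Ar]]; exists A.
(* Points missed by fewer members of the chain come first; sorting by this number makes every member
   an initial segment. *)
pose key (j : 'I_t) (x : 'I_n) := #|[set A in c | x \notin (A : elt) j]|.
have ex j : exists y : {perm 'I_n}, block_sorted (fun _ : 'I_n => tt) val (fun x => key j (y x)).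
  have [y _ [sy _]] := ex_block_sorted (fun _ : 'I_n => tt) val (key j).
  by exists y.
pose v : gT := [ffun j => xchoose (ex j)].
have vS j : block_sorted (fun _ : 'I_n => tt) val (fun x => key j (v j x)).
  by rewrite ffunE; apply: (xchooseP (ex j)).
have levA (r : 'I_n) A : A \in c -> A \in Blevel t n r -> A = lev r v.
  move=> cA Ar; apply/ffunP => j; rewrite ffunE.
  have down (x y : 'I_n) : (x < y)%N -> v j y \in A j -> v j x \in A j.
    move=> lt Ay; apply/negPn/negP => nAx.
    have /block_sortedP/(_ x y erefl lt) := vS j; rewrite leqNgt; case/negP.
    apply/proper_card/properP; split; last first.
      by exists A; rewrite !inE cA ?nAx // Ay.
    apply/subsetP => B; rewrite !inE => /andP[cB nBy]; rewrite cB /=.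
    move/forall_inP: ch => /(_ A cA)/forall_inP/(_ B cB).
    case/orP => /forallP/(_ j)/subsetP s; last by apply: contra nAx; apply: s.
    by rewrite (s _ Ay) in nBy.
  have cardA : #|[set x | v j x \in A j]| = r.
    have := Ar; rewrite inE => /forallP/(_ j)/eqP <-.
    rewrite -(card_imset _ (@perm_inj _ (v j))); apply: eq_card => y.
    apply/imsetP/idP => [[x]|Ay]; first by rewrite inE => ? ->.
    by exists ((v j)^-1%g y); rewrite ?permKV // inE permKV.
  have init : [set x | v j x \in A j] = [set x : 'I_n | (x < r)%N].
    have cr : #|[set x : 'I_n | (x < r)%N]| = r.
      have := card_lev r 1%g (Ordinal t_gt0); rewrite ffunE card_imset //.
      exact: perm_inj.
    have [sub1|/subsetPn[x]] := boolP ([set x | v j x \in A j] \subset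
                                      [set x : 'I_n | (x < r)%N]).
      by apply/eqP; rewrite eqEcard sub1 cr cardA leqnn.
    rewrite !inE -leqNgt => Ax lex; apply/esym/eqP; rewrite eqEcard cr cardA leqnn andbT.
    by apply/subsetP => y; rewrite !inE => lt; apply: down Ax; apply: leq_trans lex.
  apply/setP => y; rewrite -init; apply/idP/imsetP => [Ay|[x]].
    by exists ((v j)^-1%g y); rewrite ?permKV // inE permKV.
  by rewrite inE => ? ->.
exists v; apply/setP => A; apply/idP/imsetP => [cA|[r Jr ->]].
  by have [r Jr Ar] := ranks A cA; exists r => //; apply: levA.
by have [A' cA' Ar] := sel r Jr; rewrite -(levA r A').
Qed.

End Flags.

(** * The top homology *)

Lemma act_mx_coef (gT : finGroupType) (S : finType) (to : {action gT &-> S})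
    m (M : 'M[rat]_(m, #|S|)) g i x :
  (M *m act_repr to g) i (enum_rank x) = M i (enum_rank (to x g^-1%g)).
Proof.
rewrite mxE (bigD1 (enum_rank (to x g^-1%g))) //= big1 ?addr0 => [|k nk].
  by rewrite mxE enum_rankK actKV mxE !eqxx mulr1.
rewrite mxE mxE eqxx /= (inj_eq enum_rank_inj).
case: eqP => [e|_]; last by rewrite mulr0.
by case/eqP: nk; rewrite e actK enum_valK.
Qed.

(** The submodule divided out is zero, so the basis [R] stays free in the quotient. *)
Lemma mxtrace_section (F : fieldType) (gT : finGroupType) (G : {group gT}) n
    (rG : mx_representation F G n) (U V : 'M_n)
    (modU : mxmodule rG U) (modV : mxmodule rG V) m (R : 'M_(m, n)) h g :
  g \in G -> U = 0 -> row_free R -> (R :=: V)%MS -> R *m rG g = h *m R ->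
  \tr (section_repr modU modV g) = \tr h.
Proof.
move=> Gg U0 freeR eqRV gR.
apply: (mxtrace_submod _ (R := in_factmod U R)) => //.
- rewrite /row_free; have := mxrank_in_factmod U R.
  rewrite U0 mxrank0 addn0 => ->; rewrite adds0mx; exact: freeR.
- apply: eqmx_trans (eqmx_sym (genmxE _)); rewrite [in_factmod U R]in_factmodE.
  rewrite [in_factmod U V]in_factmodE; exact: eqmxMr.
apply: etrans (esym (in_factmodJ modU R Gg)) _; rewrite gR.
by rewrite [LHS]in_factmodE -mulmxA -in_factmodE.
Qed.

(** A vector in the kernel yields a combination of the rows with zero sum of squares, hence zero in
    a real field. *)
Lemma gram_unit (F : Num.RealField.type) m n (R : 'M[F]_(m, n)) :
  row_free R -> R *m R^T \in unitmx.
Proof.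
move=> freeR; rewrite -row_free_unit -kermx_eq0; apply/rowV0P => v /sub_kermxP e.
apply: (row_free_inj freeR); rewrite mul0mx.
have : (v *m R) *m (v *m R)^T = 0 by rewrite trmx_mul mulmxA -(mulmxA v) e mul0mx.
move/(congr1 (fun M : 'M_1 => M 0 0)); rewrite !mxE => /eqP.
rewrite Num.Theory.psumr_eq0 => [/allP H|i _]; last first.
  by rewrite !mxE -expr2 Num.Theory.sqr_ge0.
apply/rowP => k; apply/eqP; rewrite [X in _ == X]mxE.
have := H k (mem_index_enum _); rewrite /= [X in _ * X]mxE -expr2.
by rewrite expf_eq0 => /andP[].
Qed.

Section FlagMatrices.

Variables t n : nat.
Hypothesis t_gt0 : (0 < t)%N.

Local Notation elt := {ffun 'I_t -> {set 'I_n}}.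
Local Notation gT := (tuples_perm t n).
Implicit Types (u v w g : gT) (U J : {set 'I_n}).
Local Notation NF := #|{set elt}|.
Local Notation NG := #|(gT : finType)|.
Local Notation act := (act_repr (mulgr_action gT)).
Local Notation flag := (@flag t n).
Local Notation fibre := (@fibre t n).
Local Notation Des := (@Des t n).

(** Its rows are the indicators of the flag fibres on the group (zero rows for sets that are no
    [U]-flag), so its row space is the space W_U of the overview. *)
Definition Th U : 'M[rat]_(NF, NG) :=
  \matrix_(c, u) (enum_val c == flag U (enum_val u))%:R.

Lemma ThE U c u : Th U (enum_rank c) (enum_rank u) = (c == flag U u)%:R.
Proof. by rewrite mxE !enum_rankK. Qed.

Lemma sets_Th U g : sets_mx (Bact t n) g *m Th U = Th U *m act g.
Proof.
apply/matrixP => i k; rewrite -[i]enum_valK -[k]enum_valK.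
set c := enum_val i; set u := enum_val k.
rewrite act_mx_coef ThE.
have -> : (sets_mx (Bact t n) g *m Th U) (enum_rank c) (enum_rank u) =
          (row (enum_rank c) (sets_mx (Bact t n) g) *m Th U) 0 (enum_rank u).
  by rewrite -row_mul [RHS]mxE.
rewrite rowK enum_rankK -rowE mxE ThE -[mulgr_action _ _ _]/(u * g^-1)%g -flag_act.
by rewrite -(inj_eq (act_inj (Bact t n)^*%act g^-1%g)) actK.
Qed.

Lemma Th_const U (x : 'rV[rat]_NG) :
  (forall u v, flag U u = flag U v -> x 0 (enum_rank u) = x 0 (enum_rank v)) ->
  x *m (Th U)^T *m Th U = (fibre U)%:R *: x.
Proof.
move=> xU; apply/rowP => k; rewrite -[k]enum_valK; set w := enum_val k.
rewrite mxE (bigD1 (enum_rank (flag U w))) //= big1 ?addr0 => [|c nc]; last first.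
  rewrite -[c in Th U c _]enum_valK ThE; case: eqP => [e|]; last by rewrite mulr0.
  by case/eqP: nc; rewrite -e enum_valK.
rewrite ThE eqxx mulr1 !mxE (reindex (@enum_rank gT)) /=; last first.
  by exists enum_val => ? _; rewrite ?enum_rankK ?enum_valK.
rewrite (bigID (fun u => flag U u == flag U w)) /= [X in _ + X]big1 ?addr0; last first.
  by move=> u; rewrite mxE ThE eq_sym => /negPf->; rewrite mulr0.
rewrite (eq_bigr (fun _ => x 0 (enum_rank w))) => [|u /eqP e]; last first.
  by rewrite mxE ThE e eqxx mulr1 (xU u w).
rewrite sumr_const -[LHS]mulr_natl; congr (_%:R * _).
by rewrite -(card_fibre t_gt0 U w); apply: eq_card => u; rewrite inE.
Qed.

Lemma fibre_neq0 U : (fibre U)%:R != 0 :> rat.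
Proof. by rewrite Num.Theory.pnatr_eq0 -lt0n fibre_gt0. Qed.

Lemma const_sub_Th U (x : 'rV[rat]_NG) :
  (forall u v, flag U u = flag U v -> x 0 (enum_rank u) = x 0 (enum_rank v)) ->
  (x <= Th U)%MS.
Proof.
move=> /Th_const e; rewrite -(eqmx_scale _ (fibre_neq0 U)) -e; exact: submxMl.
Qed.

Lemma Th_row_const U c u v : flag U u = flag U v ->
  row c (Th U) 0 (enum_rank u) = row c (Th U) 0 (enum_rank v).
Proof. by move=> e; rewrite !mxE !enum_rankK e. Qed.

Definition bvec v : 'rV[rat]_NG := row (enum_rank (flag (Des v) v)) (Th (Des v)).

Lemma bvecE v u : bvec v 0 (enum_rank u) = (flag (Des v) v == flag (Des v) u)%:R.
Proof. by rewrite mxE ThE. Qed.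

Definition Bmx : 'M[rat]_NG := \matrix_i bvec (enum_val i).

(** On the coset that [bvec v] indicates, [v] is the strict maximum of [Psi], so the matrix is
    triangular with ones on the diagonal. *)
Lemma Bmx_unit : Bmx \in unitmx.
Proof.
rewrite -row_free_unit -kermx_eq0; apply/rowV0P => x /sub_kermxP x0.
apply/rowP => k; rewrite mxE -[k]enum_valK.
apply: (@triangular_eq0 _ _ _ predT (fun v => x 0 (enum_rank v)) id (@Psi t n)
  (fun v u => bvec v 0 (enum_rank u))) => // [v _|v u _ _|u _].
- by rewrite bvecE eqxx oner_eq0.
- rewrite bvecE Num.Theory.pnatr_eq0 eqb0 negbK => /eqP e.
  have [->|] := Psi_max t_gt0 (subxx (Des v)) (esym e); [by left | by right].
have := congr1 (fun M : 'rV_ _ => M 0 (enum_rank u)) x0.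
rewrite mxE [RHS]mxE => e0; apply: etrans e0.
rewrite [RHS](reindex (@enum_rank gT)) /=; last first.
  by exists enum_val => ? _; rewrite ?enum_rankK ?enum_valK.
by apply: eq_bigr => v _; rewrite [in RHS]mxE enum_rankK.
Qed.

Lemma bvec_sub U v : Des v \subset U -> (bvec v <= Th U)%MS.
Proof.
move=> DU; apply: const_sub_Th => u w e; apply: Th_row_const.
exact: flagS DU e.
Qed.

Definition sel (A : {set gT}) : 'M[rat]_(#|A|, NG) :=
  \matrix_i delta_mx 0 (enum_rank (enum_val i)).

Lemma sel_mul (A : {set gT}) m (M : 'M[rat]_(NG, m)) i :
  row i (sel A *m M) = row (enum_rank (enum_val i)) M.
Proof. by rewrite row_mul rowK -rowE. Qed.

Lemma selT A : sel A *m (sel A)^T = 1%:M.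
Proof.
apply/row_matrixP => i; rewrite sel_mul row1; apply/rowP => k.
by rewrite !mxE eqxx /= (inj_eq enum_rank_inj) (inj_eq enum_val_inj) eq_sym.
Qed.

Definition Rmx A := sel A *m Bmx.

Lemma row_Rmx A i : row i (Rmx A) = bvec (enum_val i).
Proof. by rewrite sel_mul rowK enum_rankK. Qed.

Lemma Rmx_free A : row_free (Rmx A).
Proof.
by apply/row_freeP; exists (invmx Bmx *m (sel A)^T); rewrite mulmxA mulmxK ?selT ?Bmx_unit.
Qed.

Definition VU U : {set gT} := [set v | Des v \subset U].

(** A second basis of W_U, made of indicators of [U]-flags, indexed by the representatives with
    descents in [U]; the group permutes it. *)
Definition FR U : 'M[rat]_(#|VU U|, NG) :=
  \matrix_i row (enum_rank (flag U (enum_val i))) (Th U).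

Lemma Th_sub_FR U : (Th U <= FR U)%MS.
Proof.
apply/row_subP => c; case: (pickP (fun u => enum_val c == flag U u)) => [u /eqP e|no].
  have [v Dv ev] := Des_rep t_gt0 U u.
  have Vv : v \in VU U by rewrite inE.
  rewrite (_ : row c (Th U) = row (enum_rank_in Vv v) (FR U)) ?row_sub //.
  by rewrite rowK enum_rankK_in // ev -e enum_valK.
rewrite (_ : row c (Th U) = 0) ?sub0mx //; apply/rowP => k.
by rewrite !mxE no.
Qed.

Lemma Rmx_sub U : (Rmx (VU U) <= Th U)%MS.
Proof.
apply/row_subP => i; rewrite row_Rmx; apply: bvec_sub.
by have := enum_valP i; rewrite inE.
Qed.

Lemma FR_sub U : (FR U <= Th U)%MS.
Proof. by apply/row_subP => i; rewrite rowK row_sub. Qed.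

(** Squeezed between a spanning family and an independent one, both indexed by [VU U]. *)
Lemma rank_Th U : \rank (Th U) = #|VU U|.
Proof.
apply/eqP; rewrite eqn_leq (leq_trans (mxrankS (Th_sub_FR U)) (rank_leq_row _)) /=.
by have /eqP {1}<- := Rmx_free (VU U); apply: mxrankS (Rmx_sub U).
Qed.

Lemma Rmx_eq U : (Rmx (VU U) :=: Th U)%MS.
Proof.
apply/eqmxP; rewrite -(mxrank_leqif_eq (Rmx_sub U)) rank_Th.
exact: Rmx_free.
Qed.

Lemma FR_eq U : (FR U :=: Th U)%MS.
Proof. by apply/eqmxP; rewrite FR_sub Th_sub_FR. Qed.

Lemma FR_free U : row_free (FR U).
Proof. by rewrite /row_free FR_eq rank_Th. Qed.

Definition Hmx g : 'M[rat]_NG := Bmx *m act g *m invmx Bmx.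

Lemma mulmx_selT m (M : 'M[rat]_(m, NG)) (A : {set gT}) i k :
  (M *m (sel A)^T) i k = M i (enum_rank (enum_val k)).
Proof.
rewrite -[M]trmxK -trmx_mul mxE.
by have /rowP/(_ i) := sel_mul M^T k; rewrite !mxE.
Qed.

(** [g] maps [bvec v] into W_(D(v)), spanned by basis vectors with smaller or equal descent set. A
    family closed downwards thus spans a stable space, with trace a partial diagonal sum of one
    fixed matrix. *)
Lemma Rmx_trace (A : {set gT}) g :
  (forall u v, v \in A -> Des u \subset Des v -> u \in A) ->
  exists2 h, Rmx A *m act g = h *m Rmx A &
    \tr h = \sum_(v in A) Hmx g (enum_rank v) (enum_rank v).
Proof.
move=> closedA.
have /submxP[h eh] : (Rmx A *m act g <= Rmx A)%MS.
  apply/row_subP => i; rewrite row_mul row_Rmx; set v := enum_val i.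
  have Av : v \in A by apply: enum_valP.
  apply: (@submx_trans _ _ _ _ _ _ (Th (Des v))).
    apply: submx_trans (submxMr _ (bvec_sub (subxx _))) _.
    by rewrite -sets_Th submxMl.
  rewrite -(Rmx_eq (Des v)); apply/row_subP => k; rewrite row_Rmx.
  have Dk : Des (enum_val k) \subset Des v by have := enum_valP k; rewrite inE.
  have Ak := closedA _ _ Av Dk.
  by rewrite -{1}(enum_rankK_in Ak Ak) -row_Rmx row_sub.
exists h => //.
have -> : h = sel A *m Hmx g *m (sel A)^T.
  have e : h *m sel A = sel A *m Hmx g.
    apply: (can_inj (mulmxK Bmx_unit)).
    rewrite -[LHS]mulmxA -/(Rmx A) -eh -[RHS]mulmxA /Hmx mulmxKV ?Bmx_unit //.
    by rewrite [RHS]mulmxA.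
  by rewrite -e -mulmxA selT mulmx1.
rewrite /mxtrace [RHS]big_enum_val; apply: eq_bigr => i _.
rewrite mulmx_selT; have /rowP/(_ (enum_rank (enum_val i))) := sel_mul (Hmx g) i.
by rewrite [LHS]mxE [RHS]mxE.
Qed.

Lemma VU_closed U u v : v \in VU U -> Des u \subset Des v -> u \in VU U.
Proof. by rewrite !inE => Dv Du; apply: subset_trans Du Dv. Qed.

(** The trace on W_U computed in two bases: the descent basis gives a diagonal sum, the permuted
    flag basis counts fixed flags. *)
Lemma fix_trace U g : \sum_(v in VU U) Hmx g (enum_rank v) (enum_rank v) =
  #|[set v in VU U | flag U (v * g)%g == flag U v]|%:R.
Proof.
have [h eh <-] := @Rmx_trace (VU U) g (@VU_closed U).
pose h2 : 'M[rat]_#|VU U| :=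
  \matrix_(i, j) (flag U (enum_val i * g)%g == flag U (enum_val j))%:R.
have eh2 : FR U *m act g = h2 *m FR U.
  apply/row_matrixP => i; rewrite [in LHS]row_mul rowK -row_mul -sets_Th row_mul rowK.
  rewrite enum_rankK flag_act -rowE [RHS]row_mul mulmx_sum_row.
  have [v Dv ev] := Des_rep t_gt0 U (enum_val i * g)%g.
  have Vv : v \in VU U by rewrite inE.
  rewrite (bigD1 (enum_rank_in Vv v)) //= big1 ?addr0 => [|k nk].
    by rewrite mxE mxE enum_rankK_in // -ev eqxx scale1r rowK enum_rankK_in // ev.
  rewrite mxE mxE; case: eqP => [e|_]; last by rewrite scale0r.
  case/eqP: nk; apply: enum_val_inj; rewrite enum_rankK_in //.
  apply: (Des_unique t_gt0 Dv); first by have := enum_valP k; rewrite inE.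
  by rewrite -e ev.
rewrite (mxtrace_basis (Rmx_free _) (FR_free U) _ eh eh2); last first.
  exact: eqmx_trans (Rmx_eq U) (eqmx_sym (FR_eq U)).
rewrite /mxtrace -[in RHS]sum1_card natr_sum.
rewrite (eq_bigl (fun v => (v \in VU U) && (flag U (v * g)%g == flag U v))); last first.
  by move=> v; rewrite inE.
rewrite big_mkcondr /= [RHS]big_enum_val; apply: eq_bigr => i _.
by rewrite mxE; case: eqP.
Qed.

Lemma chain_card_le J (c : {set elt}) :
  c \subset rank_sel (Blevel t n) J -> chain (Ble (n:=n)) c -> (#|c| <= #|J|)%N.
Proof.
move=> /subsetP sub ch.
have [->|[A0 cA0]] := set_0Vmem c; first by rewrite cards0.
have /bigcupP[r0 _ _] := sub _ cA0.
pose f (A : elt) := odflt r0 [pick s : 'I_n in J | A \in Blevel t n s].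
have fP A : A \in c -> (f A \in J) && (A \in Blevel t n (f A)).
  move=> /sub /bigcupP[s Js As]; rewrite /f; case: pickP => [s' /andP[-> ->] //|].
  by move=> /(_ s); rewrite Js As.
rewrite -(card_in_imset (f := f) (D := mem c)).
  by apply/subset_leq_card/subsetP => s /imsetP[A /fP/andP[JA _] ->].
move=> A B cA cB e; have /andP[_ fA] := fP A cA; have /andP[_ fB] := fP B cB.
by apply: (face_rank_inj ch cA cB fA); rewrite e.
Qed.

Local Notation P J := (rank_sel (Blevel t n) J).
Local Notation bnd J := (boundary (Ble (n:=n)) (P J) #|J|).

(** A chain has at most one element per selected rank, so no larger face exists and the top homology
    is the space of cycles. *)
Lemma boundary_over J : boundary (Ble (n:=n)) (P J) #|J|.+1 = 0.
Proof.
apply/row_matrixP => i; rewrite rowK row0; case: ifP => // /and3P[sub ch /eqP cc].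
by have := chain_card_le sub ch; rewrite cc ltnn.
Qed.

Lemma Ble_lev (r s : 'I_n) u :
  (lev r u != lev s u) && Ble (lev r u) (lev s u) = (r < s)%N.
Proof.
apply/andP/idP => [[ne /forallP/(_ (Ordinal t_gt0))/subset_leq_card]|lt].
  rewrite !card_lev leq_eqVlt => /orP[/eqP/val_inj e|//].
  by rewrite e eqxx in ne.
split; first by apply: contraTneq lt => /(lev_rank_inj t_gt0)->; rewrite ltnn.
apply/forallP => j; rewrite !ffunE; apply: imsetS; apply/subsetP => x.
by rewrite !inE => l; apply: leq_trans l (ltnW lt).
Qed.

Definition pos J (i : 'I_n) : nat := #|[set r in J | (r < i)%N]|.

Lemma face_boundary_flag J u : face_boundary (Ble (n:=n)) (flag J u) =
  \sum_(i in J) (-1) ^+ pos J i *: delta_mx 0 (enum_rank (flag (J :\ i) u)).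
Proof.
rewrite /face_boundary big_imset /=; last by move=> r s _ _ /(lev_rank_inj t_gt0).
apply: eq_bigr => i Ji; congr (_ ^+ _ *: delta_mx 0 (enum_rank _)).
  have lev_inj : injective (fun r : 'I_n => lev r u).
    by move=> r s /(lev_rank_inj t_gt0).
  rewrite /pos -(card_imset _ lev_inj); apply: eq_card => A; rewrite inE.
  apply/andP/imsetP => [[/imsetP[r Jr ->]]|[r]]; rewrite ?inE.
    by rewrite Ble_lev => lt; exists r; rewrite // inE Jr.
  by move=> /andP[Jr lt] ->; rewrite Ble_lev lt lev_in_flag.
apply/setP => A; rewrite !inE; apply/andP/imsetP => [[ne /imsetP[r Jr e]]|[r]].
  exists r => //; rewrite !inE Jr andbT; apply: contraNneq ne => er.
  by rewrite e er.
rewrite !inE => /andP[ne Jr] ->; rewrite lev_in_flag //; split=> //.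
by apply: contraNneq ne => /(lev_rank_inj t_gt0)->.
Qed.

Lemma ThT_row U u : row (enum_rank u) (Th U)^T = delta_mx 0 (enum_rank (flag U u)).
Proof.
apply/rowP => k; rewrite !mxE enum_rankK eqxx /=.
by rewrite -(inj_eq enum_rank_inj) enum_valK.
Qed.

Lemma Th_boundary J : (Th J)^T *m bnd J =
  \sum_(i in J) (-1) ^+ pos J i *: (Th (J :\ i))^T.
Proof.
apply/row_matrixP => k; rewrite -[k]enum_valK; set u := enum_val k.
rewrite row_mul ThT_row -rowE rowK enum_rankK (flag_face t_gt0) face_boundary_flag.
rewrite linear_sum; apply: eq_bigr => i _ /=.
by rewrite [in RHS]linearZ /= ThT_row.
Qed.

Lemma Th_col0 m (x : 'M[rat]_(m, NG)) U a c :
  (forall u, c <> flag U u) -> (x *m (Th U)^T) a (enum_rank c) = 0.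
Proof.
move=> no; rewrite mxE big1 // => k _; rewrite mxE mxE enum_rankK.
by case: eqP => [/no//|_]; rewrite mulr0.
Qed.

Lemma ThTh_const U m (x : 'M[rat]_(m, NF)) :
  x *m Th U *m (Th U)^T *m Th U = (fibre U)%:R *: (x *m Th U).
Proof.
apply/row_matrixP => i; rewrite !row_mul Th_const ?linearZ /= ?row_mul //.
move=> u v e; rewrite -row_mul; have [y ->] : exists y, row i (x *m Th U) = y *m Th U.
  by exists (row i x); rewrite row_mul.
rewrite !mxE; apply: eq_bigr => c _; rewrite !mxE !enum_rankK e //.
Qed.

Lemma chain_space_face k J (z : 'rV[rat]_NF) c :
  (z <= chain_space (Ble (n:=n)) (P J) k)%MS ->
  z 0 (enum_rank c) != 0 -> face (Ble (n:=n)) (P J) k c.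
Proof.
move=> /submxP[y ->]; apply: contraR => nf; rewrite mxE big1 // => i _.
rewrite mxE; case: eqP => [->|_]; last by rewrite mulr0.
by rewrite enum_rankK (negPf nf) mulr0.
Qed.

Lemma chain_ThTh J (z : 'rV[rat]_NF) :
  (z <= chain_space (Ble (n:=n)) (P J) #|J|)%MS ->
  z *m Th J *m (Th J)^T = (fibre J)%:R *: z.
Proof.
move=> zC; apply/rowP => k; rewrite -[k]enum_valK; set c := enum_val k.
case: (pickP (fun v => c == flag J v)) => [v /eqP ec|no]; last first.
  rewrite Th_col0 => [|u e]; last by have := no u; rewrite e eqxx.
  rewrite mxE; apply/esym/eqP; rewrite mulf_eq0; apply/orP; right.
  apply/negPn/negP => /(chain_space_face zC)/(face_flag t_gt0)[u e].
  by have := no u; rewrite e eqxx.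
have zTh u : (z *m Th J) 0 (enum_rank u) = z 0 (enum_rank (flag J u)).
  rewrite mxE (bigD1 (enum_rank (flag J u))) //= big1 ?addr0 ?ThE ?eqxx ?mulr1 //.
  move=> i ni; rewrite -[i in Th J i _]enum_valK ThE.
  by case: eqP => [e|_]; rewrite ?mulr0 //; case/eqP: ni; rewrite -e enum_valK.
rewrite mxE (reindex (@enum_rank gT)) /=; last first.
  by exists enum_val => ? _; rewrite ?enum_rankK ?enum_valK.
rewrite (bigID (fun u => flag J u == c)) /= [X in _ + X]big1 ?addr0 => [|u ne]; last first.
  by rewrite [(Th J)^T _ _]mxE ThE eq_sym (negPf ne) mulr0.
rewrite (eq_bigr (fun _ => z 0 (enum_rank c))) => [|u /eqP e]; last first.
  by rewrite [(Th J)^T _ _]mxE ThE e eqxx mulr1 zTh e.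
rewrite sumr_const -[LHS]mulr_natl [RHS]mxE; congr (_%:R * _).
by rewrite -(card_fibre t_gt0 J v); apply: eq_card => u; rewrite inE ec.
Qed.

Lemma ThT_chain m J (x : 'M[rat]_(m, NG)) :
  (x *m (Th J)^T <= chain_space (Ble (n:=n)) (P J) #|J|)%MS.
Proof.
apply: mulmx_sub; apply/row_subP => k; rewrite -[k]enum_valK ThT_row.
set c := enum_rank _.
rewrite (_ : delta_mx 0 c = row c (chain_space (Ble (n:=n)) (P J) #|J|)) ?row_sub //.
apply/rowP => i; rewrite !mxE eqxx /= eq_sym; case: eqP => [e|] //=.
by rewrite /c enum_rankK (flag_face t_gt0).
Qed.

(** Lifted to the group, the cycles [X] and the basis vectors [Y] with descent set properly inside
    [J] are orthogonal and together span W_J. The trace on [X] is the difference of two partial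
    diagonal sums. *)
Theorem top_homology_trace J g :
  top_homology_char J g =
  \sum_(v | Des v == J) Hmx g (enum_rank v) (enum_rank v).
Proof.
set Cy := cycles (Ble (n:=n)) (P J) #|J|; pose Rc := row_base Cy.
have modCy := cycles_module (@Ble_act t n) (@Brank_sel_act t n J) #|J|.
have eqRc : (Rc :=: Cy)%MS by apply: eq_row_base.
have freeRc : row_free Rc by apply: row_base_free.
clearbody Rc.
have /submxP[h eh] : (Rc *m sets_mx (Bact t n) g <= Rc)%MS.
  rewrite eqRc; apply: submx_trans (submxMr _ _) (mxmoduleP modCy g (in_setT g)).
  by rewrite eqRc.
have -> : top_homology_char J g = \tr h.
  rewrite /top_homology_char /homology_char /homology_repr.
  exact: (mxtrace_section _ _ (in_setT g) (boundary_over J) freeRc eqRc eh).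
have RcC (x : 'rV_(\rank Cy)) :
    (x *m Rc <= chain_space (Ble (n:=n)) (P J) #|J|)%MS.
  by apply: mulmx_sub; rewrite eqRc capmxSl.
have RcB : Rc *m bnd J = 0.
  by apply/sub_kermxP; rewrite eqRc capmxSr.
pose S := [set v | Des v \proper J].
pose X := Rc *m Th J; pose Y := Rmx S.
(* Faces omitting different ranks have different types, so the vanishing boundary splits into one
   equation for each [i]. *)
have X0 i : i \in J -> X *m (Th (J :\ i))^T = 0.
  move=> Ji; apply/row_matrixP => k; rewrite row_mul row0 row_mul.
  set z := row k Rc.
  have zC : (z <= chain_space (Ble (n:=n)) (P J) #|J|)%MS.
    by rewrite /z rowE RcC.
  have e0 : z *m Th J *m (Th J)^T *m bnd J = 0.
    by rewrite chain_ThTh // -scalemxAl /z -row_mul RcB row0 scaler0.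
  rewrite -mulmxA Th_boundary mulmx_sumr in e0.
  apply/rowP => l; rewrite -[l]enum_valK [RHS]mxE; set d := enum_val l.
  case: (pickP (fun u => d == flag (J :\ i) u)) => [u /eqP ed|no]; last first.
    by apply: Th_col0 => u e; have := no u; rewrite e eqxx.
  have := congr1 (fun M : 'rV_ _ => M 0 (enum_rank d)) e0.
  rewrite summxE [RHS]mxE (bigD1 i) //= big1 ?addr0 => [|r /andP[Jr nr]].
    rewrite -scalemxAr mxE => /eqP; rewrite mulf_eq0 signr_eq0 => /eqP.
    by [].
  rewrite -scalemxAr mxE Th_col0 ?mulr0 // => u' e'.
  move: e'; rewrite ed => /(flag_type_inj t_gt0) /setP/(_ r).
  by rewrite !inE Jr eqxx nr.
(* A descent set properly inside [J] misses some [i] of [J], so its basis vector lies in the space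
   of [J :\ i], orthogonal to the cycles. *)
have XY : X *m Y^T = 0.
  apply: trmx_inj; rewrite trmx_mul trmxK trmx0; apply/row_matrixP => k.
  rewrite row_mul row_Rmx row0; set v := enum_val k.
  have : v \in S by apply: enum_valP.
  rewrite inE => /properP[DJ [i Ji nDi]].
  have DJi : Des v \subset J :\ i.
    apply/subsetP => r Dr; rewrite !inE (subsetP DJ) // andbT.
    by apply: contraNneq nDi => <-.
  have /submxP[y ->] := bvec_sub DJi.
  by rewrite -mulmxA -[Th _ *m _]trmxK trmx_mul trmxK X0 // trmx0 mulmx0.
have freeX : row_free X.
  rewrite -kermx_eq0; apply/rowV0P => x /sub_kermxP; rewrite mulmxA => x0.
  apply: (row_free_inj freeRc); rewrite mul0mx.
  have := chain_ThTh (RcC x); rewrite x0 mul0mx => /esym/eqP.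
  by rewrite scaler_eq0 (negPf (fibre_neq0 J)) => /eqP.
have freeY : row_free Y by apply: Rmx_free.
have YY := gram_unit freeY.
pose R1 := col_mx X Y.
have freeR1 : row_free R1.
  rewrite -kermx_eq0; apply/rowV0P => x /sub_kermxP.
  rewrite -[x]hsubmxK mul_row_col => e.
  have y0 : rsubmx x = 0.
    have := congr1 (mulmx^~ Y^T) e; rewrite mulmxDl -mulmxA XY mulmx0 add0r mul0mx.
    rewrite -mulmxA => e'; apply: (can_inj (mulmxK YY)).
    by rewrite e' mul0mx.
  move: e; rewrite y0 mul0mx addr0 => e.
  have -> : lsubmx x = 0 by apply: (row_free_inj freeX); rewrite e mul0mx.
  by rewrite row_mx0.
have subY i : i \in J -> (Th (J :\ i) <= Y)%MS.
  move=> Ji; rewrite -(Rmx_eq (J :\ i)); apply/row_subP => k; rewrite row_Rmx.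
  have Dk : Des (enum_val k) \subset J :\ i by have := enum_valP k; rewrite inE.
  have Sk : enum_val k \in S.
    rewrite inE properE (subset_trans Dk (subD1set _ _)) /=.
    by apply/negP => /subsetP/(_ i Ji)/(subsetP Dk); rewrite !inE eqxx.
  by rewrite -{1}(enum_rankK_in Sk Sk) -row_Rmx row_sub.
have eqR1 : (R1 :=: Rmx (VU J))%MS.
  apply: eqmx_trans (eqmx_sym (Rmx_eq J)); apply/eqmxP/andP; split.
    rewrite col_mx_sub submxMl /=; apply/row_subP => k; rewrite row_Rmx.
    by apply: bvec_sub; have := enum_valP k; rewrite inE => /proper_sub.
  (* The residue of W_J under orthogonal projection to the span of [Y]. It is orthogonal to every
     W_(J \ i), hence comes from cycles. *)
  pose M := Th J - Th J *m Y^T *m invmx (Y *m Y^T) *m Y.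
  have MY : M *m Y^T = 0.
    by rewrite mulmxBl -[X in _ - X]mulmxA mulmxKV // subrr.
  have M0 i : i \in J -> M *m (Th (J :\ i))^T = 0.
    by move=> /subY /submxP[y ->]; rewrite trmx_mul mulmxA MY mul0mx.
  have YTh : (Y <= Th J)%MS.
    apply/row_subP => k; rewrite row_Rmx.
    by apply: bvec_sub; have := enum_valP k; rewrite inE => /proper_sub.
  have /submxP[a Ma] : (M <= Th J)%MS.
    rewrite addmx_sub ?submx_refl // eqmx_opp; exact: submx_trans (submxMl _ _) YTh.
  have ZCy : (M *m (Th J)^T <= Cy)%MS.
    rewrite sub_capmx ThT_chain /=; apply/sub_kermxP.
    rewrite -mulmxA Th_boundary mulmx_sumr big1 // => i Ji.
    by rewrite -scalemxAr M0 ?scaler0.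
  have MX : (M <= X)%MS.
    rewrite -(eqmx_scale _ (fibre_neq0 J)) {1}Ma -ThTh_const -Ma.
    by apply: submxMr; rewrite eqRc.
  have -> : Th J = M + Th J *m Y^T *m invmx (Y *m Y^T) *m Y by rewrite subrK.
  apply: addmx_sub.
    by apply: submx_trans MX _; rewrite -addsmxE addsmxSl.
  by apply: submx_trans (submxMl _ _) _; rewrite -addsmxE addsmxSr.
have S_closed u v : v \in S -> Des u \subset Des v -> u \in S.
  by rewrite !inE => pv su; apply: sub_proper_trans pv.
have [hS ehS trS] := Rmx_trace g S_closed.
have [hJ ehJ trJ] := @Rmx_trace (VU J) g (@VU_closed J).
have eh1 : R1 *m act g = block_mx h 0 0 hS *m R1.
  rewrite mul_col_mx mul_block_col !mul0mx addr0 add0r; congr col_mx => //.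
  rewrite /X -(mulmxA Rc (Th J)) -sets_Th (mulmxA Rc (sets_mx _ _)) eh.
  by rewrite (mulmxA h Rc).
have := mxtrace_basis freeR1 (Rmx_free (VU J)) eqR1 eh1 ehJ.
(* The diagonal sums over descent sets inside [J] and properly inside [J] differ by the elements
   with descent set exactly [J]. *)
rewrite mxtrace_block trS trJ => /esym/eqP; rewrite -subr_eq => /eqP <-.
rewrite (bigID (fun v => Des v == J)) /=.
rewrite (eq_bigl (fun v => Des v == J)) => [|v]; last first.
  by rewrite inE; case: eqP => [->|]; rewrite ?subxx ?andbF.
rewrite [X in _ + X - _](eq_bigl (mem S)) ?addrK // => v.
by rewrite !inE properEneq andbC.
Qed.

End FlagMatrices.

(** Toggling an element of [J] outside [A] pairs the sets with opposite signs. *)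
Lemma sum_sign_interval (T : finType) (A J : {set T}) :
  \sum_(U : {set T} | (U \subset J) && (A \subset U)) (-1) ^+ (#|J| - #|U|) =
  (A == J)%:R :> rat.
Proof.
case: eqP => [->|nAJ].
  rewrite (bigD1 J) /= ?subxx // subnn expr0 big1 ?addr0 // => U.
  by rewrite -eqEsubset => /andP[-> ].
have [AJ|nAJs] := boolP (A \subset J); last first.
  by rewrite big1 // => U /andP[UJ AU]; rewrite (subset_trans AU UJ) in nAJs.
have [i Ji nAi] : exists2 i, i \in J & i \notin A.
  by have /properP[_ [i ? ?]] : A \proper J;
    [rewrite properEneq AJ andbT; apply/eqP | exists i].
rewrite (bigID (fun U : {set T} => i \in U)) /=.
rewrite [X in _ + X](reindex_onto (fun U => U :\ i) (fun U => i |: U)) /=; last first.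
  by move=> U /andP[_ niU]; rewrite setU1K.
rewrite [X in _ + X](eq_bigl (fun U : {set T} =>
    [&& U \subset J, A \subset U & i \in U])); last first.
  move=> U; rewrite !inE eqxx /= andbT subsetD1 nAi andbT.
  apply/andP/and3P => [[/andP[UJ AU] /eqP e]|[UJ AU iU]].
    have iU : i \in U by rewrite -e !inE eqxx.
    by rewrite iU AU -(setD1K iU) subUset sub1set Ji UJ.
  by rewrite AU setD1K // (subset_trans (subD1set _ _) UJ).
rewrite (eq_bigl (fun U : {set T} => [&& U \subset J, A \subset U & i \in U])) => [|U];
  last by rewrite andbA.
rewrite -big_split big1 //= => U /and3P[UJ AU iU].
have c1 : #|U| = #|U :\ i|.+1 by rewrite (cardsD1 i) iU.
have c2 : (#|U| <= #|J|)%N by apply: subset_leq_card.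
rewrite (_ : (#|J| - #|U :\ i| = (#|J| - #|U|).+1)%N); last by lia.
by rewrite exprS mulN1r subrr.
Qed.

Definition young_order n (U : {set 'I_n}) : nat :=
  #|[set y : {perm 'I_n} | block_perm (blk U) y]|.

(* The permutation character of S_n on the cosets of the Young subgroup of U. *)
Definition psi n (U : {set 'I_n}) (w : {perm 'I_n}) : rat :=
  #|[set v : {perm 'I_n} | block_perm (blk U) (v * w * v^-1)%g]|%:R
  / (young_order U)%:R.

Lemma young_order_neq0 n (U : {set 'I_n}) : (young_order U)%:R != 0 :> rat.
Proof.
rewrite Num.Theory.pnatr_eq0 -lt0n; apply/card_gt0P; exists 1%g.
by rewrite inE block_perm1.
Qed.

Lemma psi_conj n (U : {set 'I_n}) w g : psi U (w ^ g)%g = psi U w.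
Proof.
congr (_%:R / _); rewrite -[LHS](card_imset _ (mulIg g^-1%g)); apply: eq_card => v.
rewrite inE; apply/imsetP/idP => [[u]|Hv].
  by rewrite inE conjgE => H ->; rewrite invMg invgK !mulgA; rewrite !mulgA in H.
exists (v * g)%g; rewrite ?mulgK // inE conjgE invMg !mulgA mulgK.
by rewrite mulgK.
Qed.

Section HomologyCharacter.

Variables t n : nat.
Hypothesis t_gt0 : (0 < t)%N.
Local Notation gT := (tuples_perm t n).
Local Notation flag := (@flag t n).
Implicit Types (U J : {set 'I_n}) (g : gT).

Lemma card_tuples (Q : 'I_t -> pred {perm 'I_n}) :
  #|[set v : gT | [forall j, Q j (v j)]]| = (\prod_j #|[set x | Q j x]|)%N.
Proof.
rewrite -(cardsXn (fun j => [set x | Q j x])); apply: eq_card => v.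
by rewrite !inE; apply: eq_forallb => j; rewrite inE.
Qed.

Lemma card_fixed_flags U g :
  #|[set v in VU t U | flag U (v * g)%g == flag U v]|%:R = \prod_j psi U (g j).
Proof.
pose S := [set v | flag U (v * g)%g == flag U v].
have Sflag u v : flag U u = flag U v -> (u \in S) = (v \in S).
  by move=> e; rewrite !inE -!flag_act e.
have cardS : #|S| = (\prod_j #|[set x : {perm 'I_n} |
                        block_perm (blk U) (x * g j * x^-1)%g]|)%N.
  rewrite -card_tuples; apply: eq_card => v; rewrite !inE.
  by apply/(flag_eqP t_gt0)/forallP => H j; have := H j; rewrite ?ffunE.
have cardF : fibre t U = (\prod_(j < t) young_order U)%N.
  rewrite /fibre /young_order -card_tuples; apply: eq_card => v; rewrite !inE.
  apply/(flag_eqP t_gt0)/forallP => H j; have := H j; rewrite ?ffunE ?invg1 ?mulg1 //.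
(* Double counting: each group element with a fixed flag has exactly one representative with
   descents in [U], and each representative accounts for a whole fibre. *)
have count : (#|[set v in VU t U | flag U (v * g)%g == flag U v]| * fibre t U = #|S|)%N.
  rewrite -sum_nat_const.
  under eq_bigr => v _ do rewrite -(card_fibre t_gt0 U v) -sum1_card big_mkcond.
  rewrite exchange_big /= -sum1_card [RHS]big_mkcond; apply: eq_bigr => u _.
  have [v0 Dv0 ev0] := Des_rep t_gt0 U u.
  rewrite -big_mkcondr /=; case: ifP => [Su|nSu].
    rewrite (big_pred1 v0) // => v; rewrite !inE.
    apply/idP/eqP => [/andP[/andP[Dv _] /eqP e]|->].
      by apply: (Des_unique t_gt0 Dv0 Dv); rewrite ev0.
    by have := Sflag _ _ ev0; rewrite Su !inE => ->; rewrite Dv0 ev0 eqxx.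
  rewrite big_pred0 // => v; rewrite !inE.
  apply/negP => /andP[/andP[_ Sv] /eqP e].
  by have := Sflag _ _ e; rewrite nSu inE Sv.
have {}count := congr1 (fun k : nat => k%:R : rat) count.
rewrite natrM cardS cardF !natr_prod in count.
have nz : \prod_(j < t) (young_order U)%:R != 0 :> rat.
  by apply/prodf_neq0 => j _; apply: young_order_neq0.
apply: (mulIf nz); rewrite count -big_split; apply: eq_bigr => j _ /=.
by rewrite /psi mulfVK ?young_order_neq0.
Qed.

(** In the alternating sum of the traces on the W_U, each diagonal entry [v] gets the signed count
    of the sets between [Des v] and [J]. *)
Theorem top_homology_charE J g :
  top_homology_char J g =
  \sum_(U : {set 'I_n} | U \subset J) (-1) ^+ (#|J| - #|U|) * \prod_j psi U (g j).
Proof.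
rewrite top_homology_trace //.
under [RHS]eq_bigr => U _ do rewrite -card_fixed_flags -(fix_trace t_gt0) mulr_sumr big_mkcond.
rewrite [RHS]exchange_big /= big_mkcond; apply: eq_bigr => v _.
rewrite -big_mkcondr /= -mulr_suml (eq_bigl (fun U : {set 'I_n} =>
  (U \subset J) && (Des v \subset U))) => [|U]; last by rewrite inE.
by rewrite sum_sign_interval; case: eqP; rewrite ?mul1r ?mul0r.
Qed.

End HomologyCharacter.

(** * Generating functions of block-sorted words *)

Definition qfact (R : nzRingType) (k : nat) : {poly R} :=
  \prod_(1 <= i < k.+1) (1 - 'X^i).

Lemma qfactS (R : nzRingType) k : qfact R k.+1 = qfact R k * (1 - 'X^(k.+1)).
Proof. by rewrite /qfact big_nat_recr. Qed.

(** The witness is the q-binomial coefficient, built by the q-Pascal rule; over the integers this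
    gives an integral polynomial without division. *)
Lemma qbinomial_ex (R : comNzRingType) a b :
  exists g : {poly R}, g * (qfact R a * qfact R b) = qfact R (a + b).
Proof.
have q0 : qfact R 0 = 1 by rewrite /qfact big_nil.
have [k] := ubnP (a + b)%N; elim: k a b => // k IH [|a] [|b] le_k.
- by exists 1; rewrite q0 !mul1r.
- by exists 1; rewrite q0 !mul1r.
- by exists 1; rewrite q0 mul1r mulr1 addn0.
have [|g1 e1] := IH a b.+1; first by lia.
have [|g2 e2] := IH a.+1 b; first by lia.
exists (g1 + 'X^(a.+1) * g2).
rewrite addnS in e1; rewrite addSn in e2.
have -> : (a.+1 + b.+1 = (a + b).+2)%N by lia.
have eX : 'X^((a + b).+2) = 'X^(a.+1) * 'X^(b.+1) :> {poly R}.
  by rewrite -exprD; congr ('X^_); lia.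
rewrite [qfact R (a + b).+2]qfactS eX.
transitivity ((1 - 'X^(a.+1)) * qfact R (a + b).+1 +
              'X^(a.+1) * (1 - 'X^(b.+1)) * qfact R (a + b).+1); last by ring.
by rewrite -{1}e1 -e2 [qfact R a.+1]qfactS [qfact R b.+1]qfactS; ring.
Qed.

Lemma qmultinomial_ex (R : comNzRingType) (I : Type) (s : seq I) (a : I -> nat) :
  exists g : {poly R},
    g * \prod_(i <- s) qfact R (a i) = qfact R (\sum_(i <- s) a i).
Proof.
elim: s => [|i s [g e]]; first by exists 1; rewrite !big_nil mulr1 /qfact big_nil.
have [g' e'] := qbinomial_ex R (a i) (\sum_(j <- s) a j).
by exists (g' * g); rewrite !big_cons -e' -e; ring.
Qed.

(** Counted from the top, the elements of [S] have positions 1, ..., [#|S|], each once; the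
    induction removes the minimum. *)
Lemma prod_ranks (R : comNzRingType) n (S : {set 'I_n}) :
  \prod_(i in S) (1 - 'X^(#|[set x in S | (i <= x)%N]|)) = qfact R #|S| :> {poly R}.
Proof.
have [k] := ubnP #|S|; elim: k S => // k IH S le_k.
have [->|[j Sj]] := set_0Vmem S; first by rewrite big_set0 cards0 /qfact big_nil.
case: (@arg_minnP _ j (mem S) val Sj) => i iS min_i; have Si : i \in S by [].
clear iS.
have cS : #|S| = #|S :\ i|.+1 by rewrite (cardsD1 i) Si.
rewrite (big_setD1 i) //= cS qfactS mulrC; congr (_ * _); last first.
  congr (1 - 'X^_); rewrite -cS; apply: eq_card => x; rewrite inE.
  by case Sx: (x \in S) => //=; apply: min_i.
rewrite -IH; last by rewrite -ltnS -cS.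
apply: eq_bigr => x; rewrite !inE => /andP[nx Sx]; congr (1 - 'X^_).
apply: eq_card => y; rewrite !inE; case: eqP => [->|_] //=.
rewrite Si /=; apply/negP => le; case/eqP: nx; apply: val_inj; apply/eqP.
by rewrite eqn_leq le; apply: min_i.
Qed.

Section BlockSeries.

Variables (n : nat) (U : {set 'I_n}).
Local Notation blk := (blk U).

Definition tailsize (i : 'I_n) : nat :=
  #|[set x : 'I_n | (blk x == blk i) && (i <= x)%N]|.

Lemma tailsize_gt0 i : (0 < tailsize i)%N.
Proof. by apply/card_gt0P; exists i; rewrite inE eqxx leqnn. Qed.

Lemma tail_qmultinomial (R : comNzRingType) : exists g : {poly R},
  g * \prod_i (1 - 'X^(tailsize i)) = qfact R n.
Proof.
(* Block numbers are indexed by ['I_n.+1]; numbers that no element has contribute the empty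
   product. *)
have blk_lt x : (blk x < n.+1)%N.
  by rewrite ltnS -[X in (_ <= X)%N]card_ord max_card.
pose ob x := Ordinal (blk_lt x).
have [g e] := qmultinomial_ex R (index_enum 'I_n.+1)
                (fun b => #|[set x | ob x == b]|).
exists g; rewrite (_ : qfact R n = qfact R (\sum_b #|[set x | ob x == b]|)).
  rewrite -e (partition_big ob predT) //=; congr (_ * _); apply: eq_bigr => b _.
  rewrite -prod_ranks; apply: eq_big => [i|i /eqP ei]; first by rewrite inE.
  congr (1 - 'X^_); apply: eq_card => x; rewrite !inE -ei.
  by rewrite -val_eqE.
congr (qfact R _); rewrite -[LHS]card_ord -sum1_card (partition_big ob predT) //=.
by apply: eq_bigr => b _; rewrite -sum1_card; apply: eq_bigl => x; rewrite inE.
Qed.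

Definition block_pred (x : 'I_n) : option 'I_n :=
  [pick p : 'I_n | (p.+1 == x :> nat) && (blk p == blk x)].

Definition at_pred (f : 'I_n -> nat) x := if block_pred x is Some p then f p else 0%N.

(** Partial sums along each block: a block-sorted word is encoded by its increments, and an
    increment at [i] raises the total once for each later position of the block and once for [i]. *)
Definition block_sum (e : 'I_n -> nat) (x : 'I_n) : nat :=
  (\sum_(i : 'I_n | (blk x == blk i) && (i <= x)) e i)%N.

Lemma block_sum_rec e x : block_sum e x = (e x + at_pred (block_sum e) x)%N.
Proof.
rewrite /block_sum (bigD1 x) ?eqxx ?leqnn //=; congr (_ + _)%N.
rewrite /at_pred /block_pred; case: pickP => [p /andP[/eqP ep /eqP eb]|no].
  apply: eq_bigl => i; rewrite eb -andbA; congr (_ && _).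
  by rewrite andbC -val_eqE /= -ltn_neqAle -ep ltnS.
rewrite big_pred0 // => i; apply/negP => /andP[/andP[/eqP eb le] ne].
have lt : (i < x)%N by rewrite ltn_neqAle le andbT.
have ltp : (x.-1 < n)%N by apply: leq_ltn_trans (leq_pred _) (ltn_ord x).
have := no (Ordinal ltp); rewrite /= prednK ?eqxx /=; last exact: leq_ltn_trans lt.
case/negP; rewrite eqn_leq blk_mono ?leq_pred //= eb blk_mono //=.
by rewrite -ltnS prednK //; apply: leq_ltn_trans lt.
Qed.

Definition block_diff (f : 'I_n -> nat) (x : 'I_n) : nat := (f x - at_pred f x)%N.

Lemma block_sumK e : block_diff (block_sum e) =1 e.
Proof. by move=> x; rewrite /block_diff block_sum_rec addnK. Qed.

Lemma block_diffK f : block_sorted blk val f -> block_sum (block_diff f) =1 f.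
Proof.
move=> /block_sortedP sf x; have [k] := ubnP x; elim: k x => // k IH x le_k.
rewrite block_sum_rec /block_diff /at_pred /block_pred.
case: pickP => [p /andP[/eqP ep /eqP eb]|_]; last by rewrite subn0 addn0.
have lt : (p < x)%N by rewrite -ep.
by rewrite IH ?subnK ?sf //; apply: leq_trans lt le_k.
Qed.

Lemma block_sum_sorted e : block_sorted blk val (block_sum e).
Proof.
apply/block_sortedP => x y eb /= lt; rewrite /block_sum [X in (_ <= X)%N](bigID
  (fun i : 'I_n => (i <= x)%N)) /= -eb.
apply: leq_trans (leq_addr _ _); apply: eq_leq; apply: eq_bigl => i.
by case: (leqP i x) => le; rewrite ?andbF // !andbT (leq_trans le (ltnW lt)) andbT.
Qed.

Lemma sum_block_sum e : (\sum_x block_sum e x = \sum_i tailsize i * e i)%N.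
Proof.
rewrite /block_sum (exchange_big_dep predT) //=; apply: eq_bigr => i _.
by rewrite sum_nat_const; congr (_ * _)%N; apply: eq_card => x; rewrite !inE.
Qed.

Definition gf_sorted N : {poly rat} :=
  \sum_(f : {ffun 'I_n -> 'I_N} | block_sorted blk val (fun x => val (f x)))
    'X^(\sum_i f i).

(** Passing to increments is a bijection. A total of [m], less than [N], keeps all letters and
    increments below [N], so the bound on letters excludes nothing in this degree. *)
Lemma coef_gf_sorted N m : (m < N)%N ->
  (gf_sorted N)`_m = (\prod_i \sum_(a < N) ('X^(tailsize i) : {poly rat}) ^+ a)`_m.
Proof.
case: N => // N lt_mN; rewrite bigA_distr_bigA /= !coef_sum.
under [RHS]eq_bigr => e _.
  under eq_bigr do rewrite -exprM.
  rewrite -expr_sum coefXn eq_sym; over.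
under [LHS]eq_bigr do rewrite coefXn eq_sym.
pose A := [set e : {ffun 'I_n -> 'I_N.+1} | (\sum_i tailsize i * e i == m)%N].
pose B := [set f : {ffun 'I_n -> 'I_N.+1} |
  block_sorted blk val (fun x => val (f x)) && (\sum_i f i == m)%N].
have -> : \sum_(e : {ffun 'I_n -> 'I_N.+1}) (\sum_i tailsize i * e i == m)%N%:R =
    #|A|%:R :> rat.
  rewrite -[in RHS]sum1_card natr_sum [RHS]big_mkcond; apply: eq_bigr => e _.
  rewrite inE.
  by case: eqP.
have -> : \sum_(f : {ffun 'I_n -> 'I_N.+1} |
      block_sorted blk val (fun x => val (f x))) (\sum_i f i == m)%N%:R =
    #|B|%:R :> rat.
  rewrite -[in RHS]sum1_card natr_sum [RHS]big_mkcond [LHS]big_mkcond.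
  by apply: eq_bigr => e _; rewrite inE; case: ifP => //= _; case: eqP.
congr (_%:R); pose tof (h : 'I_n -> nat) : {ffun 'I_n -> 'I_N.+1} := [ffun x => inord (h x)].
have small (h : 'I_n -> nat) x : (\sum_i h i = m)%N -> (h x < N.+1)%N.
  move=> e; apply: leq_ltn_trans lt_mN; rewrite -e (bigD1 x) //=; exact: leq_addr.
have tofE h : (\sum_i h i = m)%N -> forall x, tof h x = h x :> nat.
  by move=> e x; rewrite ffunE inordK // small.
have sumA (e : {ffun 'I_n -> 'I_N.+1}) : e \in A ->
    (\sum_x block_sum (fun i => val (e i)) x = m)%N.
  by rewrite inE => /eqP <-; apply: sum_block_sum.
have block_sum_ext (e e' : 'I_n -> nat) : e =1 e' -> block_sum e =1 block_sum e'.
  by move=> E x; apply: eq_bigr => i _; apply: E.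
have diff_ext (e e' : 'I_n -> nat) : e =1 e' -> block_diff e =1 block_diff e'.
  by move=> E x; rewrite /block_diff /at_pred E; case: block_pred => // p; rewrite E.
rewrite -(card_in_imset (f := fun e : {ffun 'I_n -> 'I_N.+1} =>
   tof (block_sum (fun i => val (e i)))) (D := mem A)) => [|e e' Ae Ae' ee]; last first.
  apply/ffunP => x; apply: val_inj; rewrite /=.
  rewrite -[LHS](block_sumK (fun i => val (e i))) -[RHS](block_sumK (fun i => val (e' i))).
  apply: diff_ext => y; rewrite -(tofE _ (sumA e Ae)) -(tofE _ (sumA e' Ae')).
  by rewrite ee.
apply: eq_card => f; rewrite inE; apply/andP/imsetP => [[sf /eqP sumf]|[e Ae ->]].
  have sumd : (\sum_i tailsize i * block_diff (fun x => val (f x)) i = m)%N.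
    rewrite -sum_block_sum -sumf; apply: eq_bigr => x _.
    exact: (block_diffK sf).
  have le_d x : (block_diff (fun x => val (f x)) x < N.+1)%N.
    by apply: leq_ltn_trans (leq_subr _ _) (ltn_ord (f x)).
  have tofd x : tof (block_diff (fun x => val (f x))) x =
                block_diff (fun x => val (f x)) x :> nat by rewrite ffunE inordK.
  exists (tof (block_diff (fun x => val (f x)))).
    by rewrite inE; apply/eqP; rewrite -sumd; apply: eq_bigr => i _; rewrite tofd.
  apply/ffunP => x; apply: val_inj; rewrite /= tofE.
    by rewrite (block_sum_ext _ _ tofd) (block_diffK sf).
  rewrite sum_block_sum -sumd; apply: eq_bigr => i _; congr (_ * _)%N.
  exact: tofd.
have Te := tofE _ (sumA e Ae); split.
  have /block_sortedP H := block_sum_sorted (fun i => val (e i)).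
  by apply/block_sortedP => x y eb lt; rewrite /= !Te; apply: H.
by rewrite -(sumA e Ae); apply/eqP; apply: eq_bigr => x _; rewrite Te.
Qed.

End BlockSeries.

(** * Arithmetic modulo a power of the variable, and division of series *)

Section TruncatedEquality.

Variable R : comNzRingType.

Definition eqX N (p q : {poly R}) : Prop := forall m, (m < N)%N -> p`_m = q`_m.

Lemma eqX_refl N p : eqX N p p. Proof. by []. Qed.

Lemma eqX_trans N p q r : eqX N p q -> eqX N q r -> eqX N p r.
Proof. by move=> e1 e2 m lt; rewrite e1 ?e2. Qed.

Lemma eqXD N p p' q q' : eqX N p p' -> eqX N q q' -> eqX N (p + q) (p' + q').
Proof. by move=> e e' m lt; rewrite !coefD e ?e'. Qed.

Lemma eqXM N p p' q q' : eqX N p p' -> eqX N q q' -> eqX N (p * q) (p' * q').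
Proof.
move=> e e' m lt; rewrite !coefM; apply: eq_bigr => i _.
by have li := ltn_ord i; rewrite e ?e' //; lia.
Qed.

Lemma eqXX N p q k : eqX N p q -> eqX N (p ^+ k) (q ^+ k).
Proof. by move=> e; elim: k => // k IH; rewrite !exprS; apply: eqXM. Qed.

Lemma eqX_prod N (I : Type) (s : seq I) (P : pred I) (F F' : I -> {poly R}) :
  (forall i, P i -> eqX N (F i) (F' i)) ->
  eqX N (\prod_(i <- s | P i) F i) (\prod_(i <- s | P i) F' i).
Proof.
by move=> H; apply: (big_ind2 (eqX N)) => // *; [apply: eqXM].
Qed.

Lemma eqX_sum N (I : Type) (s : seq I) (P : pred I) (F F' : I -> {poly R}) :
  (forall i, P i -> eqX N (F i) (F' i)) ->
  eqX N (\sum_(i <- s | P i) F i) (\sum_(i <- s | P i) F' i).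
Proof.
by move=> H; apply: (big_ind2 (eqX N)) => // *; [apply: eqXD].
Qed.

End TruncatedEquality.

Section SeriesDivision.

Variable g : {poly rat}.
Hypothesis g0 : g`_0 != 0.
Local Notation s := (ser_of_poly g).

Lemma size_ser_inv_seq (f : series) m : size (ser_inv_seq f m) = m.
Proof. by elim: m => //= m IH; rewrite size_rcons IH. Qed.

Lemma nth_ser_inv_seq (f : series) m i : (i < m)%N -> (ser_inv_seq f m)`_i = ser_inv f i.
Proof.
elim: m => // m IH; rewrite ltnS leq_eqVlt => /orP[/eqP-> //|lt].
by rewrite /= nth_rcons size_ser_inv_seq lt IH.
Qed.

(** The entry appended last to [ser_inv_seq] solves this equation, and later steps do not change
    earlier entries. *)
Lemma ser_invE k : \sum_(i < k.+1) g`_(k - i) * ser_inv s i = (k == 0)%:R.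
Proof.
rewrite big_ord_recr /= subnn {2}/ser_inv /= nth_rcons size_ser_inv_seq ltnn eqxx.
rewrite [X in _ + X]mulrC mulfVK // addrC.
rewrite [X in _ - X + _](eq_bigr (fun i : 'I_k => g`_(k - i) * ser_inv s i)) ?subrK //.
by move=> i _; rewrite nth_ser_inv_seq.
Qed.

(** Truncating the inverse series after degree [m] turns the division into polynomial arithmetic
    modulo X^(m+1). *)
Lemma ser_div_coef (f T : {poly rat}) m :
  eqX m.+1 (T * g) f -> ser_div (ser_of_poly f) s m = T`_m.
Proof.
move=> e; pose I := \poly_(i < m.+1) ser_inv s i.
have gI : eqX m.+1 (g * I) 1.
  move=> k lt; rewrite coefMr coef1 -ser_invE; apply: eq_bigr => i _.
  by rewrite coef_poly (leq_trans (ltn_ord i) lt).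
have -> : ser_div (ser_of_poly f) s m = (f * I)`_m.
  rewrite coefM; apply: eq_bigr => i _; rewrite coef_poly.
  by rewrite ltnS leq_subr.
have /(_ m (leqnn _)) <- := eqXM e (eqX_refl (N := m.+1) I).
rewrite -mulrA; have /(_ m (leqnn _)) -> := eqXM (eqX_refl (N := m.+1) T) gI.
by rewrite mulr1.
Qed.

End SeriesDivision.

Section BlockSeriesLimit.

Variables (n : nat) (U : {set 'I_n}).

(** Each factor is a geometric sum of [N] terms in X^k with [k] positive, whose defect X^(kN) lies
    beyond the degrees compared. *)
Lemma gf_sorted_limit N :
  eqX N (gf_sorted U N * \prod_i (1 - 'X^(tailsize U i))) 1.
Proof.
apply: (@eqX_trans _ _ _ ((\prod_i \sum_(a < N) ('X^(tailsize U i)) ^+ a)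
         * \prod_i (1 - 'X^(tailsize U i)))).
  by apply: eqXM => // m; apply: coef_gf_sorted.
rewrite -big_split /= -[X in eqX _ _ X](@big1_eq _ 1 *%R _ (index_enum 'I_n) predT).
apply: eqX_prod => i _ m lt.
rewrite mulrC -opprB mulNr -subrX1 opprB coefB -exprM coefXn coef1.
rewrite (_ : (m == tailsize U i * N)%N = false) ?subr0 //; apply/negbTE; rewrite neq_ltn; apply/orP; left.
by apply: leq_trans lt _; rewrite leq_pmull ?tailsize_gt0.
Qed.

Lemma gf_sorted_qfact N (h : {poly rat}) :
  h * \prod_i (1 - 'X^(tailsize U i)) = qfact rat n ->
  eqX N (gf_sorted U N * qfact rat n) h.
Proof.
move=> <-; rewrite mulrCA -[X in eqX _ _ X]mulr1; apply: eqXM => //.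
exact: gf_sorted_limit.
Qed.

Lemma pi_word_conj N (w g : {perm 'I_n}) : pi_word N (w ^ g)%g = pi_word N w.
Proof.
rewrite /pi_word (reindex_inj (@act_inj _ _ _ (word_action n N) g)) /=.
apply: eq_big => [f|f _]; last by rewrite wact_sum.
have <- := actM (word_action n N) f g (w ^ g)%g.
rewrite conjgE !mulgA mulgV mul1g.
by rewrite (actM (word_action n N) f w g) (inj_eq (act_inj (word_action n N) g)).
Qed.

(** Burnside's lemma for the Young subgroup on words of weight [m]: each orbit contains exactly one
    block-sorted word. *)
Lemma sum_young_pi N :
  \sum_(y | block_perm (blk U) y) pi_word N y =
  (young_order U)%:R *: gf_sorted U N :> {poly rat}.
Proof.
apply/polyP => m; rewrite coef_sum coefZ.
pose to := word_action n N.
pose S := [set f : {ffun 'I_n -> 'I_N} | (\sum_i f i == m)%N].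
pose G := block_perm_group (blk U).
have actsGS : [acts G, on S | to].
  apply/actsP => y _ f; rewrite !inE; congr (_ == _).
  exact: wact_sum.
have := Frobenius_Cauchy actsGS => /(congr1 (fun k : nat => k%:R : rat)).
rewrite natrM natr_sum.
rewrite (eq_big (fun y => block_perm (blk U) y) (fun y => (pi_word N y)`_m)); first last.
- move=> y _; rewrite coef_pi_word; congr (_%:R); apply: eq_card => f.
  by rewrite in_setI [RHS]inE [f \in S]inE; congr (_ && _); apply/afix1P/eqP.
- by move=> y; rewrite inE.
move=> ->; rewrite mulrC; congr (_%:R * _).
pose So := [set f in S | block_sorted (blk U) val (fun x => val (f x))].
have -> : (gf_sorted U N)`_m = #|So|%:R.
  rewrite coef_sum -sum1_card natr_sum big_mkcond [RHS]big_mkcond.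
  apply: eq_bigr => f _; rewrite coefXn !inE andbC [m == _]eq_sym.
  by case: (block_sorted _ _ _) => //=; case: eqP.
congr (_%:R).
have inj x y : blk U x = blk U y -> val x = val y -> x = y by move=> _ /val_inj.
rewrite -(card_in_imset (f := orbit to G) (D := mem So)) => [|f f' Sf Sf' e].
  apply: eq_card => O; apply/imsetP/imsetP => [[f Sf ->]|[f]].
    have [y py [sy _]] := ex_block_sorted (blk U) val (fun x => val (f x)).
    have Gy : y^-1%g \in G by rewrite inE block_permV.
    exists (to f y^-1%g); last by apply/esym/orbit_act.
    rewrite inE (actsP actsGS) // Sf /=.
    move/block_sortedP: sy => sy; apply/block_sortedP => a b eb lt.
    by rewrite !ffunE invgK; apply: sy.
  by rewrite inE => /andP[Sf _] ->; exists f.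
have /orbitP[y Gy ey] : f' \in orbit to G f by rewrite e orbit_refl.
move: Sf Sf'; rewrite !inE => /andP[_ sf] /andP[_ sf'].
rewrite -ey; apply/ffunP => x; apply: val_inj; rewrite ffunE.
have py : block_perm (blk U) y^-1%g by apply: block_permV; rewrite inE in Gy.
apply/esym; apply: (block_sorted_unique inj py sf).
apply/block_sortedP => a b eb lt /=.
by have /block_sortedP/(_ a b eb lt) := sf'; rewrite -ey !ffunE.
Qed.

(** Expanding [psi] as a count of conjugators and using that [pi_word] is a class function, every
    conjugator contributes the same sum over the Young subgroup. *)
Theorem psi_pairing N :
  n`!%:R^-1 *: \sum_w psi U w *: pi_word N w = gf_sorted U N.
Proof.
have step : \sum_w #|[set v : {perm 'I_n} | block_perm (blk U) (v * w * v^-1)%g]|%:R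
      *: pi_word N w = n`!%:R *: ((young_order U)%:R *: gf_sorted U N).
  rewrite -sum_young_pi -card_permutations scaler_nat -sumr_const.
  under eq_bigr => w _.
    rewrite scaler_nat -sumr_const big_mkcond; over.
  rewrite exchange_big /=; apply: eq_bigr => v _; rewrite -big_mkcond /=.
  rewrite (reindex_inj (conjg_inj v)) /=; apply: eq_big => [y|y _].
    by rewrite inE conjgE !mulgA mulgV mul1g mulgK.
  exact: pi_word_conj.
have -> : \sum_w psi U w *: pi_word N w = (young_order U)%:R^-1 *:
   \sum_w #|[set v : {perm 'I_n} | block_perm (blk U) (v * w * v^-1)%g]|%:R
      *: pi_word N w.
  by rewrite scaler_sumr; apply: eq_bigr => w _; rewrite scalerA mulrC.
have nf : n`!%:R != 0 :> rat by rewrite Num.Theory.pnatr_eq0 -lt0n fact_gt0.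
rewrite step !scalerA [X in X *: _](_ : _ = 1) ?scale1r //.
by field; rewrite nf young_order_neq0.
Qed.

End BlockSeriesLimit.

(** * Flags of subspaces *)

Section AdaptedBases.

Variables (F : finFieldType) (n : nat).
Local Notation vT := 'rV[F]_n.
Local Notation q := #|F|.
Implicit Types (V : nat -> {vspace vT}) (s : seq vT).

Lemma card_subspace (W : {vspace vT}) : #|[set v | v \in W]| = (q ^ \dim W)%N.
Proof.
by rewrite cardsE; apply: (@card_vspace F _ (Vector.class ('rV[F]_n : vectType F)) W).
Qed.

(* The bases are listed backwards: the head of s is its last vector. *)
Fixpoint adapted V s : bool :=
  if s is v :: s' then [&& v \in V (size s'), v \notin <<s'>>%VS & adapted V s']
  else true.

Lemma adapted_free V s : adapted V s -> free s.
Proof.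
elim: s => [|v s IH] /=; first by rewrite nil_free.
by rewrite free_cons => /and3P[_ -> /IH->].
Qed.

Lemma adapted_drop V s k : adapted V s -> adapted V (drop k s).
Proof. by elim: s k => [|v s IH] [|k] //= /and3P[_ _ /IH]. Qed.

Lemma adapted_sub V s (W : {vspace vT}) : adapted V s ->
  (forall i, (i < size s)%N -> (V i <= W)%VS) -> (<<s>> <= W)%VS.
Proof.
elim: s => [|v s IH] /=; first by rewrite span_nil sub0v.
case/and3P => Vv _ ads H; rewrite span_cons subv_add IH ?andbT //.
  by rewrite -memvE; apply: (subvP (H (size s) (ltnSn _))).
by move=> i lt; apply: H; apply: ltnW.
Qed.

Lemma dim_free_span s : free s -> \dim <<s>> = size s.
Proof. by move/eqP. Qed.

(** After [k] vectors the next one is taken in [V k] outside their span, which by monotonicity is a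
    k-dimensional subspace of [V k]. *)
Lemma card_adapted V k :
  (forall i j, (i <= j)%N -> (V i <= V j)%VS) ->
  #|[set s : k.-tuple vT | adapted V s]| = (\prod_(i < k) (q ^ \dim (V i) - q ^ i))%N.
Proof.
move=> mono; elim: k => [|k IH].
  rewrite big_ord0 (eq_card (B := predT)); last by move=> s; rewrite inE [s]tuple0.
  by rewrite card_tuple.
rewrite big_ord_recr /= -IH -[LHS]sum1_card.
rewrite (reindex (fun x : k.-tuple vT * vT => cons_tuple x.2 x.1)) /=; last first.
  exists (fun s : k.+1.-tuple vT => (behead_tuple s, thead s)) => [[s v] _|s _] /=.
    by congr (_, _); apply: val_inj.
  by apply: val_inj; rewrite [in RHS](tuple_eta s).
rewrite (eq_bigl (fun x : k.-tuple vT * vT => (x.1 \in [set s : k.-tuple vT | adapted V s])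
   && ((x.2 \in V k) && (x.2 \notin <<x.1>>%VS)))); last first.
  by move=> [s v]; rewrite !inE /= size_tuple andbA andbC.
rewrite -(pair_big_dep (fun s : k.-tuple vT => s \in [set s : k.-tuple vT | adapted V s])
  (fun (s : k.-tuple vT) v => (v \in V k) && (v \notin <<s>>%VS)) (fun _ _ => 1%N)) /=.
rewrite -sum_nat_const; apply: eq_bigr => s; rewrite inE => ads.
have sub : (<<s>> <= V k)%VS.
  apply: adapted_sub ads _ => i; rewrite size_tuple => lt; exact/mono/ltnW.
rewrite sum1_card -(card_subspace (V k)).
have -> : (q ^ k = #|[set v : vT | v \in <<s>>%VS]|)%N.
  by rewrite card_subspace (dim_free_span (adapted_free ads)) size_tuple.
rewrite -cardsDS; last by apply/subsetP => v; rewrite !inE; apply: (subvP sub).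
by apply: eq_card => v; rewrite !inE andbC.
Qed.

End AdaptedBases.

Section NextRank.

Variables (n : nat) (U : {set 'I_n}).

Definition is_rank (r : nat) : bool :=
  [|| r == 0, r == n | [exists u : 'I_n, (u \in U) && (u == r :> nat)]]%N.

Lemma next_rank_ex i : exists r,
  (i < r)%N && ((n <= r)%N || [exists u : 'I_n, (u \in U) && (u == r :> nat)]).
Proof. by exists (i + n).+1; apply/andP; split; [|apply/orP; left]; lia. Qed.

(** Least element of [U] above [i], or [n] if there is none. The alternative [n <= r] in the search
    keeps the function total for [i >= n]. *)
Definition next_rank i := ex_minn (next_rank_ex i).

Lemma next_rank_gt i : (i < next_rank i)%N.
Proof. by rewrite /next_rank; case: ex_minnP => r /andP[]. Qed.

Lemma next_rank_min i r : (i < r)%N -> is_rank r -> (next_rank i <= r)%N.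
Proof.
move=> lt; rewrite /next_rank; case: ex_minnP => r0 _ min /or3P[/eqP e|/eqP e|ex].
- by rewrite e in lt.
- by apply: min; rewrite lt e leqnn.
by apply: min; rewrite lt ex orbT.
Qed.

Lemma next_rank_le i : (i < n)%N -> (next_rank i <= n)%N.
Proof. by move=> lt; apply: next_rank_min => //; rewrite /is_rank eqxx orbT. Qed.

Lemma next_rankP i : (i < n)%N -> is_rank (next_rank i).
Proof.
move=> lt; have le := next_rank_le lt; move: le; rewrite /next_rank.
case: ex_minnP => r /andP[_ /orP[le|ex]] _ le'; rewrite /is_rank ?ex ?orbT //.
by rewrite (_ : r = n) ?eqxx ?orbT //; apply/eqP; rewrite eqn_leq le'.
Qed.

Lemma next_rank_mono i j : (i <= j)%N -> (next_rank i <= next_rank j)%N.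
Proof.
move=> le; rewrite {1}/next_rank; case: ex_minnP => r _; apply.
rewrite (leq_ltn_trans le (next_rank_gt j)) /=.
by rewrite /next_rank; case: ex_minnP => r' /andP[].
Qed.

(** The positions of the block of [i] from [i] on are exactly those before the next cut. This links
    the exponents for words to the dimensions for subspaces. *)
Lemma next_rankE (i : 'I_n) : next_rank i = (i + tailsize U i)%N.
Proof.
have le := next_rank_le (ltn_ord i); have gt := next_rank_gt i.
suff -> : tailsize U i = (next_rank i - i)%N by rewrite subnKC // ltnW.
have lt_add (k : 'I_(next_rank i - i)) : (i + k < n)%N.
  by have := ltn_ord k; lia.
have inj : injective (fun k => Ordinal (lt_add k)).
  by move=> k k' /(congr1 val) /= /addnI /val_inj.
rewrite -[RHS]card_ord -(card_codom inj); apply: eq_card => x; rewrite inE.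
apply/andP/codomP => [[/eqP eb le_ix]|[k ->]].
  have lt : (x < next_rank i)%N.
    rewrite ltnNge; apply/negP => ge.
    have /or3P[/eqP e|/eqP e|] := next_rankP (ltn_ord i).
    - by rewrite e in gt.
    - by move: (ltn_ord x); rewrite ltnNge -{1}e ge.
    case/existsP => u /andP[Uu /eqP eu].
    have := blk_mono U (x := u) (y := x); rewrite eu eb => /(_ ge).
    by rewrite leqNgt -blk_lt // eu gt.
  have lt' : (x - i < next_rank i - i)%N by rewrite ltn_sub2r.
  by exists (Ordinal lt'); apply: val_inj => /=; rewrite subnKC.
split; last exact: leq_addr.
rewrite eqn_leq; apply/andP; split; last by apply: blk_mono; apply: leq_addr.
apply/subset_leq_card/subsetP => r.
rewrite !inE => /andP[Ur le_r]; rewrite Ur leqNgt; apply/negP => lt.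
have : (next_rank i <= r)%N.
  apply: next_rank_min => //; apply/or3P/Or33/existsP; exists r.
  by rewrite Ur eqxx.
by move: le_r (ltn_ord k) => /=; lia.
Qed.

End NextRank.

Section SubspaceChains.

Variables (F : finFieldType) (t n : nat) (U : {set 'I_n}).
Hypothesis t_gt0 : (0 < t)%N.
Local Notation vT := 'rV[F]_n.
Local Notation q := #|F|.
Local Notation elt := {ffun 'I_t -> {vspace vT}}.
Local Notation bases := {dffun forall _ : 'I_t, n.-tuple vT}.
Local Notation Q := (Bqlevel F t n 0 :|: rank_sel (Bqlevel F t n) U :|: Bqlevel F t n n).
Local Notation is_rank := (is_rank U).
Local Notation next_rank := (next_rank U).
Local Notation j0 := (Ordinal t_gt0).
Implicit Types (M : bases) (A B : elt) (c d : {set elt}).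

Lemma mem_Q A : reflect (exists2 r, is_rank r & A \in Bqlevel F t n r) (A \in Q).
Proof.
apply: (iffP idP) => [|[r]].
  rewrite !in_setU -orbA => /or3P[H|/bigcupP[r Ur H]|H].
  - by exists 0%N.
  - by exists r => //; apply/or3P/Or33/existsP; exists r; rewrite Ur eqxx.
  by exists n => //; apply/or3P/Or32.
rewrite !in_setU => /or3P[/eqP-> ->|/eqP-> ->|/existsP[u /andP[Uu /eqP <-]] H];
  rewrite ?orbT //.
by apply/orP; left; apply/orP; right; apply/bigcupP; exists u.
Qed.

Lemma is_rank_le r : is_rank r -> (r <= n)%N.
Proof. by case/or3P => [/eqP->|/eqP->|/existsP[u /andP[_ /eqP <-]]] //; apply: ltnW. Qed.

Lemma Bqlevel_dim A r j : A \in Bqlevel F t n r -> \dim (A j) = r.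
Proof. by rewrite inE => /forallP/(_ j)/eqP. Qed.

(** Bases are listed backwards, so dropping [n - r] entries keeps the [r] vectors chosen first. *)
Definition levq (r : nat) M : elt := [ffun j => <<drop (n - r) (M j)>>%VS].

Definition flagq M : {set elt} := [set levq r M | r : 'I_n.+1 & is_rank r].

Definition all_free M : bool := [forall j, free (M j)].

Lemma span_drop_dim (s : n.-tuple vT) r : free s -> (r <= n)%N ->
  \dim <<drop (n - r) s>> = r.
Proof.
move=> fs le; rewrite dim_free_span ?size_drop ?size_tuple ?subKn //.
by move: fs; rewrite -{1}(cat_take_drop (n - r) s) => /catr_free.
Qed.

Lemma span_drop_mono (s : n.-tuple vT) r r' : (r <= r')%N ->
  (<<drop (n - r) s>> <= <<drop (n - r') s>>)%VS.
Proof.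
move=> le; apply: sub_span => x.
rewrite (_ : (n - r = n - r - (n - r') + (n - r'))%N); last by lia.
by rewrite -drop_drop; apply: mem_drop.
Qed.

Lemma levq_level M r : all_free M -> (r <= n)%N -> levq r M \in Bqlevel F t n r.
Proof.
move=> /forallP fM le; rewrite inE; apply/forallP => j; rewrite ffunE.
by rewrite span_drop_dim.
Qed.

Lemma levq_rank_inj M M' (r r' : nat) : all_free M -> all_free M' ->
  (r <= n)%N -> (r' <= n)%N -> levq r M = levq r' M' -> r = r'.
Proof.
move=> fM fM' le le' e.
by rewrite -(Bqlevel_dim j0 (levq_level fM le)) e (Bqlevel_dim j0 (levq_level fM' le')).
Qed.

Lemma flagq_sub M : all_free M -> flagq M \subset Q.
Proof.
move=> fM; apply/subsetP => A /imsetP[r]; rewrite inE => Rr ->.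
by apply/mem_Q; exists r => //; apply: levq_level; rewrite // -ltnS.
Qed.

Lemma flagq_chain M : chain (@Bqle F t n) (flagq M).
Proof.
apply/forall_inP => A /imsetP[r _ ->]; apply/forall_inP => B /imsetP[r' _ ->].
have mono (s s' : nat) : (s <= s')%N -> Bqle (levq s M) (levq s' M).
  by move=> le; apply/forallP => j; rewrite !ffunE span_drop_mono.
by case/orP: (leq_total r r') => /mono ->; rewrite ?orbT.
Qed.

Lemma card_flagq M : all_free M -> #|flagq M| = #|[set r : 'I_n.+1 | is_rank r]|.
Proof.
move=> fM; rewrite card_in_imset ?cardsE // => r r' _ _ e.
by apply: val_inj; apply: (levq_rank_inj fM fM _ _ e); rewrite -ltnS.
Qed.

Lemma flagq_eqP M M' : all_free M -> all_free M' ->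
  reflect (forall r, is_rank r -> levq r M = levq r M') (flagq M == flagq M').
Proof.
move=> fM fM'; apply: (iffP eqP) => [e r Rr|H]; last first.
  by apply: eq_in_imset => r; rewrite inE; apply: H.
have le := is_rank_le Rr; rewrite -ltnS in le.
have : levq r M \in flagq M'.
  by rewrite -e; apply/imsetP; exists (Ordinal le); rewrite ?inE.
case/imsetP => r'; rewrite inE => Rr' e'.
by rewrite e' (levq_rank_inj fM fM' _ _ e') // -ltnS.
Qed.

Lemma q_gt1 : (1 < q)%N.
Proof. exact: finNzRing_gt1. Qed.

(** A basis whose vector of index [i] lies in every member of the chain of dimension above [i] spans
    each member by its initial vectors; such bases exist because they can be counted. *)
Lemma chain_refine d : d \subset Q -> chain (@Bqle F t n) d ->
  exists2 M, all_free M & d \subset flagq M.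
Proof.
move=> /subsetP dQ /forall_inP ch.
(* In a chain this intersection is the smallest member of dimension above [i], or the full space if
   there is none, so it always has room for a further vector. *)
pose V (j : 'I_t) (i : nat) : {vspace vT} :=
  (\bigcap_(A in d | (i < \dim ((A : elt) j))%N) (A : elt) j)%VS.
have Vmono j i i' : (i <= i')%N -> (V j i <= V j i')%VS.
  move=> le; apply/subv_bigcapP => A /andP[dA lt]; apply: (bigcapv_inf A) => //.
  by rewrite dA (leq_ltn_trans le lt).
have Vdim j i : (i < n)%N -> (i < \dim (V j i))%N.
  move=> lt; case: (pickP (fun A : elt => (A \in d) && (i < \dim (A j))%N)) => [A PA|no].
    case: (@arg_minnP _ A (fun A : elt => (A \in d) && (i < \dim (A j))%N)
            (fun A : elt => \dim (A j)) PA) => A0 /andP[dA0 lt0] min0.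
    apply: leq_trans lt0 _; apply: dimvS; apply/subv_bigcapP => B /andP[dB ltB].
    have /forall_inP/(_ B dB) := ch A0 dA0.
    case/orP => /forallP/(_ j) // sBA.
    have : (B j == A0 j) by rewrite eqEdim sBA min0 // dB.
    by move/eqP->.
  by rewrite /V big_pred0 // dimvf dim_matrix mul1r.
have exs j : exists s : n.-tuple vT, adapted (V j) s.
  have : (0 < #|[set s : n.-tuple vT | adapted (V j) s]|)%N.
    rewrite card_adapted; last exact: Vmono.
    by rewrite prodn_gt0 // => i; rewrite subn_gt0 ltn_exp2l ?q_gt1 // Vdim.
  by case/card_gt0P => s; rewrite inE; exists s.
pose M : bases := [ffun j => xchoose (exs j)].
have adM j : adapted (V j) (M j) by rewrite ffunE; apply: (xchooseP (exs j)).
have fM : all_free M by apply/forallP => j; apply: adapted_free (adM j).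
exists M => //; apply/subsetP => A dA; have /mem_Q[r Rr Ar] := dQ A dA.
have le := is_rank_le Rr; have lt : (r < n.+1)%N by rewrite ltnS.
apply/imsetP; exists (Ordinal lt); rewrite ?inE //; apply/ffunP => j.
rewrite ffunE /=; apply/esym/eqP; rewrite eqEdim.
rewrite (Bqlevel_dim j Ar) span_drop_dim ?leqnn ?andbT //; last by have /forallP := fM.
apply: (adapted_sub (adapted_drop (n - r) (adM j))) => i.
rewrite size_drop size_tuple subKn // => lti.
by apply: (bigcapv_inf A) => //; rewrite dA (Bqlevel_dim j Ar).
Qed.

(** Every chain extends to the flag of some bases, and all such flags have the same number of
    elements. *)
Lemma max_chainsP c : reflect (exists2 M, all_free M & c = flagq M)
  (c \in max_chains (@Bqle F t n) Q).
Proof.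
rewrite inE; apply: (iffP maxsetP) => [[/andP[cQ ch] max_c]|[M fM ->]].
  have [M fM sub] := chain_refine cQ ch.
  by exists M => //; apply/esym/max_c => //; rewrite flagq_sub ?flagq_chain.
split; first by rewrite flagq_sub ?flagq_chain.
move=> d /andP[dQ ch] sub; have [M' fM' sub'] := chain_refine dQ ch.
apply/esym/eqP; rewrite eqEcard sub (card_flagq fM) -(card_flagq fM').
exact: subset_leq_card.
Qed.

Lemma card_bases (P : 'I_t -> pred (n.-tuple vT)) :
  #|[set M : bases | [forall j, P j (M j)]]| = (\prod_j #|[set s | P j s]|)%N.
Proof.
rewrite -(cardsXn (fun j => [set s | P j s])); apply: eq_card => M.
by rewrite !inE; apply: eq_forallb => j; rewrite inE.
Qed.

Lemma adapted_intro (V : nat -> {vspace vT}) (s : seq vT) : free s ->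
  (forall k, (k < size s)%N -> s`_k \in V (size s - k.+1)%N) -> adapted V s.
Proof.
elim: s => //= v s IH; rewrite free_cons => /andP[-> fs] H.
have := H 0%N isT; rewrite subn1 /= => -> /=.
by apply: IH => // k lt; have := H k.+1 lt; rewrite subSS.
Qed.

Lemma card_free_bases : #|[set M | all_free M]| =
  ((\prod_(i < n) (q ^ n - q ^ i)) ^ t)%N.
Proof.
rewrite (card_bases (fun _ s => free s)) prod_nat_const card_ord; congr (_ ^ _)%N.
have -> : [set s : n.-tuple vT | free s] =
          [set s : n.-tuple vT | adapted (fun=> fullv) s].
  apply/setP => s; rewrite !inE; apply/idP/idP => [fs|]; last exact: adapted_free.
  by apply: adapted_intro => // k _; rewrite memvf.
by rewrite card_adapted // dimvf dim_matrix mul1r.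
Qed.

(** The flag is that of [M0] exactly when each vector of index [i] lies in the member of that flag
    of rank [next_rank i]; this counts adapted bases. *)
Lemma card_flagq_fibre M0 : all_free M0 ->
  #|[set M | all_free M && (flagq M == flagq M0)]| =
  ((\prod_(i < n) (q ^ next_rank i - q ^ i)) ^ t)%N.
Proof.
move=> fM0; pose V j (i : nat) : {vspace vT} := <<drop (n - next_rank i) (M0 j)>>%VS.
have -> : [set M | all_free M && (flagq M == flagq M0)] =
          [set M : bases | [forall j, adapted (V j) (M j)]].
  apply/setP => M; rewrite !inE; apply/andP/forallP => [[fM eM] j|adM].
    move/(flagq_eqP fM fM0): eM => eM; apply: adapted_intro; first exact: (forallP fM).
    rewrite size_tuple => k lt.
    have lti : (n - k.+1 < n)%N by lia.
    have := eM _ (next_rankP U lti) => /ffunP/(_ j); rewrite !ffunE /V => <-.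
    have gt := next_rank_gt U (n - k.+1); apply: memv_span.
    have -> : (M j)`_k = (drop (n - next_rank (n - k.+1)) (M j))`_(k - (n - next_rank (n - k.+1))).
      by rewrite nth_drop subnKC //; lia.
    by apply: mem_nth; rewrite size_drop size_tuple; lia.
  have fM : all_free M by apply/forallP => j; apply: adapted_free (adM j).
  split=> //; apply/(flagq_eqP fM fM0) => r Rr; have le := is_rank_le Rr.
  apply/ffunP => j; rewrite !ffunE; apply/eqP; rewrite eqEdim.
  have [fj fj0] := (forallP fM j, forallP fM0 j).
  rewrite !span_drop_dim ?leqnn ?andbT //.
  apply: (adapted_sub (adapted_drop (n - r) (adM j))) => i.
  rewrite size_drop size_tuple subKn // => lti.
  by apply: span_drop_mono; apply: next_rank_min.
rewrite (card_bases (fun j s => adapted (V j) s)).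
rewrite (eq_bigr (fun _ => (\prod_(i < n) (q ^ next_rank i - q ^ i))%N)) => [|j _].
  by rewrite prod_nat_const card_ord.
rewrite card_adapted => [|i i' le]; last exact/span_drop_mono/next_rank_mono.
apply: eq_bigr => i _; rewrite span_drop_dim ?next_rank_le //.
exact: (forallP fM0).
Qed.

(** All tuples of bases are sorted by their flags, the maximal chains, and the fibres have a common
    size. *)
Theorem alpha_num_subspaces :
  (alpha_num (@Bqle F t n) (@Bqlevel F t n) U *
     (\prod_(i < n) (q ^ next_rank i - q ^ i)) ^ t =
   (\prod_(i < n) (q ^ n - q ^ i)) ^ t)%N.
Proof.
rewrite -card_free_bases -[RHS]sum1_card.
rewrite (partition_big flagq (mem (max_chains (@Bqle F t n) Q))) /=; last first.
  by move=> M; rewrite inE => fM; apply/max_chainsP; exists M.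
rewrite -sum_nat_const; apply: eq_bigr => c /max_chainsP[M0 fM0 ->].
rewrite -(card_flagq_fibre fM0) -sum1_card; apply: eq_bigl => M.
by rewrite !inE.
Qed.

End SubspaceChains.

(** * Principal specialisation *)

(** Serves twice: with tuples of partitions for the Frobenius expansion, and with sets of ranks for
    the homology character. *)
Lemma sum_prod_pairing (t : nat) (W : finType) (I : finType) (A : pred I)
    (c : I -> rat) (phi : I -> 'I_t -> W -> rat) (p : W -> {poly rat}) :
  \sum_(w : {ffun 'I_t -> W}) (\sum_(i | A i) c i * \prod_j phi i j (w j))
    *: \prod_j p (w j) =
  \sum_(i | A i) c i *: \prod_j \sum_w phi i j w *: p w.
Proof.
under eq_bigr do rewrite scaler_suml.
rewrite exchange_big /=; apply: eq_bigr => i _.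
rewrite bigA_distr_bigA scaler_sumr; apply: eq_bigr => w _ /=.
by rewrite scaler_prod scalerA.
Qed.

(** [g] is the q-multinomial of [U]; after cancelling the nonzero [D], its value at the field order
    is the ratio of the two counts of bases in one component. *)
Lemma alpha_num_horner (F : finFieldType) t n (U : {set 'I_n}) (g : {poly int}) :
  (0 < t)%N -> g * \prod_i (1 - 'X^(tailsize U i)) = qfact int n ->
  g.[#|F|%:R] ^+ t = (alpha_num (@Bqle F t n) (@Bqlevel F t n) U)%:R.
Proof.
move=> t_gt0 eg; set q := #|F|; set x : int := q%:R.
have q1 : (1 < q)%N by apply: finNzRing_gt1.
pose D : int := \prod_(i < n) (x ^+ next_rank U i - x ^+ i).
have castB (r i : nat) : (i <= r)%N -> (q ^ r - q ^ i)%N%:R = x ^+ r - x ^+ i.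
  by move=> le; rewrite natrB ?leq_exp2l // !natrX.
have D0 : D != 0.
  apply/prodf_neq0 => i _; have lt := next_rank_gt U i.
  by rewrite -(castB _ _ (ltnW lt)) Num.Theory.pnatr_eq0 -lt0n subn_gt0 ltn_exp2l.
have Dg : g.[x] * D = \prod_(i < n) (x ^+ n - x ^+ i).
  have := congr1 (fun p : {poly int} => p.[x]) eg.
  rewrite /qfact big_add1 big_mkord /= hornerM !horner_prod => e.
  (* Each factor splits off minus a power of [x], the gap between [i] and [next_rank U i] being
     [tailsize U i]. *)
  have -> : D = \prod_(i < n) (- x ^+ i) * \prod_i (1 - 'X^(tailsize U i)).[x].
    rewrite -big_split; apply: eq_bigr => i _ /=.
    by rewrite next_rankE exprD !hornerE; ring.
  (* Reversing the index pairs [- x ^+ i] with [1 - x ^+ (n - i)], which gives [x ^+ n - x ^+ i]. *)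
  rewrite mulrCA e [X in _ * X](reindex_inj rev_ord_inj) -big_split /=.
  apply: eq_bigr => i _; have lt := ltn_ord i.
  have -> : (n - i.+1).+1 = (n - i)%N by lia.
  have -> : x ^+ n = x ^+ i * x ^+ (n - i) by rewrite -exprD subnKC // ltnW.
  by rewrite !hornerE; ring.
apply: (mulIf (expf_neq0 t D0)); rewrite -exprMn Dg.
have := congr1 (fun k : nat => k%:R : int) (alpha_num_subspaces F U t_gt0).
have En : \prod_(i < n) (q ^ n - q ^ i)%N%:R = \prod_(i < n) (x ^+ n - x ^+ i).
  by apply: eq_bigr => i _; rewrite castB // ltnW.
have Ed : \prod_(i < n) (q ^ next_rank U i - q ^ i)%N%:R = D.
  by apply: eq_bigr => i _; rewrite castB // ltnW ?next_rank_gt.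
by rewrite natrM !natrX !natr_prod En Ed => ->.
Qed.

Lemma ps_trunc_schur (t n N : nat) (a : {ffun 'I_t -> intpart n} -> rat) :
  ps_trunc (\sum_mu a mu *:
     \prod_j schur (mu j) (fun i : 'I_N => 'X_(mxvec_index j i))) =
  \sum_mu a mu *: \prod_j schur (mu j) (fun i : 'I_N => 'X^i : {poly rat}).
Proof.
rewrite /ps_trunc rmorph_sum; apply: eq_bigr => mu _ /=.
rewrite mmapZ mul_polyC; congr (_ *: _); rewrite rmorph_prod; apply: eq_bigr => j _ /=.
rewrite /schur rmorph_sum; apply: eq_bigr => T _ /=.
rewrite rmorph_prod; apply: eq_bigr => i _ /=.
by rewrite mmapX mmap1U mxvecE mxE.
Qed.

(** The orders of finite fields are infinitely many, so the values determine [P]: it is the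
    polynomial reading of the numerator. The clause on existence keeps the last one from being
    vacuous. *)
Theorem theorem7p2 (t n : nat) (t_gt0 : (0 < t)%N) (n_gt0 : (0 < n)%N)
    (J : {set 'I_n}) (J_gt0 : forall r : 'I_n, r \in J -> (0 < r)%N) :
  exists P : {poly int},
    (forall F : finFieldType,
       P.[#|F|%:R] = beta_num (@Bqle F t n) (@Bqlevel F t n) J) /\
    (exists beta : symfun t, is_prod_frob (@top_homology_char t n J) beta) /\
    (forall beta : symfun t, is_prod_frob (@top_homology_char t n J) beta ->
       is_ps beta
         (ser_div (ser_of_poly (map_poly intr P))
                  (ser_of_poly (\prod_(1 <= i < n.+1) (1 - 'X^i) ^+ t)))).
Proof.
have [g eg] := fin_all_exists (fun U : {set 'I_n} => tail_qmultinomial U int).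
pose sgn (U : {set 'I_n}) := (#|J| - #|U|)%N.
(* [g U] is the integral q-multinomial of [U]; its t-th power interpolates [alpha_num] at [U]. *)
exists (\sum_(U : {set 'I_n} | U \subset J) (-1) ^+ sgn U * g U ^+ t).
split=> [F|].
  rewrite horner_sum; apply: eq_bigr => U _.
  by rewrite hornerM horner_exp hornerN hornerC horner_exp (alpha_num_horner F t_gt0 (eg U)).
split.
  (* Each [psi U] is a class function, so it expands in Specht characters; products of the
     expansions give the coefficients. *)
  have [k ek] := fin_all_exists (fun U : {set 'I_n} => specht_char_span (psi_conj U)).
  pose a (mu : {ffun 'I_t -> intpart n}) : rat :=
    \sum_(U : {set 'I_n} | U \subset J) (-1) ^+ sgn U * \prod_j k U (mu j).
  exists (fun N => \sum_mu a mu *: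
            \prod_j schur (mu j) (fun i : 'I_N => 'X_(mxvec_index j i))).
  exists a; split=> // w; rewrite top_homology_charE //.
  under [RHS]eq_bigr do rewrite mulr_suml.
  rewrite [RHS]exchange_big /=; apply: eq_bigr => U _.
  under eq_bigr do rewrite ek.
  rewrite bigA_distr_bigA mulr_sumr; apply: eq_bigr => mu _ /=.
  by rewrite big_split mulrA.
(* With more than [m] letters the coefficient of degree [m] has already reached its limit. *)
move=> beta [a [phiE betaE]] m; exists m.+1 => N lt_mN.
pose h U : {poly rat} := map_poly intr (g U).
have eh U : h U * \prod_i (1 - 'X^(tailsize U i)) = qfact rat n.
  have := congr1 (map_poly (intr : int -> rat)) (eg U).
  rewrite rmorphM /= rmorph_prod => e; rewrite /h.
  transitivity (map_poly (intr : int -> rat) (qfact int n)).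
    rewrite -e; congr (_ * _); apply: eq_bigr => i _.
    by rewrite rmorphB rmorph1 /= map_polyXn.
  by rewrite rmorph_prod; apply: eq_bigr => i _; rewrite rmorphB rmorph1 /= map_polyXn.
have nf : n`!%:R != 0 :> rat by rewrite Num.Theory.pnatr_eq0 -lt0n fact_gt0.
have psT : ps_trunc (beta N) = \sum_(U : {set 'I_n} | U \subset J)
    (-1) ^+ sgn U *: gf_sorted U N ^+ t.
  rewrite betaE ps_trunc_schur.
  (* Frobenius's formula in each factor removes the coefficients [a]: only the character itself
     remains, averaged against power sums. *)
  transitivity ((n`!%:R^-1) ^+ t *: \sum_(w : {ffun 'I_t -> {perm 'I_n}})
      top_homology_char J w *: \prod_j pi_word N (w j)).
    under [X in _ = _ *: X]eq_bigr do rewrite phiE.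
    rewrite (sum_prod_pairing predT a (fun mu j => specht_char (mu j)) (pi_word N)).
    rewrite scaler_sumr; apply: eq_bigr => mu _; rewrite scalerA mulrC -scalerA.
    congr (_ *: _); under eq_bigr do rewrite schur_principal.
    by rewrite scaler_prod prodr_const card_ord.
  under eq_bigr do rewrite top_homology_charE //.
  rewrite (sum_prod_pairing _ _ (fun U _ => psi U) (pi_word N)) scaler_sumr.
  apply: eq_bigr => U _; rewrite scalerA mulrC -scalerA; congr (_ *: _).
  by rewrite prodr_const card_ord -exprZn psi_pairing.
(* The denominator has constant coefficient 1; the other goal is the truncated product identity,
   proved for each [U] separately. *)
apply/esym/ser_div_coef.
  rewrite -horner_coef0 horner_prod big_add1 big_mkord; apply/prodf_neq0 => i _.
  rewrite horner_exp hornerD hornerN hornerXn hornerC expr0n /= subr0.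
  by rewrite expr1n oner_neq0.
rewrite psT prodrXl -/(qfact rat n) mulr_suml rmorph_sum /=.
apply: eqX_sum => U _; rewrite rmorphM !rmorphXn rmorphN rmorph1 /= -scalerAl -exprMn.
rewrite -mul_polyC polyC_exp polyCN; apply: eqXM => //.
by apply: eqXX => k lt; apply: (gf_sorted_qfact (eh U)); apply: leq_trans lt lt_mN.
Qed.
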